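(* The system $\Pi^1_1\text{-}\mathsf{CA}_0^\omega+\mathsf{BW}_0^C$ proves $\Pi^1_2\text{-}\mathsf{CA}_0$, where $\mathsf{BW}_0^C$ is the statement: for any countable $A\subset 2^{\mathbb{N}}$ and any $F:2^{\mathbb{N}}\to 2^{\mathbb{N}}$, the supremum $\sup_{f\in A}F(f)$ exists.
   Context: Finite types: $0$ is a type (natural numbers), and if $\sigma,\tau$ are types then so is $\sigma\to\tau$; $1:=0\to 0$ and $n+1:=n\to 0$; superscripts indicate types. $\mathsf{L}_\omega$ is the many-sorted language with variables of every finite type, constants $0,1,<_0,+_0,\times_0,=_0$ (with usual meaning), typed combinators $\Pi,\Sigma$, and recursor constants $\mathbf{R}_\sigma$. For $\tau=(\tau_1\to\dots\to\tau_k\to 0)$, $x=_\tau y$ abbreviates $\forall z_1^{\tau_1}\dots z_k^{\tau_k}(xz_1\dots z_k=_0 yz_1\dots z_k)$. $\mathsf{QF\text{-}AC}^{\sigma,\tau}$ is the schema $(\forall x^\sigma)(\exists y^\tau)A(x,y)\to(\exists Y^{\sigma\to\tau})(\forall x^\sigma)A(x,Y(x))$ for quantifier-free $A$ of $\mathsf{L}_\omega$. $\mathsf{RCA}_0^\omega$ (Kohlenbach's base theory, classical logic) has the following axioms: ordered semi-ring axioms for $0,1,<_0,+_0,\times_0$; defining axioms of $\Pi,\Sigma$ (giving $\lambda$-abstraction); $\mathbf{R}_0(f,m,0)=m$ and $\mathbf{R}_0(f,m,n+1)=f(n,\mathbf{R}_0(f,m,n))$; extensionality $x=_\rho y\to\varphi(x)=_\tau\varphi(y)$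 for all types $\rho,\tau$; induction for quantifier-free formulas of $\mathsf{L}_\omega$; and $\mathsf{QF\text{-}AC}^{1,0}$. Finite sequences are coded as usual. $\Pi^1_1\text{-}\mathsf{CA}_0^\omega:=\mathsf{RCA}_0^\omega+(\mathsf{S}^2)$, where $(\mathsf{S}^2)$ states the existence of the Suslin functional: there is $\mathsf{S}^2$ with values in $\{0,1\}$ such that $(\forall f^1)[(\exists g^1)(\forall n^0)(f(\overline{g}n)=0)\leftrightarrow\mathsf{S}(f)=0]$, with $\overline{g}n=\langle g(0),\dots,g(n-1)\rangle$. $\Pi^1_2\text{-}\mathsf{CA}_0$ is the usual second-order system whose characteristic axiom is comprehension (existence of subsets of $\mathbb{N}$, identified with characteristic functions) for $\Pi^1_2$-formulas of second-order arithmetic with first- and second-order parameters. Subsets of $2^{\mathbb{N}}$ are given by characteristic functions; $A\subset 2^{\mathbb{N}}$ is countable if there is $Y:2^{\mathbb{N}}\to\mathbb{N}$ which is injective on $A$, i.e. $(\forall f,g\in A)(Y(f)=Y(g)\to f=_1 g)$. The supremum is the least upper bound with respect to the lexicographic order on $2^{\mathbb{N}}$. *)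

(* Defs.v *)
From Stdlib Require Import List.
Import ListNotations.

Set Implicit Arguments.
Unset Strict Implicit.
Unset Printing Implicit Defensive.

Inductive ty : Set :=
| tO : ty
| tA : ty -> ty -> ty.

Declare Scope ty_scope.
Delimit Scope ty_scope with ty.
Bind Scope ty_scope with ty.
Notation "s ⇒ t" := (tA s t) (at level 60, right associativity) : ty_scope.
Notation t1 := (tA tO tO).
Notation t2 := (tA t1 tO).
Local Open Scope ty_scope.

Implicit Types V W : ty -> Set.

Inductive cst : ty -> Set :=
| cZero : cst tO
| cOne : cst tO
| cAdd : cst (tO ⇒ tO ⇒ tO)
| cMul : cst (tO ⇒ tO ⇒ tO)
| cPi s t : cst (s ⇒ t ⇒ s)
| cSigma r s t : cst ((r ⇒ s ⇒ t) ⇒ (r ⇒ s) ⇒ r ⇒ t)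
| cRec s : cst ((tO ⇒ s ⇒ s) ⇒ s ⇒ tO ⇒ s).

(** Syntax is well typed and well scoped: [V s] is the collection of the
    variables of type [s] that may occur free, and a quantifier over [s] binds
    the new variable [E0] of [ext V s]. *)

Inductive ext (V : ty -> Set) (s : ty) : ty -> Set :=
| E0 : ext V s s
| ES t : V t -> ext V s t.
Arguments E0 {V s}.
Arguments ES {V s t} _.

Inductive tm (V : ty -> Set) : ty -> Set :=
| Var s : V s -> tm V s
| Cst s : cst s -> tm V s
| App s t : tm V (s ⇒ t) -> tm V s -> tm V t.
Arguments Var {V s} _.
Arguments Cst {V s} _.
Arguments App {V s t} _ _.

Inductive fm (V : ty -> Set) : Set :=
| Eq : tm V tO -> tm V tO -> fm V
| Lt : tm V tO -> tm V tO -> fm V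
| Bot : fm V
| Imp : fm V -> fm V -> fm V
| All s : fm (ext V s) -> fm V.
Arguments Bot {V}.
Arguments All {V} s _.

Definition Not {V} (a : fm V) : fm V := Imp a Bot.
Definition And {V} (a b : fm V) : fm V := Not (Imp a (Not b)).
Definition Or {V} (a b : fm V) : fm V := Imp (Not a) b.
Definition Iff {V} (a b : fm V) : fm V := And (Imp a b) (Imp b a).
Definition Ex {V} s (a : fm (ext V s)) : fm V := Not (All s (Not a)).
Arguments Ex {V} s _.

Fixpoint quantifier_free {V} (a : fm V) : Prop :=
  match a with
  | Eq _ _ | Lt _ _ | Bot => True
  | Imp a b => quantifier_free a /\ quantifier_free b
  | All _ _ => False
  end.

Declare Scope tm_scope.
Delimit Scope tm_scope with tm.
Bind Scope tm_scope with tm.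
Notation "f · x" := (App f x) (at level 29, left associativity) : tm_scope.
Notation "0" := (Cst cZero) : tm_scope.
Notation "1" := (Cst cOne) : tm_scope.
Notation "x + y" := (App (App (Cst cAdd) x) y) : tm_scope.
Notation "x * y" := (App (App (Cst cMul) x) y) : tm_scope.
Notation "x '=₀' y" := (Eq x%tm y%tm) (at level 70).
Notation "x '<₀' y" := (Lt x%tm y%tm) (at level 70).
Local Open Scope tm_scope.

Definition up_ren {V W : ty -> Set} {s} (r : forall t, V t -> W t)
    (t : ty) (x : ext V s t) : ext W s t :=
  match x in ext _ _ t return ext W s t with
  | E0 => E0
  | ES x => ES (r _ x)
  end.

Fixpoint ren_tm {V W : ty -> Set} (r : forall t, V t -> W t) {t} (u : tm V t) :
    tm W t :=
  match u with
  | Var x => Var (r _ x)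
  | Cst c => Cst c
  | App u v => App (ren_tm r u) (ren_tm r v)
  end.

Fixpoint ren_fm {V W : ty -> Set} (r : forall t, V t -> W t) (a : fm V) : fm W :=
  match a with
  | Eq u v => Eq (ren_tm r u) (ren_tm r v)
  | Lt u v => Lt (ren_tm r u) (ren_tm r v)
  | Bot => Bot
  | Imp a b => Imp (ren_fm r a) (ren_fm r b)
  | All s a => All s (ren_fm (up_ren r) a)
  end.

Definition wk {V s t} (u : tm V t) : tm (ext V s) t :=
  ren_tm (fun _ x => ES x) u.
Definition wk_fm {V s} (a : fm V) : fm (ext V s) :=
  ren_fm (fun _ x => ES x) a.

Definition up {V W : ty -> Set} {s} (r : forall t, V t -> tm W t)
    (t : ty) (x : ext V s t) : tm (ext W s) t :=
  match x in ext _ _ t return tm (ext W s) t with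
  | E0 => Var E0
  | ES x => wk (r _ x)
  end.

Fixpoint sub_tm {V W : ty -> Set} (r : forall t, V t -> tm W t) {t}
    (u : tm V t) : tm W t :=
  match u with
  | Var x => r _ x
  | Cst c => Cst c
  | App u v => App (sub_tm r u) (sub_tm r v)
  end.

Fixpoint sub_fm {V W : ty -> Set} (r : forall t, V t -> tm W t) (a : fm V) :
    fm W :=
  match a with
  | Eq u v => Eq (sub_tm r u) (sub_tm r v)
  | Lt u v => Lt (sub_tm r u) (sub_tm r v)
  | Bot => Bot
  | Imp a b => Imp (sub_fm r a) (sub_fm r b)
  | All s a => All s (sub_fm (up r) a)
  end.

Definition scons {V W : ty -> Set} {s} (u : tm W s) (r : forall t, V t -> tm W t)
    (t : ty) (x : ext V s t) : tm W t :=
  match x in ext _ _ t return tm W t with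
  | E0 => u
  | ES x => r _ x
  end.

Definition inst {V s} (a : fm (ext V s)) (u : tm V s) : fm V :=
  sub_fm (scons u (fun _ x => Var x)) a.

Definition v0 {V s} : tm (ext V s) s := Var E0.
Definition v1 {V r s} : tm (ext (ext V s) r) s := Var (ES E0).
Definition v2 {V q r s} : tm (ext (ext (ext V s) r) q) s := Var (ES (ES E0)).

(** Bracket abstraction [λ x^s. u] in terms of the combinators. *)
Fixpoint lam {V : ty -> Set} {s t : ty} (u : tm (ext V s) t) : tm V (s ⇒ t) :=
  match u in tm _ t return tm V (s ⇒ t) with
  | Var x =>
      match x in ext _ _ t return tm V (s ⇒ t) with
      | E0 => Cst (cSigma s (s ⇒ s) s) · Cst (cPi s (s ⇒ s)) · Cst (cPi s s)
      | ES x => Cst (cPi _ s) · Var x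
      end
  | Cst c => Cst (cPi _ s) · Cst c
  | App u v => Cst (cSigma _ _ _) · lam u · lam v
  end.

Fixpoint EqT {V : ty -> Set} (t : ty) : tm V t -> tm V t -> fm V :=
  match t with
  | tO => fun x y => x =₀ y
  | tA r s => fun x y => All r (EqT (wk x · v0) (wk y · v0))
  end.

(** Classical many-sorted natural deduction, in which equality at type [0] is
    logical equality; equality at higher types is only the abbreviation [EqT].
    [T V] gives the axioms with free variables among [V]. *)

Definition theory := forall V : ty -> Set, fm V -> Prop.

Inductive prv (T : theory) : forall V : ty -> Set, list (fm V) -> fm V -> Prop :=
| prv_ax V (G : list (fm V)) a : T V a -> prv T G a
| prv_hyp V (G : list (fm V)) a : In a G -> prv T G a
| prv_impI V (G : list (fm V)) a b : prv T (a :: G) b -> prv T G (Imp a b)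
| prv_impE V (G : list (fm V)) a b : prv T G (Imp a b) -> prv T G a -> prv T G b
| prv_raa V (G : list (fm V)) a : prv T (Not a :: G) Bot -> prv T G a
| prv_allI V (G : list (fm V)) s (a : fm (ext V s)) :
    prv T (map wk_fm G) a -> prv T G (All s a)
| prv_allE V (G : list (fm V)) s (a : fm (ext V s)) u :
    prv T G (All s a) -> prv T G (inst a u)
| prv_eq_refl V (G : list (fm V)) x : prv T G (x =₀ x)
| prv_eq_leibniz V (G : list (fm V)) x y (a : fm (ext V tO)) :
    prv T G (x =₀ y) -> prv T G (inst a x) -> prv T G (inst a y).

Definition no_var : ty -> Set := fun _ => Empty_set.

Definition proves (T : theory) (a : fm no_var) : Prop := prv T [] a.

(** The terms occurring in an axiom are arbitrary, possibly open; in the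
    schemata, parameters are the free variables of [V]. Only the recursor of
    type [0] is axiomatized. *)
Inductive RCA0w (V : ty -> Set) : fm V -> Prop :=
| ax_addA (x y z : tm V tO) : RCA0w (x + (y + z) =₀ x + y + z)
| ax_addC (x y : tm V tO) : RCA0w (x + y =₀ y + x)
| ax_add0 (x : tm V tO) : RCA0w (x + 0 =₀ x)
| ax_mulA (x y z : tm V tO) : RCA0w (x * (y * z) =₀ x * y * z)
| ax_mulC (x y : tm V tO) : RCA0w (x * y =₀ y * x)
| ax_mul1 (x : tm V tO) : RCA0w (x * 1 =₀ x)
| ax_mul0 (x : tm V tO) : RCA0w (x * 0 =₀ 0)
| ax_mulD (x y z : tm V tO) : RCA0w (x * (y + z) =₀ x * y + x * z)
| ax_lt_irr (x : tm V tO) : RCA0w (Not (x <₀ x))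
| ax_lt_trans (x y z : tm V tO) :
    RCA0w (Imp (x <₀ y) (Imp (y <₀ z) (x <₀ z)))
| ax_lt_total (x y : tm V tO) :
    RCA0w (Or (x <₀ y) (Or (x =₀ y) (y <₀ x)))
| ax_lt_add (x y z : tm V tO) : RCA0w (Imp (x <₀ y) (x + z <₀ y + z))
| ax_lt_mul (x y z : tm V tO) :
    RCA0w (Imp (0 <₀ z) (Imp (x <₀ y) (x * z <₀ y * z)))
| ax_lt01 : RCA0w (0 <₀ 1)
| ax_Pi s t (x : tm V s) (y : tm V t) :
    RCA0w (EqT (Cst (cPi s t) · x · y) x)
| ax_Sigma r s t (x : tm V (r ⇒ s ⇒ t)) (y : tm V (r ⇒ s)) (z : tm V r) :
    RCA0w (EqT (Cst (cSigma r s t) · x · y · z) (x · z · (y · z)))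
| ax_Rec0 (f : tm V (tO ⇒ tO ⇒ tO)) (m : tm V tO) :
    RCA0w (Cst (cRec tO) · f · m · 0 =₀ m)
| ax_RecS (f : tm V (tO ⇒ tO ⇒ tO)) (m n : tm V tO) :
    RCA0w (Cst (cRec tO) · f · m · (n + 1)
             =₀ f · n · (Cst (cRec tO) · f · m · n))
| ax_ext r t (x y : tm V r) (f : tm V (r ⇒ t)) :
    RCA0w (Imp (EqT x y) (EqT (f · x) (f · y)))
| ax_ind (a : fm (ext V tO)) :
    quantifier_free a ->
    RCA0w (Imp (inst a 0)
             (Imp (All tO (Imp a (sub_fm (scons (v0 + 1) (fun _ x => Var (ES x))) a)))
                (All tO a)))
| ax_QFAC (a : fm (ext (ext V t1) tO)) :
    quantifier_free a ->
    RCA0w (Imp (All t1 (Ex tO a))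
             (Ex t2 (All t1
                (sub_fm
                   (scons (v1 · v0) (scons v0 (fun _ x => Var (ES (ES x))))) a)))).

Definition add_axiom (T : theory) (A : forall V, fm V) : theory :=
  fun V a => T V a \/ a = A V.

Definition Bin {V} (x : tm V tO) : fm V := Or (x =₀ 0) (x =₀ 1).

(** Sequence codes: [⟨⟩ = 0] and [s * ⟨x⟩ = j(s,x) + 1], where
    [j(s,x) = (s+x)^2 + s] is an injective pairing. *)
Definition snoc {V} (s x : tm V tO) : tm V tO := (s + x) * (s + x) + s + 1.

(** [initial g n] is the code of [⟨g(0), ..., g(n-1)⟩]. *)
Definition initial {V} (g : tm V t1) (n : tm V tO) : tm V tO :=
  Cst (cRec tO) · lam (lam (snoc v0 (wk (wk g) · v1))) · 0 · n.

Definition is_suslin {V} (S : tm V t2) : fm V :=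
  All t1 (And (Bin (wk S · v0))
              (Iff (Ex t1 (All tO (v2 · initial v1 v0 =₀ 0)))
                   (wk S · v0 =₀ 0))).

Definition S2 (V : ty -> Set) : fm V := Ex t2 (is_suslin v0).

Definition Pi11CA0w : theory := add_axiom RCA0w S2.

Definition Cantor {V} (f : tm V t1) : fm V := All tO (Bin (wk f · v0)).
Definition AllC {V} (a : fm (ext V t1)) : fm V := All t1 (Imp (Cantor v0) a).
Definition ExC {V} (a : fm (ext V t1)) : fm V := Ex t1 (And (Cantor v0) a).

Definition is_subset {V} (A : tm V t2) : fm V := AllC (Bin (wk A · v0)).
Definition elt {V} (f : tm V t1) (A : tm V t2) : fm V := A · f =₀ 1.

Definition countable {V} (A : tm V t2) : fm V :=
  Ex t2 (AllC (AllC
    (Imp (elt v1 (wk (wk (wk A))))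
      (Imp (elt v0 (wk (wk (wk A))))
        (Imp (v2 · v1 =₀ v2 · v0) (EqT v1 v0)))))).

Definition lex_le {V} (g h : tm V t1) : fm V :=
  Or (EqT g h)
     (Ex tO (And (All tO (Imp (v0 <₀ v1) (wk (wk g) · v0 =₀ wk (wk h) · v0)))
                 (wk g · v0 <₀ wk h · v0))).

Definition upper_bound {V} (A : tm V t2) (F : tm V (t1 ⇒ t1)) (h : tm V t1) : fm V :=
  AllC (Imp (elt v0 (wk A)) (lex_le (wk F · v0) (wk h))).

Definition is_sup {V} (A : tm V t2) (F : tm V (t1 ⇒ t1)) (h : tm V t1) : fm V :=
  And (upper_bound A F h)
      (AllC (Imp (upper_bound (wk A) (wk F) v0) (lex_le (wk h) v0))).

Definition BW0C (V : ty -> Set) : fm V :=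
  All t2 (Imp (And (is_subset v0) (countable v0))
    (All (t1 ⇒ t1) (Imp (AllC (Cantor (v1 · v0)))
      (ExC (is_sup v2 v1 v0))))).

Implicit Types N P : Set.

(** [N] and [P] are the collections of free number and set variables; the
    variable bound by a quantifier is [None]. *)

Inductive tm2 (N : Set) : Set :=
| Var2 : N -> tm2 N
| Zero2 : tm2 N
| One2 : tm2 N
| Add2 : tm2 N -> tm2 N -> tm2 N
| Mul2 : tm2 N -> tm2 N -> tm2 N.
Arguments Zero2 {N}.
Arguments One2 {N}.

Inductive fm2 (N P : Set) : Set :=
| Eq2 : tm2 N -> tm2 N -> fm2 N P
| Lt2 : tm2 N -> tm2 N -> fm2 N P
| Mem2 : tm2 N -> P -> fm2 N P
| Bot2 : fm2 N P
| Imp2 : fm2 N P -> fm2 N P -> fm2 N P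
| AllN : fm2 (option N) P -> fm2 N P
| AllS : fm2 N (option P) -> fm2 N P.
Arguments Eq2 {N P} _ _.
Arguments Lt2 {N P} _ _.
Arguments Mem2 {N P} _ _.
Arguments Bot2 {N P}.

Definition Not2 {N P} (a : fm2 N P) : fm2 N P := Imp2 a Bot2.
Definition And2 {N P} (a b : fm2 N P) : fm2 N P := Not2 (Imp2 a (Not2 b)).
Definition Or2 {N P} (a b : fm2 N P) : fm2 N P := Imp2 (Not2 a) b.
Definition Iff2 {N P} (a b : fm2 N P) : fm2 N P := And2 (Imp2 a b) (Imp2 b a).
Definition ExS {N P} (a : fm2 N (option P)) : fm2 N P := Not2 (AllS (Not2 a)).

Fixpoint arithmetical {N P} (a : fm2 N P) : Prop :=
  match a with
  | Eq2 _ _ | Lt2 _ _ | Mem2 _ _ | Bot2 => True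
  | Imp2 a b => arithmetical a /\ arithmetical b
  | AllN a => arithmetical a
  | AllS _ => False
  end.

Definition is_Pi12 {N P} (a : fm2 N P) : Prop :=
  exists b, arithmetical b /\ a = AllS (ExS b).

Fixpoint ren_tm2 {N N'} (r : N -> N') (u : tm2 N) : tm2 N' :=
  match u with
  | Var2 x => Var2 (r x)
  | Zero2 => Zero2
  | One2 => One2
  | Add2 u v => Add2 (ren_tm2 r u) (ren_tm2 r v)
  | Mul2 u v => Mul2 (ren_tm2 r u) (ren_tm2 r v)
  end.

Fixpoint ren_fm2 {N P N' P'} (r : N -> N') (q : P -> P') (a : fm2 N P) : fm2 N' P' :=
  match a with
  | Eq2 u v => Eq2 (ren_tm2 r u) (ren_tm2 r v)
  | Lt2 u v => Lt2 (ren_tm2 r u) (ren_tm2 r v)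
  | Mem2 u X => Mem2 (ren_tm2 r u) (q X)
  | Bot2 => Bot2
  | Imp2 a b => Imp2 (ren_fm2 r q a) (ren_fm2 r q b)
  | AllN a => AllN (ren_fm2 (option_map r) q a)
  | AllS a => AllS (ren_fm2 r (option_map q) a)
  end.

Fixpoint fin (n : nat) : Set :=
  match n with
  | O => Empty_set
  | S n => option (fin n)
  end.

Definition sentence2 := fm2 Empty_set Empty_set.

Fixpoint closeN (n : nat) : forall {P}, fm2 (fin n) P -> fm2 Empty_set P :=
  match n with
  | O => fun P a => a
  | S n => fun P a => closeN (n := n) (AllN a)
  end.

Fixpoint closeS (m : nat) : forall {N}, fm2 N (fin m) -> fm2 N Empty_set :=
  match m with
  | O => fun N a => a
  | S m => fun N a => closeS (m := m) (AllS a)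
  end.

Definition close (n m : nat) (a : fm2 (fin n) (fin m)) : sentence2 :=
  closeS (closeN a).

Definition x0 {N} : tm2 (option N) := Var2 None.
Definition x1 {N} : tm2 (option (option N)) := Var2 (Some None).

Inductive Pi12CA0 : sentence2 -> Prop :=
| ax2_succ_ne0 : Pi12CA0 (AllN (Not2 (Eq2 (Add2 x0 One2) Zero2)))
| ax2_succ_inj :
    Pi12CA0 (AllN (AllN (Imp2 (Eq2 (Add2 x1 One2) (Add2 x0 One2)) (Eq2 x1 x0))))
| ax2_add0 : Pi12CA0 (AllN (Eq2 (Add2 x0 Zero2) x0))
| ax2_addS :
    Pi12CA0 (AllN (AllN (Eq2 (Add2 x1 (Add2 x0 One2)) (Add2 (Add2 x1 x0) One2))))
| ax2_mul0 : Pi12CA0 (AllN (Eq2 (Mul2 x0 Zero2) Zero2))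
| ax2_mulS :
    Pi12CA0 (AllN (AllN (Eq2 (Mul2 x1 (Add2 x0 One2)) (Add2 (Mul2 x1 x0) x1))))
| ax2_lt0 : Pi12CA0 (AllN (Not2 (Lt2 x0 Zero2)))
| ax2_ltS :
    Pi12CA0 (AllN (AllN (Iff2 (Lt2 x1 (Add2 x0 One2)) (Or2 (Lt2 x1 x0) (Eq2 x1 x0)))))
| ax2_ind :
    Pi12CA0 (AllS (Imp2 (And2 (Mem2 Zero2 None)
                              (AllN (Imp2 (Mem2 x0 None) (Mem2 (Add2 x0 One2) None))))
                        (AllN (Mem2 x0 None))))
| ax2_comp n m (a : fm2 (option (fin n)) (fin m)) :
    is_Pi12 a ->
    Pi12CA0 (close (n := n) (m := m)
      (ExS (AllN (Iff2 (Mem2 x0 None) (ren_fm2 (fun x => x) Some a))))).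

(** Sets are read as characteristic functions: set quantifiers range over
    [Cantor], and [u ∈ X] becomes [X(u) = 1]. *)

Fixpoint tr_tm {N V} (nu : N -> tm V tO) (u : tm2 N) : tm V tO :=
  match u with
  | Var2 x => nu x
  | Zero2 => 0
  | One2 => 1
  | Add2 u v => tr_tm nu u + tr_tm nu v
  | Mul2 u v => tr_tm nu u * tr_tm nu v
  end.

Definition ocons {A : Set} {V s t} (xi : A -> tm V t) (u : tm (ext V s) t) (x : option A) :
    tm (ext V s) t :=
  match x with
  | None => u
  | Some x => wk (xi x)
  end.

Fixpoint tr {N P} (a : fm2 N P) :
    forall V : ty -> Set, (N -> tm V tO) -> (P -> tm V t1) -> fm V :=
  match a with
  | Eq2 u v => fun V nu xi => tr_tm nu u =₀ tr_tm nu v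
  | Lt2 u v => fun V nu xi => tr_tm nu u <₀ tr_tm nu v
  | Mem2 u X => fun V nu xi => xi X · tr_tm nu u =₀ 1
  | Bot2 => fun V nu xi => Bot
  | Imp2 a b => fun V nu xi => Imp (tr a nu xi) (tr b nu xi)
  | AllN a => fun V nu xi => All tO (tr a (ocons nu v0) (fun X => wk (xi X)))
  | AllS a => fun V nu xi => AllC (tr a (fun x => wk (nu x)) (ocons xi v0))
  end.

Definition no_env {V t} (x : Empty_set) : tm V t := match x with end.

Definition tr_sentence (a : sentence2) : fm no_var := tr a no_env no_env.

(** To prove a second-order system is to prove all of its axioms. *)
Definition proves_system (T : theory) (T2 : sentence2 -> Prop) : Prop :=
  forall a, T2 a -> proves T (tr_sentence a).

(* Main.v *)
From Stdlib Require Import List ssreflect Classical ClassicalEpsilon.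
From Stdlib Require Import FunctionalExtensionality Eqdep_dec ProofIrrelevance.
From Stdlib Require Import PropExtensionality Arith Lia Cantor Ring.
Require Import Defs.
Import ListNotations.

(** By completeness it suffices to argue in a Henkin model, taken extensional. There
    the Suslin functional makes every relation of the form [∃ Y ∀ n, Q], with [Q]
    continuous in [Y], decidable by an element of the model, uniformly in the parameters.

    An arithmetical formula is brought into the form [∃ h ∀ n, Q] by Skolem functions, so
    a [Σ¹₂] set is [C = {i | ∃ X, the tree of (i, X) is well founded}]. As in the proof of
    Kondo's theorem there is for each [i] in [C] a unique such [X] for which the sequence
    (rank of node 0, X(0), rank of node 1, X(1), ...) is lexicographically least, and this
    [X] can be recognized: an [X'] that beats [X] comes with a simulation of its tree in
    that of [X], so its existence is a [Σ¹₁] statement. Finally let [A] be the set of pairs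
    of a finite subset [W] of [C] and the sequence of the witnesses for the elements of
    [W]. It is countable because the witnesses are unique, and the supremum over [A] of
    the characteristic functions of the sets [W] is that of [C]. *)

Set Implicit Arguments.
Unset Strict Implicit.
Unset Printing Implicit Defensive.
Local Open Scope ty_scope.
Local Open Scope general_if_scope.

(** * Substitution *)

(** The obstacle is countability: [BW0C] asks for a functional of the model that is injective on the
    set, so an index may contribute one witness only, and whether something is that witness must be
    decided in the model. The Suslin functional handles a single function quantifier, whereas
    leastness compares with all competitors, each of which would have to be well founded. Two facts
    remove the second quantifier: the nodes of the well-founded tree of [Z] name every rank that a
    smaller competitor can have, and a tree simulated in a well-founded one is itself well founded.
    Finite sets of indices are used because the supremum is lexicographic: single indices would only
    yield the least element of the domain, while finite sets approximate the domain on every initial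
    segment. The Skolem functions return the truth value of the formula, true or false, so that
    implications do not add quantifiers. Recursion is available for values of type 0 only, so
    functions are built through codes of their histories. *)

Definition rens (V W : ty -> Set) := forall t, V t -> W t.
Definition subs (V W : ty -> Set) := forall t, V t -> tm W t.

Lemma subs_eq V W (r q : subs V W) : (forall t x, r t x = q t x) -> r = q.
Proof.
  move=> e; apply: functional_extensionality_dep => t.
  exact: functional_extensionality (e t).
Qed.

Lemma ren_ren_tm U V W (r : rens U V) (q : rens V W) t (u : tm U t) :
  ren_tm q (ren_tm r u) = ren_tm (fun s x => q s (r s x)) u.
Proof. by elim: u => //= s' t' u -> v ->. Qed.

Lemma sub_ren_tm U V W (r : rens U V) (q : subs V W) t (u : tm U t) :
  sub_tm q (ren_tm r u) = sub_tm (fun s x => q s (r s x)) u.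
Proof. by elim: u => //= s' t' u -> v ->. Qed.

Lemma ren_sub_tm U V W (r : subs U V) (q : rens V W) t (u : tm U t) :
  ren_tm q (sub_tm r u) = sub_tm (fun s x => ren_tm q (r s x)) u.
Proof. by elim: u => //= s' t' u -> v ->. Qed.

Lemma sub_sub_tm U V W (r : subs U V) (q : subs V W) t (u : tm U t) :
  sub_tm q (sub_tm r u) = sub_tm (fun s x => sub_tm q (r s x)) u.
Proof. by elim: u => //= s' t' u -> v ->. Qed.

Lemma sub_var_tm V t (u : tm V t) : sub_tm (fun _ x => Var x) u = u.
Proof. by elim: u => //= s' t' u -> v ->. Qed.

Lemma sub_ren_var_tm V W (r : rens V W) t (u : tm V t) :
  sub_tm (fun s x => Var (r s x)) u = ren_tm r u.
Proof. by elim: u => //= s' t' u -> v ->. Qed.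

Lemma sub_wk_tm V W s (r : subs V W) t (u : tm V t) :
  sub_tm (up (s := s) r) (wk u) = wk (sub_tm r u).
Proof. by rewrite /wk sub_ren_tm ren_sub_tm. Qed.

Lemma scons_wk_tm V W s (w : tm W s) (r : subs V W) t (u : tm V t) :
  sub_tm (scons w r) (wk u) = sub_tm r u.
Proof. by rewrite /wk sub_ren_tm. Qed.

Lemma sub_ren_fm U V W (r : rens U V) (q : subs V W) (a : fm U) :
  sub_fm q (ren_fm r a) = sub_fm (fun s x => q s (r s x)) a.
Proof.
  elim: a V W r q => //= {U} [U u v|U u v|U a IHa b IHb|U s a IH] V W r q;
    rewrite ?sub_ren_tm ?IHa ?IHb ?IH //.
  by congr (All _ (sub_fm _ _)); apply: subs_eq => t [].
Qed.

Lemma ren_sub_fm U V W (r : subs U V) (q : rens V W) (a : fm U) :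
  ren_fm q (sub_fm r a) = sub_fm (fun s x => ren_tm q (r s x)) a.
Proof.
  elim: a V W r q => //= {U} [U u v|U u v|U a IHa b IHb|U s a IH] V W r q;
    rewrite ?ren_sub_tm ?IHa ?IHb ?IH //.
  congr (All _ (sub_fm _ _)); apply: subs_eq => t [] //= t' x.
  by rewrite /wk !ren_ren_tm.
Qed.

Lemma sub_sub_fm U V W (r : subs U V) (q : subs V W) (a : fm U) :
  sub_fm q (sub_fm r a) = sub_fm (fun s x => sub_tm q (r s x)) a.
Proof.
  elim: a V W r q => //= {U} [U u v|U u v|U a IHa b IHb|U s a IH] V W r q;
    rewrite ?sub_sub_tm ?IHa ?IHb ?IH //.
  congr (All _ (sub_fm _ _)); apply: subs_eq => t [] //= t' x.
  exact: sub_wk_tm.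
Qed.

Lemma sub_var_fm V (a : fm V) : sub_fm (fun _ x => Var x) a = a.
Proof.
  elim: a => //= {V} [V u v|V u v|V a IHa b IHb|V s a IH];
    rewrite ?sub_var_tm ?IHa ?IHb //.
  by congr (All _ _); rewrite -{2}IH; congr sub_fm; apply: subs_eq => t [].
Qed.

Lemma sub_wk_fm V W s (r : subs V W) (a : fm V) :
  sub_fm (up (s := s) r) (wk_fm a) = wk_fm (sub_fm r a).
Proof. by rewrite /wk_fm sub_ren_fm ren_sub_fm. Qed.

Lemma inst_up V W s (r : subs V W) (a : fm (ext V s)) (u : tm W s) :
  inst (sub_fm (up r) a) u = sub_fm (scons u r) a.
Proof.
  rewrite /inst sub_sub_fm; congr sub_fm; apply: subs_eq => t [] //= t' x.
  by rewrite scons_wk_tm sub_var_tm.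
Qed.

Lemma sub_inst V W s (r : subs V W) (a : fm (ext V s)) (u : tm V s) :
  sub_fm r (inst a u) = inst (sub_fm (up r) a) (sub_tm r u).
Proof.
  rewrite inst_up /inst sub_sub_fm.
  by congr sub_fm; apply: subs_eq => t [].
Qed.

Lemma sub_EqT V W (r : subs V W) t (x y : tm V t) :
  sub_fm r (EqT x y) = EqT (sub_tm r x) (sub_tm r y).
Proof.
  elim: t V W r x y => //= s _ t IH V W r x y.
  by rewrite IH /= !sub_wk_tm.
Qed.

Lemma sub_qf V W (r : subs V W) (a : fm V) :
  quantifier_free a -> quantifier_free (sub_fm r a).
Proof. by elim: a W r => //= {}V a IHa b IHb W r [/IHa ? /IHb ?]. Qed.

(** Closure under substitution serves three purposes: a fresh constant can be turned into a bound
    variable, the constants left in a refutation can be replaced by closed terms, and axioms with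
    parameters become true in the term model. *)
Definition sub_closed (T : theory) :=
  forall V W (r : subs V W) a, T V a -> T W (sub_fm r a).

Lemma prv_sub (T : theory) V W (r : subs V W) G (a : fm V) :
  sub_closed T -> prv T G a -> prv T (map (sub_fm r) G) (sub_fm r a).
Proof.
  move=> Tr p; elim: p W r => {V G a}.
  - by move=> V G a Ta W r; apply/prv_ax/Tr.
  - by move=> V G a Ga W r; apply/prv_hyp/in_map.
  - by move=> V G a b _ IH W r; apply/prv_impI/(IH W r).
  - by move=> V G a b _ IH _ IH' W r; apply: prv_impE (IH W r) (IH' W r).
  - by move=> V G a _ IH W r; apply/prv_raa/(IH W r).
  - move=> V G s a _ IH W r; apply/prv_allI.
    have := IH _ (up r); rewrite !map_map.
    by under map_ext do rewrite sub_wk_fm.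
  - by move=> V G s a u _ IH W r; rewrite sub_inst; apply/prv_allE/(IH W r).
  - by move=> *; apply: prv_eq_refl.
  - move=> V G x y a _ IH _ IH' W r; rewrite sub_inst.
    by apply: prv_eq_leibniz (IH W r) _; rewrite -sub_inst.
Qed.

Lemma prv_weak (T : theory) V G H (a : fm V) :
  incl G H -> prv T G a -> prv T H a.
Proof.
  move=> GH p; elim: p H GH => {V G a}.
  - by move=> *; apply: prv_ax.
  - by move=> V G a Ga H GH; apply/prv_hyp/GH.
  - move=> V G a b _ IH H GH; apply/prv_impI/IH => x [->|/GH]; [by left|by right].
  - by move=> V G a b _ IH _ IH' H GH; apply: prv_impE (IH H GH) (IH' H GH).
  - move=> V G a _ IH H GH; apply/prv_raa/IH => x [->|/GH]; [by left|by right].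
  - by move=> V G s a _ IH H GH; apply/prv_allI/IH/incl_map.
  - by move=> V G s a u _ IH H GH; apply/prv_allE/IH.
  - by move=> *; apply: prv_eq_refl.
  - by move=> V G x y a _ IH _ IH' H GH; apply: prv_eq_leibniz (IH H GH) (IH' H GH).
Qed.

Lemma RCA0w_sub : sub_closed RCA0w.
Proof.
  move=> V W r a; case=> {a} /=; intros; rewrite ?sub_EqT /=; try by constructor.
  all: match goal with H : quantifier_free _ |- _ => rename H into qf end.
  - set a' := sub_fm (up r) a.
    have := @ax_ind _ a' (sub_qf _ _); rewrite /a' sub_inst /=.
    suff -> : sub_fm (up r) (sub_fm (scons (Cst cAdd · v0 · Cst cOne)%tm
        (fun t x => Var (ES x))) a)
      = sub_fm (scons (Cst cAdd · v0 · Cst cOne)%tm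
        (fun t x => Var (ES x))) a' by auto.
    rewrite /a' !sub_sub_fm; congr sub_fm; apply: subs_eq => t [] //= t' x.
    by rewrite /wk sub_ren_tm sub_ren_var_tm.
  - set a' := sub_fm (up (up r)) a.
    have := @ax_QFAC _ a' (sub_qf _ _); rewrite /a'.
    suff -> : sub_fm (up (up r)) (sub_fm (scons (v1 · v0)%tm (scons v0
        (fun t x => Var (ES (ES x))))) a)
      = sub_fm (scons (v1 · v0)%tm (scons v0 (fun t x => Var (ES (ES x))))) a'
      by auto.
    rewrite /a' !sub_sub_fm; congr sub_fm; apply: subs_eq => t [] //= t' [] //= t'' x.
    by rewrite /wk !sub_ren_tm ren_ren_tm /= sub_ren_var_tm.
Qed.

Lemma add_axiom_sub (T : theory) (A : forall V, fm V) :
  sub_closed T -> (forall V W (r : subs V W), sub_fm r (A V) = A W) ->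
  sub_closed (add_axiom T A).
Proof. by move=> Tr Ar V W r a [/Tr Ta|->]; [left|right]. Qed.

Lemma theory_sub : sub_closed (add_axiom Pi11CA0w BW0C).
Proof. by do 2!apply: add_axiom_sub => //; exact: RCA0w_sub. Qed.

(** * Extensional models and completeness *)

Record model := Model {
  car :> ty -> Set;
  app : forall s t, car (s ⇒ t) -> car s -> car t;
  cval : forall s, cst s -> car s;
  ltm : car tO -> car tO -> Prop;
  app_ext : forall s t (f g : car (s ⇒ t)), (forall x, app f x = app g x) -> f = g
}.

Definition env (W : ty -> Set) (M : model) := forall s, W s -> M s.

Definition econs (M : model) W s (x : M s) (r : env W M) : env (ext W s) M :=
  fun t y => match y in ext _ _ t return M s -> M t with
             | E0 => fun x => x
             | ES y => fun _ => r _ y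
             end x.

Fixpoint ev (M : model) W (r : env W M) t (u : tm W t) : M t :=
  match u with
  | Var x => r _ x
  | Cst c => cval M c
  | App u v => app (ev r u) (ev r v)
  end.

Fixpoint sat (M : model) W (r : env W M) (a : fm W) : Prop :=
  match a with
  | Eq u v => ev r u = ev r v
  | Lt u v => ltm (ev r u) (ev r v)
  | Bot => False
  | Imp a b => sat r a -> sat r b
  | All s a => forall x : M s, sat (econs x r) a
  end.

Definition models (M : model) (T : theory) :=
  forall W (r : env W M) a, T W a -> sat r a.

Definition no_env_of (M : model) : env no_var M := fun s x => match x with end.

Section Completeness.

Variable T : theory.
Hypothesis T_sub : sub_closed T.
Hypothesis T_ext : forall V r t (x y : tm V r) (f : tm V (r ⇒ t)),
  T (Imp (EqT x y) (EqT (App f x) (App f y))).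

Definition ty_eq_dec (s t : ty) : {s = t} + {s <> t}.
Proof. decide equality. Defined.

(** The Henkin constants are the free variables of one large context, countably many in each type;
    derivability with constants is then just [prv] in this context. *)
Definition consts (s : ty) : Set := nat.

Definition npair a b := to_nat (a, b).
Arguments npair : simpl never.
Notation "⟨ a , b ⟩" := (npair a b).

Lemma pair_inj a b c d : ⟨a, b⟩ = ⟨c, d⟩ -> a = c /\ b = d.
Proof. by move/(f_equal of_nat); rewrite !cancel_of_to => -[-> ->]. Qed.

Fixpoint code_ty (t : ty) : nat :=
  match t with
  | tO => ⟨0, 0⟩
  | s ⇒ t => ⟨1, ⟨code_ty s, code_ty t⟩⟩
  end.

Lemma code_ty_inj s t : code_ty s = code_ty t -> s = t.
Proof.
  elim: s t => [|s IHs s' IHs'] [|t t'] //= /pair_inj [] //.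
  by move=> _ /pair_inj [/IHs -> /IHs' ->].
Qed.

Definition code_cst s (c : cst s) : nat :=
  match c with
  | cZero => ⟨0, 0⟩
  | cOne => ⟨1, 0⟩
  | cAdd => ⟨2, 0⟩
  | cMul => ⟨3, 0⟩
  | cPi s t => ⟨4, ⟨code_ty s, code_ty t⟩⟩
  | cSigma r s t => ⟨5, ⟨code_ty r, ⟨code_ty s, code_ty t⟩⟩⟩
  | cRec s => ⟨6, code_ty s⟩
  end.

Lemma code_cst_inj s t (c : cst s) (d : cst t) :
  code_cst c = code_cst d -> existT _ s c = existT _ t d.
Proof.
  case: c => [||||s1 s2|s1 s2 s3|s1]; case: d => [||||t1 t2|t1 t2 t3|t1] //=;
    case/pair_inj => // _.
  - by case/pair_inj=> /code_ty_inj -> /code_ty_inj ->.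
  - by case/pair_inj=> /code_ty_inj -> /pair_inj [/code_ty_inj -> /code_ty_inj ->].
  - by move/code_ty_inj ->.
Qed.

Definition codes (V : ty -> Set) := forall s, V s -> nat.

Definition inj_codes V (m : codes V) :=
  forall s t x y, m s x = m t y -> existT V s x = existT V t y.

Fixpoint code_tm V (m : codes V) t (u : tm V t) : nat :=
  match u with
  | Var x => ⟨0, m _ x⟩
  | Cst c => ⟨1, code_cst c⟩
  | App u v => ⟨2, ⟨code_tm m u, code_tm m v⟩⟩
  end.

Lemma existT_ty (F : ty -> Set) s (x y : F s) :
  existT F s x = existT F s y -> x = y.
Proof. exact: (inj_pair2_eq_dec _ ty_eq_dec). Qed.

Lemma code_tm_inj V (m : codes V) : inj_codes m -> inj_codes (code_tm m).
Proof.
  move=> mi s t u v.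
  elim: u t v => [s' x|s' c|s1 s2 u IHu w IHw] t [t' y|t' d|t1 t2 v z] //=;
    case/pair_inj => //= _.
  - by move=> /mi /(f_equal (fun p => existT (tm V) _ (Var (projT2 p)))).
  - by move=> /code_cst_inj /(f_equal (fun p => existT (tm V) _ (Cst (projT2 p)))).
  - case/pair_inj=> /IHu e /IHw e'.
    case: (e) => e1 e2; subst t1 t2.
    by rewrite (existT_ty e) (existT_ty e').
Qed.

Lemma code_tm_inj_same V (m : codes V) t (u v : tm V t) : inj_codes m ->
  code_tm m u = code_tm m v -> u = v.
Proof. by move=> mi e; apply: existT_ty (code_tm_inj mi e). Qed.

Definition code_ext V (m : codes V) s : codes (ext V s) := fun t x =>
  match x with
  | E0 => ⟨0, code_ty s⟩
  | ES x => ⟨1, m _ x⟩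
  end.

Lemma code_ext_inj V (m : codes V) s : inj_codes m -> inj_codes (code_ext m (s := s)).
Proof.
  move=> mi t t' [|r x] [|r' y] //= /pair_inj [] // _.
  by move=> /mi /(f_equal (fun p => existT (ext V s) _ (ES (projT2 p)))).
Qed.

Fixpoint code_fm V (m : codes V) (a : fm V) : nat :=
  match a with
  | Eq u v => ⟨0, ⟨code_tm m u, code_tm m v⟩⟩
  | Lt u v => ⟨1, ⟨code_tm m u, code_tm m v⟩⟩
  | Bot => ⟨2, 0⟩
  | Imp a b => ⟨3, ⟨code_fm m a, code_fm m b⟩⟩
  | All s a => ⟨4, ⟨code_ty s, code_fm (code_ext m (s := s)) a⟩⟩
  end.

Lemma code_fm_inj V (m : codes V) : inj_codes m ->
  forall a b, code_fm m a = code_fm m b -> a = b.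
Proof.
  move=> mi a; elim: a m mi => {V} [V u v|V u v|V|V a IHa a' IHa'|V s a IH] m mi;
    case=> [u' v'|u' v'||b b'|s' b] //= /pair_inj [] // _ /pair_inj [].
  - by move=> /(code_tm_inj_same mi) -> /(code_tm_inj_same mi) ->.
  - by move=> /(code_tm_inj_same mi) -> /(code_tm_inj_same mi) ->.
  - by move=> /(IHa _ mi) -> /(IHa' _ mi) ->.
  - move=> /code_ty_inj e; subst s'.
    by move=> /IH -> //; apply: code_ext_inj.
Qed.

Definition code_consts : codes consts := fun s n => ⟨code_ty s, n⟩.

Lemma code_consts_inj : inj_codes code_consts.
Proof. by move=> s t x y /pair_inj [/code_ty_inj e ex]; subst. Qed.

(** Only surjectivity matters; numbers that code nothing give an arbitrary formula. *)
Definition enum (n : nat) : fm consts :=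
  epsilon (inhabits Bot) (fun a => code_fm code_consts a = n).

Lemma enum_code a : enum (code_fm code_consts a) = a.
Proof.
  apply: (code_fm_inj code_consts_inj).
  by apply: (epsilon_spec (inhabits Bot) (fun b => code_fm _ b = _)); exists a.
Qed.

(** The constants of [a] have index below [bound_fm index a]; any larger index is fresh. *)
Fixpoint bound_tm V (m : codes V) t (u : tm V t) : nat :=
  match u with
  | Var x => S (m _ x)
  | Cst c => 0
  | App u v => max (bound_tm m u) (bound_tm m v)
  end.

Definition index_ext V (m : codes V) s : codes (ext V s) := fun t x =>
  match x with
  | E0 => 0
  | ES x => m _ x
  end.

Fixpoint bound_fm V (m : codes V) (a : fm V) : nat :=
  match a with
  | Eq u v => max (bound_tm m u) (bound_tm m v)
  | Lt u v => max (bound_tm m u) (bound_tm m v)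
  | Bot => 0
  | Imp a b => max (bound_fm m a) (bound_fm m b)
  | All s a => bound_fm (index_ext m (s := s)) a
  end.

Lemma sub_tm_bound V W (m : codes V) (r q : subs V W) t (u : tm V t) k :
  bound_tm m u <= k -> (forall s x, m s x < k -> r s x = q s x) ->
  sub_tm r u = sub_tm q u.
Proof.
  move=> uk rq; elim: u uk => //= s s' u IHu v IHv uk.
  by rewrite IHu ?IHv //; lia.
Qed.

Lemma sub_fm_bound V W (m : codes V) (r q : subs V W) (a : fm V) k :
  bound_fm m a <= k -> (forall s x, m s x < k -> r s x = q s x) ->
  sub_fm r a = sub_fm q a.
Proof.
  elim: a W m r q => {V} [V u v|V u v|V|V a IHa b IHb|V s a IH] W m r q //= ak rq.
  - by rewrite !(sub_tm_bound (k := k) (r := r) _ rq) //; lia.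
  - by rewrite !(sub_tm_bound (k := k) (r := r) _ rq) //; lia.
  - by rewrite (IHa _ m r q) ?(IHb _ m r q) //; lia.
  - by congr (All _ _); apply: IH ak _ => t [] //= t' x /rq ->.
Qed.

Definition index : codes consts := fun s n => n.

Definition bound_ctx (G : list (fm consts)) := list_max (map (bound_fm index) G).

Definition unfix (s : ty) (k : nat) : subs consts (ext consts s) := fun t n =>
  match ty_eq_dec s t with
  | left e => if Nat.eq_dec n k then eq_rect s (tm (ext consts s)) (Var E0) t e
              else Var (ES n)
  | right _ => Var (ES (n : consts t))
  end.

Lemma unfix_eq s k : unfix s k (k : consts s) = Var E0.
Proof.
  rewrite /unfix; case: ty_eq_dec => // e.
  case: Nat.eq_dec => // _.
  by rewrite -(Eqdep_dec.eq_rect_eq_dec ty_eq_dec).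
Qed.

Lemma unfix_lt s k t (n : consts t) : n < k -> unfix s k n = Var (ES n).
Proof.
  rewrite /unfix => nk; case: ty_eq_dec => // e.
  by case: Nat.eq_dec => // e'; subst n; lia.
Qed.

Lemma bound_hyp a G : In a G -> bound_fm index a <= bound_ctx G.
Proof.
  move=> Ga; have /list_max_le := Nat.le_refl (bound_ctx G).
  by rewrite Forall_forall => /(_ (bound_fm index a)); apply; apply: in_map.
Qed.

(** Substituting [unfix s k] throughout the derivation turns the constant [k] back into the bound
    variable and, as [k] is above every index in [G], merely weakens the hypotheses. *)
Lemma prv_gen G s (a : fm (ext consts s)) k :
  bound_ctx G <= k -> bound_fm index (All s a) <= k ->
  prv T G (inst a (Var (k : consts s))) -> prv T G (All s a).
Proof.
  move=> Gk ak /(prv_sub (unfix s k) T_sub) p; apply: prv_allI.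
  have e : sub_fm (unfix s k) (inst a (Var (k : consts s))) = a.
    rewrite /inst sub_sub_fm -[RHS]sub_var_fm.
    apply: (@sub_fm_bound _ _ (index_ext index (s := s)) _ _ _ _ ak).
    by move=> t [|t' n] /= nk; [apply: unfix_eq|apply: unfix_lt].
  rewrite e in p.
  suff -> : map wk_fm G = map (sub_fm (unfix s k)) G by [].
  apply: map_ext_in => b /bound_hyp bG.
  rewrite /wk_fm -[in LHS](sub_var_fm b) ren_sub_fm /=; apply: (@sub_fm_bound _ _ _ _ _ _ _ bG).
  by move=> t n nb; rewrite unfix_lt //; move: nb; rewrite /index; lia.
Qed.

Definition consistent (G : list (fm consts)) := ~ prv T G Bot.

(** Since [Ex] is a negated [All], a witness is owed exactly when an [All] formula is rejected; its
    index is chosen beyond everything in the context. *)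
Definition henkin (G : list (fm consts)) (a : fm consts) : list (fm consts) :=
  match a with
  | All s b => [Not (inst b (Var (bound_ctx (Not a :: G) : consts s)))]
  | _ => []
  end.

Definition step (G : list (fm consts)) (a : fm consts) : list (fm consts) :=
  if excluded_middle_informative (consistent (a :: G)) then a :: G
  else henkin G a ++ Not a :: G.

Lemma prv_cut G (a b : fm consts) : prv T (a :: G) b -> prv T G a -> prv T G b.
Proof. by move=> /prv_impI; apply: prv_impE. Qed.

Lemma step_consistent G a : consistent G -> consistent (step G a).
Proof.
  move=> Gc; rewrite /step; case: excluded_middle_informative => // /NNPP aG.
  have {aG} na : consistent (Not a :: G).
    by move=> p; apply: Gc; apply: prv_cut p _; apply: prv_impI.
  (* A contradiction from the witness axiom proves the instance at a fresh constant, hence the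
     universal formula just rejected. *)
  case: a na => //= s b nb /prv_raa p; apply: nb.
  apply: prv_impE (prv_hyp _ _) _; first by left.
  apply: prv_gen p => //.
  have : bound_fm index (Not (All s b)) <= bound_ctx (Not (All s b) :: G).
    by apply: bound_hyp; left.
  by rewrite /=; lia.
Qed.

Section Extension.

Variable G0 : list (fm consts).
Hypothesis G0_consistent : consistent G0.

Fixpoint stage (n : nat) : list (fm consts) :=
  match n with
  | O => G0
  | S n => step (stage n) (enum n)
  end.

Lemma stage_consistent n : consistent (stage n).
Proof. by elim: n => //= n /step_consistent. Qed.

Lemma stage_incl n m : n <= m -> incl (stage n) (stage m).
Proof.
  elim=> [|{}m _ IH]; first exact: incl_refl.
  apply: incl_tran IH _; rewrite /= /step; case: excluded_middle_informative => _.
  - by apply: incl_tl; apply: incl_refl.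
  - by apply: incl_appr; apply: incl_tl; apply: incl_refl.
Qed.

Definition Delta (a : fm consts) := exists n, In a (stage n).

Lemma Delta_finite G : (forall a, In a G -> Delta a) -> exists n, incl G (stage n).
Proof.
  elim: G => [|a G IH] GD; first by exists 0.
  have [|n Gn] := IH; first by move=> b Gb; apply: GD; right.
  have [|m am] := GD a; first by left.
  exists (n + m) => b [<-|/Gn].
  - by apply: stage_incl am; lia.
  - by apply: stage_incl; lia.
Qed.

Lemma Delta_consistent G : (forall a, In a G -> Delta a) -> consistent G.
Proof.
  by move=> /Delta_finite [n Gn] /(prv_weak Gn); apply: stage_consistent.
Qed.

Lemma Delta_decides a : Delta a \/ Delta (Not a).
Proof.
  set n := code_fm code_consts a.
  have: In a (stage (S n)) \/ In (Not a) (stage (S n)).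
    rewrite /= enum_code /step; case: excluded_middle_informative => _ /=; first by auto.
    by right; apply/in_or_app; right; left.
  by case=> ?; [left|right]; exists (S n).
Qed.

Lemma Delta_prv G a : (forall b, In b G -> Delta b) -> prv T G a -> Delta a.
Proof.
  move=> GD p; case: (Delta_decides a) => // na; exfalso.
  apply: (@Delta_consistent (Not a :: G)); first by move=> b [<-|/GD].
  apply: prv_impE (prv_hyp _ _) (prv_weak _ p); first by left.
  by move=> b; right.
Qed.

Lemma Delta_not a : Delta (Not a) <-> ~ Delta a.
Proof.
  split=> [na Da|]; last by case: (Delta_decides a).
  apply: (@Delta_consistent [Not a; a]); first by move=> b [<-|[<-|[]]].
  by apply: prv_impE (prv_hyp _ _) (prv_hyp _ _); [left|right; left].
Qed.

Lemma Delta_imp a b : Delta (Imp a b) <-> (Delta a -> Delta b).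
Proof.
  split=> [ab Da|ab].
  - apply: (Delta_prv (G := [Imp a b; a])); first by move=> c [<-|[<-|[]]].
    by apply: prv_impE (prv_hyp _ _) (prv_hyp _ _); [left|right; left].
  - case: (Delta_decides a) => [/ab Db|na].
    + apply: (Delta_prv (G := [b])); first by move=> c [<-|[]].
      by apply/prv_impI/prv_hyp; right; left.
    + apply: (Delta_prv (G := [Not a])); first by move=> c [<-|[]].
      apply/prv_impI/prv_raa; apply: prv_impE (prv_hyp _ _) (prv_hyp _ _).
      * by right; right; left.
      * by right; left.
Qed.

Lemma Delta_all s (a : fm (ext consts s)) : Delta (All s a) <-> forall u, Delta (inst a u).
Proof.
  split=> [Da u|Da].
  - apply: (Delta_prv (G := [All s a])); first by move=> c [<-|[]].
    by apply/prv_allE/prv_hyp; left.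
  - apply: NNPP => na; set n := code_fm code_consts (All s a).
    have [k] : exists k, Delta (Not (inst a (Var (k : consts s)))).
      have : ~ In (All s a) (stage (S n)) by move=> ?; apply: na; exists (S n).
      rewrite /= enum_code /step; case: excluded_middle_informative => /= [_ []|c _].
        by left.
      eexists; exists (S n); rewrite /= enum_code /step.
      by case: excluded_middle_informative => // _; left.
    by move/Delta_not; apply.
Qed.

Lemma Delta_ax a : T a -> Delta a.
Proof. by move=> Ta; apply: (Delta_prv (G := [])) => //; apply: prv_ax. Qed.

Lemma Delta_leibniz x y (a : fm (ext consts tO)) :
  Delta (Eq x y) -> Delta (inst a x) -> Delta (inst a y).
Proof.
  move=> xy ax; apply: (Delta_prv (G := [Eq x y; inst a x])).
    by move=> c [<-|[<-|[]]].
  by apply: prv_eq_leibniz (prv_hyp _ _) (prv_hyp _ _); [left|right; left].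
Qed.

Definition sim t (x y : tm consts t) := Delta (EqT x y).

Lemma sim_arrow s t (f g : tm consts (s ⇒ t)) :
  sim f g <-> forall x, sim (App f x) (App g x).
Proof.
  rewrite /sim /= Delta_all.
  by split=> fg x; have := fg x; rewrite /inst sub_EqT /= !scons_wk_tm !sub_var_tm.
Qed.

Lemma sim_refl t (x : tm consts t) : sim x x.
Proof.
  elim: t x => [|s _ t IH] x; last by apply/sim_arrow.
  by apply: (Delta_prv (G := [])) => //; apply: prv_eq_refl.
Qed.

Lemma Delta_leibniz' (a : fm (ext consts tO)) b c x y :
  inst a x = b -> inst a y = c -> Delta (Eq x y) -> Delta b -> Delta c.
Proof. by move=> <- <-; apply: Delta_leibniz. Qed.

Lemma sim_sym t (x y : tm consts t) : sim x y -> sim y x.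
Proof.
  elim: t x y => [|s _ t IH] x y xy.
  - by apply: (Delta_leibniz' (a := Eq v0 (wk x)) _ _ xy (sim_refl x)); 
      rewrite /inst /= scons_wk_tm sub_var_tm.
  - by apply/sim_arrow => z; apply: IH; move: z; apply/sim_arrow.
Qed.

Lemma sim_trans t (x y z : tm consts t) : sim x y -> sim y z -> sim x z.
Proof.
  elim: t x y z => [|s _ t IH] x y z xy yz.
  - by apply: (Delta_leibniz' (a := Eq (wk x) v0) _ _ yz xy);
      rewrite /inst /= scons_wk_tm sub_var_tm.
  - move/sim_arrow: xy => xy; move/sim_arrow: yz => yz.
    by apply/sim_arrow => w; apply: IH (xy w) (yz w).
Qed.

(** Here the extensionality axioms enter: they make [sim] a congruence, so that application is well
    defined on the quotient. *)
Lemma sim_app s t (f g : tm consts (s ⇒ t)) x y :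
  sim f g -> sim x y -> sim (App f x) (App g y).
Proof.
  move=> /sim_arrow/(_ x) fg xy; apply: sim_trans fg _.
  by have /Delta_imp := Delta_ax (T_ext x y g); apply.
Qed.

(** Canonical representatives make the quotient by [sim] a subtype. *)
Definition rep t (x : tm consts t) : tm consts t := epsilon (inhabits x) (sim x).

Lemma sim_rep t (x : tm consts t) : sim x (rep x).
Proof. by apply: epsilon_spec; exists x; apply: sim_refl. Qed.

Lemma rep_eq t (x y : tm consts t) : sim x y -> rep x = rep y.
Proof.
  move=> xy; rewrite /rep.
  have -> : inhabits x = inhabits y by apply: proof_irrelevance.
  congr epsilon; apply: functional_extensionality => z.
  apply: propositional_extensionality; split; apply: sim_trans => //.
  exact: sim_sym.
Qed.

Definition quot (t : ty) : Set := {x : tm consts t | rep x = x}.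

Definition cls t (x : tm consts t) : quot t :=
  exist _ (rep x) (eq_sym (rep_eq (sim_rep x))).

Lemma cls_eq t (x y : tm consts t) : cls x = cls y <-> sim x y.
Proof.
  split=> [/(f_equal (@proj1_sig _ _)) /= e|xy].
  - by apply: sim_trans (sim_rep x) _; rewrite e; apply/sim_sym/sim_rep.
  - by apply: subset_eq_compat; apply: rep_eq.
Qed.

Lemma sim_cls t (x : tm consts t) : sim x (proj1_sig (cls x)).
Proof. exact: sim_rep. Qed.

Lemma cls_val t (x : quot t) : cls (proj1_sig x) = x.
Proof. by case: x => x e; apply: subset_eq_compat. Qed.

Definition qapp s t (f : quot (s ⇒ t)) (x : quot s) : quot t :=
  cls (App (proj1_sig f) (proj1_sig x)).

Lemma qapp_cls s t (f : tm consts (s ⇒ t)) x : qapp (cls f) (cls x) = cls (App f x).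
Proof. by apply/cls_eq/sim_app; apply/sim_sym/sim_cls. Qed.

Lemma qapp_ext s t (f g : quot (s ⇒ t)) : (forall x, qapp f x = qapp g x) -> f = g.
Proof.
  rewrite -(cls_val f) -(cls_val g) => fg; apply/cls_eq/sim_arrow => x.
  by apply/cls_eq; rewrite -!qapp_cls.
Qed.

Definition qlt (x y : quot tO) := Delta (Lt (proj1_sig x) (proj1_sig y)).

Lemma qlt_cls x y : qlt (cls x) (cls y) <-> Delta (Lt x y).
Proof.
  have l x' y' z : sim x' y' -> Delta (Lt x' z) -> Delta (Lt y' z).
    by apply: (Delta_leibniz' (a := Lt v0 (wk z))); rewrite /inst /= scons_wk_tm sub_var_tm.
  have r x' y' z : sim x' y' -> Delta (Lt z x') -> Delta (Lt z y').
    by apply: (Delta_leibniz' (a := Lt (wk z) v0)); rewrite /inst /= scons_wk_tm sub_var_tm.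
  split=> h.
  - by apply: l (sim_sym (sim_cls x)) _; apply: r (sim_sym (sim_cls y)) _.
  - by apply: l (sim_cls x) _; apply: r (sim_cls y) _.
Qed.

Definition term_model : model :=
  Model (fun s c => cls (Cst c)) qlt qapp_ext.

Lemma ev_cls W (r : subs W consts) t (u : tm W t) :
  ev (M := term_model) (fun s x => cls (r s x)) u = cls (sub_tm r u).
Proof. by elim: u => //= s s' u -> v ->; rewrite /= qapp_cls. Qed.

(** The truth lemma; environments into the quotient are presented by substitutions of terms. *)
Lemma sat_cls W (r : subs W consts) (a : fm W) :
  sat (M := term_model) (fun s x => cls (r s x)) a <-> Delta (sub_fm r a).
Proof.
  elim: a r => {W} [W u v|W u v|W|W a IHa b IHb|W s a IH] r /=.
  - by rewrite !ev_cls cls_eq.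
  - by rewrite !ev_cls qlt_cls.
  - split=> // DB; apply: (Delta_consistent (G := [Bot])); first by move=> c [<-|[]].
    by apply: prv_hyp; left.
  - by rewrite IHa IHb Delta_imp.
  - have e u : econs (M := term_model) (cls u) (fun t x => cls (r t x))
        = fun t x => cls (scons u r x).
      by apply: functional_extensionality_dep => t;
        apply: functional_extensionality; case.
    rewrite Delta_all; split=> h u.
    + by rewrite inst_up -IH -e; apply: h.
    + by rewrite -(cls_val u) e IH -inst_up; apply: h.
Qed.

Lemma term_model_models : models term_model T.
Proof.
  move=> W r a Ta.
  have -> : r = fun s x => cls (proj1_sig (r s x)).
    apply: functional_extensionality_dep => s.
    by apply: functional_extensionality => x; rewrite cls_val.
  by apply/sat_cls/Delta_ax/T_sub.
Qed.

End Extension.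

Fixpoint default (t : ty) : tm no_var t :=
  match t with
  | tO => Cst cZero
  | s ⇒ t => App (Cst (cPi t s)) (default t)
  end.

Theorem completeness (a : fm no_var) :
  (forall M, models M T -> sat (no_env_of M) a) -> proves T a.
Proof.
  move=> Ma; apply: NNPP => na.
  set a' : fm consts := sub_fm (fun s (x : no_var s) => match x with end) a.
  have c : consistent [Not a'].
    (* Replacing all constants by closed terms turns the refutation of [Not a'] into a derivation of
       [a] itself. *)
    move=> /prv_raa /(prv_sub (fun t _ => default t) T_sub); rewrite /= sub_sub_fm.
    set r := (fun s x => _); have -> : r = fun _ x => Var x by apply: subs_eq => t [].
    by rewrite sub_var_fm.
  have := Ma _ (@term_model_models _ c).
  have -> : no_env_of (term_model c)
      = fun s (x : no_var s) => cls c match x return tm consts s with end.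
    apply: functional_extensionality_dep => s.
    by apply: functional_extensionality; case.
  move/(sat_cls c); have /(Delta_not c) : Delta [Not a'] (Not a') by exists 0; left.
  by [].
Qed.

End Completeness.

(** * Definability in a model *)

Lemma ev_ren (M : model) V W (r : env W M) (q : rens V W) t (u : tm V t) :
  ev r (ren_tm q u) = ev (fun s x => r s (q s x)) u.
Proof. by elim: u => //= s s' u -> v ->. Qed.

Lemma ev_sub (M : model) V W (r : env W M) (q : subs V W) t (u : tm V t) :
  ev r (sub_tm q u) = ev (fun s x => ev r (q s x)) u.
Proof. by elim: u => //= s s' u -> v ->. Qed.

Lemma env_eq (M : model) W (r q : env W M) : (forall s x, r s x = q s x) -> r = q.
Proof.
  move=> e; apply: functional_extensionality_dep => s.
  exact: functional_extensionality (e s).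
Qed.

Lemma sat_sub (M : model) V W (r : env W M) (q : subs V W) (a : fm V) :
  sat r (sub_fm q a) <-> sat (fun s x => ev r (q s x)) a.
Proof.
  elim: a W r q => {V} [V u v|V u v|V|V a IHa b IHb|V s a IH] W r q //=.
  - by rewrite !ev_sub.
  - by rewrite !ev_sub.
  - by rewrite IHa IHb.
  - have e x : econs x (fun t y => ev r (q t y))
        = fun t y => ev (econs x r) (up (s := s) q y).
      by apply: env_eq => t [] //= t' y; rewrite /wk ev_ren.
    by split=> h x; have := h x; rewrite IH e.
Qed.

Lemma sat_EqT (M : model) W (r : env W M) t (x y : tm W t) :
  sat r (EqT x y) <-> ev r x = ev r y.
Proof.
  elim: t W r x y => //= s _ t IH W r x y; split=> [h|e z].
  - by apply: app_ext => z; have := h z; rewrite IH /= /wk !ev_ren.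
  - by rewrite IH /= /wk !ev_ren /= e.
Qed.

Lemma sat_And (M : model) W (r : env W M) a b : sat r (And a b) <-> sat r a /\ sat r b.
Proof. by split=> /= [h|[] ? ? h]; [split; apply: NNPP|]; tauto. Qed.

Lemma sat_Or (M : model) W (r : env W M) a b : sat r (Or a b) <-> sat r a \/ sat r b.
Proof. by rewrite /=; split=> [h|]; [case: (classic (sat r a))|]; tauto. Qed.

Lemma sat_Iff (M : model) W (r : env W M) a b :
  sat r (Iff a b) <-> (sat r a <-> sat r b).
Proof. by rewrite sat_And /=; tauto. Qed.

Lemma sat_Imp (M : model) W (r : env W M) a b : sat r (Imp a b) -> sat r a -> sat r b.
Proof. by []. Qed.

Lemma sat_All (M : model) W (r : env W M) s (a : fm (ext W s)) :
  sat r (All s a) <-> forall x, sat (econs x r) a.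
Proof. by []. Qed.

Lemma sat_Ex (M : model) W (r : env W M) s (a : fm (ext W s)) :
  sat r (Ex s a) <-> exists x, sat (econs x r) a.
Proof.
  rewrite /=; split=> [h|[x ax] h]; last by apply: (h x).
  by apply: NNPP => n; apply: h => x ax; apply: n; exists x.
Qed.

Declare Scope model_scope.
Delimit Scope model_scope with M.
Notation "f @ x" := (app f x) (at level 29, left associativity) : model_scope.
Local Open Scope model_scope.

Record structure := Structure {
  carrier :> model;
  carrierP : models carrier (add_axiom Pi11CA0w BW0C)
}.

Section Definability.

Context {M : structure}.

Notation N := (M tO).
Implicit Types x y z n m k i j : N.

Definition params : env M M := fun s (x : M s) => x.

Lemma ax_sat (a : fm M) : RCA0w a -> sat params a.
Proof. by move=> ax; apply: carrierP; left; left. Qed.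

Definition zero : N := cval M cZero.
Definition one : N := cval M cOne.
Definition add (x y : N) : N := cval M cAdd @ x @ y.
Definition mul (x y : N) : N := cval M cMul @ x @ y.

Notation "0" := zero : model_scope.
Notation "1" := one : model_scope.
Notation "x + y" := (add x y) : model_scope.
Notation "x * y" := (mul x y) : model_scope.
Notation "x < y" := (ltm x y) : model_scope.

Lemma addA x y z : x + (y + z) = x + y + z.
Proof. exact: (ax_sat (ax_addA (Var x) (Var y) (Var z))). Qed.
Lemma addC x y : x + y = y + x.
Proof. exact: (ax_sat (ax_addC (Var x) (Var y))). Qed.
Lemma add0 x : x + 0 = x.
Proof. exact: (ax_sat (ax_add0 (Var x))). Qed.
Lemma mulA x y z : x * (y * z) = x * y * z.
Proof. exact: (ax_sat (ax_mulA (Var x) (Var y) (Var z))). Qed.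
Lemma mulC x y : x * y = y * x.
Proof. exact: (ax_sat (ax_mulC (Var x) (Var y))). Qed.
Lemma mul1 x : x * 1 = x.
Proof. exact: (ax_sat (ax_mul1 (Var x))). Qed.
Lemma mul0 x : x * 0 = 0.
Proof. exact: (ax_sat (ax_mul0 (Var x))). Qed.
Lemma mulD x y z : x * (y + z) = x * y + x * z.
Proof. exact: (ax_sat (ax_mulD (Var x) (Var y) (Var z))). Qed.
Lemma lt_irr x : ~ x < x.
Proof. exact: (ax_sat (ax_lt_irr (Var x))). Qed.
Lemma lt_trans x y z : x < y -> y < z -> x < z.
Proof. exact: (ax_sat (ax_lt_trans (Var x) (Var y) (Var z))). Qed.
Lemma lt_total x y : x < y \/ x = y \/ y < x.
Proof. by have := ax_sat (ax_lt_total (Var x) (Var y)); rewrite !sat_Or. Qed.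
Lemma lt_add x y z : x < y -> x + z < y + z.
Proof. exact: (ax_sat (ax_lt_add (Var x) (Var y) (Var z))). Qed.
Lemma lt_mul x y z : 0 < z -> x < y -> x * z < y * z.
Proof. exact: (ax_sat (ax_lt_mul (Var x) (Var y) (Var z))). Qed.
Lemma lt01 : 0 < 1.
Proof. exact: (ax_sat (ax_lt01 _)). Qed.

Lemma PiE s t (x : M s) (y : M t) : cval M (cPi s t) @ x @ y = x.
Proof. by have := ax_sat (ax_Pi (Var x) (Var y)); rewrite sat_EqT. Qed.
Lemma SigmaE r s t (x : M (r ⇒ s ⇒ t)) (y : M (r ⇒ s)) (z : M r) :
  cval M (cSigma r s t) @ x @ y @ z = x @ z @ (y @ z).
Proof. by have := ax_sat (ax_Sigma (Var x) (Var y) (Var z)); rewrite sat_EqT. Qed.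

Definition rec (f : M (tO ⇒ tO ⇒ tO)) (x n : N) : N := cval M (cRec tO) @ f @ x @ n.

Lemma rec0 f x : rec f x 0 = x.
Proof. exact: (ax_sat (ax_Rec0 (Var f) (Var x))). Qed.
Lemma recS f x n : rec f x (n + 1) = f @ n @ rec f x n.
Proof. exact: (ax_sat (ax_RecS (Var f) (Var x) (Var n))). Qed.

Lemma qf_ac (a : fm (ext (ext M t1) tO)) : quantifier_free a ->
  (forall f : M t1, exists y : N, sat (econs y (econs f params)) a) ->
  exists Y : M t2, forall f, sat (econs (Y @ f) (econs f params)) a.
Proof.
  move=> qa h; have ax : sat params (All t1 (Ex tO a)) by move=> f; apply/sat_Ex.
  have [Y Yh] := proj1 (sat_Ex params _) (sat_Imp (ax_sat (ax_QFAC qa)) ax); exists Y => f.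
  have := proj1 (sat_sub (econs f (econs Y params)) _ _) (Yh f).
  by congr (sat _ _); apply: env_eq => s [|t []].
Qed.

Lemma econs_lam W (r : env W M) s t (u : tm (ext W s) t) (x : M s) :
  ev r (lam u) @ x = ev (econs x r) u.
Proof.
  elim: u => [s' y|s' c|s1 s2 u IHu v IHv] /=.
  - case: y => [|s'' y] /=; [by rewrite SigmaE PiE|exact: PiE].
  - by rewrite PiE.
  - by rewrite SigmaE IHu IHv.
Qed.

Fixpoint dflt (t : ty) : M t :=
  match t with
  | tO => zero
  | s ⇒ t => cval M (cPi t s) @ dflt t
  end.

(** The element of [M] representing [F], provided there is one. *)
Definition lamM s t (F : M s -> M t) : M (s ⇒ t) :=
  epsilon (inhabits (dflt (s ⇒ t))) (fun f => forall x : M s, f @ x = F x).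

Fixpoint tup (G : list ty) : Set :=
  match G with
  | [] => unit
  | s :: G => (M s * tup G)%type
  end.

Fixpoint vars (G : list ty) : ty -> Set :=
  match G with
  | [] => M
  | s :: G => ext (vars G) s
  end.

Fixpoint look (G : list ty) : tup G -> env (vars G) M :=
  match G with
  | [] => fun _ => params
  | s :: G => fun p => econs (fst p) (look (snd p))
  end.

(** Uniform definability: one term, with parameters from [M], gives [F p] for all tuples [p]. This
    is what allows [F] to be abstracted into an element of the model. *)
Definition Def (G : list ty) t (F : tup G -> M t) : Prop :=
  exists u : tm (vars G) t, forall p, ev (look p) u = F p.

Lemma Def_wk G s t (F : tup G -> M t) :
  Def F -> Def (fun p : tup (s :: G) => F (snd p)).
Proof. by case=> u h; exists (wk u) => p; rewrite /wk ev_ren /= -h. Qed.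

Lemma Def_fst G s : Def (fun p : tup (s :: G) => fst p).
Proof. by exists (Var E0). Qed.

Lemma Def_const G t (x : M t) : Def (fun _ : tup G => x).
Proof.
  elim: G => [|s G IH]; first by exists (Var x).
  exact: (Def_wk s IH).
Qed.

Lemma Def_app G s t (F : tup G -> M (s ⇒ t)) (X : tup G -> M s) :
  Def F -> Def X -> Def (fun p => F p @ X p).
Proof. by move=> [u h] [v k]; exists (App u v) => p /=; rewrite h k. Qed.

Lemma lamM_spec G s t (F : tup (s :: G) -> M t) (p : tup G) (x : M s) :
  Def F -> lamM (fun x : M s => F (x, p)) @ x = F (x, p).
Proof.
  case=> u h.
  have e : exists f : M (s ⇒ t), forall y : M s, f @ y = F (y, p).
    by exists (ev (look p) (lam u)) => y; rewrite econs_lam -h.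
  exact: (epsilon_spec (inhabits (dflt (s ⇒ t))) _ e).
Qed.

Lemma Def_lam G s t (F : tup (s :: G) -> M t) :
  Def F -> Def (fun p : tup G => lamM (fun x : M s => F (x, p))).
Proof.
  move=> DF; case: (DF) => u h; exists (lam u) => p; apply: app_ext => x.
  by rewrite econs_lam lamM_spec // -h.
Qed.

Lemma lamE s t (F : M s -> M t) (x : M s) :
  Def (fun p : tup [s] => F (fst p)) -> lamM F @ x = F x.
Proof. by move=> DF; have := @lamM_spec [] s t _ tt x DF. Qed.

End Definability.

Ltac def_hyp :=
  match goal with
  | H : Def _ |- _ => first
    [ exact H | exact (Def_wk _ H) | exact (Def_wk _ (Def_wk _ H))
    | exact (Def_wk _ (Def_wk _ (Def_wk _ H)))
    | exact (Def_wk _ (Def_wk _ (Def_wk _ (Def_wk _ H))))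
    | exact (Def_wk _ (Def_wk _ (Def_wk _ (Def_wk _ (Def_wk _ H))))) ]
  end.

Ltac def_var := first
  [ exact (Def_fst _ _) | exact (Def_wk _ (Def_fst _ _))
  | exact (Def_wk _ (Def_wk _ (Def_fst _ _)))
  | exact (Def_wk _ (Def_wk _ (Def_wk _ (Def_fst _ _))))
  | exact (Def_wk _ (Def_wk _ (Def_wk _ (Def_wk _ (Def_fst _ _)))))
  | exact (Def_wk _ (Def_wk _ (Def_wk _ (Def_wk _ (Def_wk _ (Def_fst _ _)))))) ].

Notation "0" := zero : model_scope.
Notation "1" := one : model_scope.
Notation "x + y" := (add x y) : model_scope.
Notation "x * y" := (mul x y) : model_scope.
Notation "x < y" := (ltm x y) : model_scope.

(** * Definable functions and decidable relations *)

Section Decidable.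

Context {M : structure}.
Notation N := (M tO).
Notation tup := (@tup M).
Implicit Types x y z n m k i j : N.

Lemma Def_add G (X Y : tup G -> N) :
  Def X -> Def Y -> Def (fun p => X p + Y p).
Proof. by move=> DX DY; do 2!apply: Def_app => //; apply: Def_const. Qed.

Lemma Def_mul G (X Y : tup G -> N) :
  Def X -> Def Y -> Def (fun p => X p * Y p).
Proof. by move=> DX DY; do 2!apply: Def_app => //; apply: Def_const. Qed.

Lemma Def_rec G F (X Y : tup G -> N) :
  Def F -> Def X -> Def Y -> Def (fun p => rec (F p) (X p) (Y p)).
Proof. by move=> DF DX DY; do 3!apply: Def_app => //; apply: Def_const. Qed.

(** Truth values: [0] is true and [1] is false, as for the Suslin functional. *)
Definition chi (P : Prop) : N := if excluded_middle_informative P then 0 else 1.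
Definition cond (P : Prop) (x y : N) : N :=
  if excluded_middle_informative P then x else y.

Definition Dec (G : list ty) (P : tup G -> Prop) := Def (fun p => chi (P p)).

End Decidable.

Ltac def_lamM :=
  match goal with
  | |- @Def ?M ?G _ (fun p => @lamM _ ?s ?t (fun x => @?B p x)) =>
      refine (@Def_lam M G s t (fun q => B (snd q) (fst q)) _); cbv beta
  end.

Ltac def_const := match goal with |- Def (fun p => ?c) => exact (Def_const _ c) end.

Ltac def_tac := cbv beta;
  first [ def_const | def_var | def_hyp | def_lamM
        | apply: Def_add | apply: Def_mul | apply: Def_rec | apply: Def_app ].

Ltac def0 := repeat def_tac.

Section Decidable.

Context {M : structure}.
Notation N := (M tO).
Notation tup := (@tup M).
Implicit Types x y z n m k i j : N.

Lemma not01 : 0 <> 1 :> N.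
Proof. by move=> e; apply: (@lt_irr M 1); rewrite -{1}e; apply: lt01. Qed.

Lemma not10 : 1 <> 0 :> N.
Proof. by move=> e; apply: not01. Qed.

Lemma chi0 (P : Prop) : chi P = 0 :> N <-> P.
Proof.
  rewrite /chi; case: excluded_middle_informative => // nP; split=> // e.
  by case: not01; rewrite e.
Qed.

(** Choice acts on a single argument of type 1, so two numbers are packed into the values of a
    function at [0] and [1]. *)
Definition fun2 x y : M t1 :=
  lamM (fun n => rec (lamM (fun _ => lamM (fun _ => y))) x n).

Lemma add0l x : 0 + x = x.
Proof. by rewrite addC add0. Qed.

Lemma Def_fun2 G (X Y : tup G -> N) :
  Def X -> Def Y -> Def (fun p => fun2 (X p) (Y p)).
Proof. by move=> DX DY; rewrite /fun2; def0. Qed.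

Lemma fun2_0 x y : fun2 x y @ 0 = x.
Proof. by rewrite /fun2 lamE; [def0|rewrite rec0]. Qed.

Lemma fun2_1 x y : fun2 x y @ 1 = y.
Proof.
  rewrite /fun2 lamE; first by def0.
  rewrite -(add0l 1) recS lamE; first by def0.
  by rewrite lamE //; def0.
Qed.

(** Choice applied to the quantifier-free relation [(a → y = 0) ∧ (¬a → y = 1)], which is total by
    classical logic. *)
Lemma qf_chi (a : fm (ext M t1)) : quantifier_free a ->
  exists C : M t2, forall f, C @ f = chi (sat (econs f params) a).
Proof.
  move=> qa; set a' := sub_fm (fun s v => Var (ES (s := tO) v)) a.
  have [|f|C Ch] := @qf_ac M (And (Imp a' (Eq v0 (Cst cZero)))
                               (Imp (Not a') (Eq v0 (Cst cOne)))).
  - by rewrite /= /a'; have := sub_qf _ qa; auto 10.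
  - exists (chi (sat (econs f params) a)); rewrite sat_And /= /a' sat_sub /= /chi.
    by case: excluded_middle_informative.
  - exists C => f; have := Ch f; rewrite sat_And /= /a' sat_sub /= /chi.
    by case: excluded_middle_informative => ? [? ?]; auto.
Qed.

Lemma Dec_eq G (X Y : tup G -> N) :
  Def X -> Def Y -> Dec (fun p => X p = Y p).
Proof.
  move=> DX DY.
  have [//|C Ch] := @qf_chi (Eq (App v0 (Cst cZero)) (App v0 (Cst cOne))).
  have : Def (fun p => C @ fun2 (X p) (Y p)).
    by apply: Def_app; [apply: Def_const|apply: Def_fun2].
  case=> u h; exists u => p; rewrite h Ch /=.
  by rewrite -[cval M cZero]/zero -[cval M cOne]/one fun2_0 fun2_1.
Qed.

Lemma Dec_lt G (X Y : tup G -> N) :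
  Def X -> Def Y -> Dec (fun p => X p < Y p).
Proof.
  move=> DX DY.
  have [//|C Ch] := @qf_chi (Lt (App v0 (Cst cZero)) (App v0 (Cst cOne))).
  have : Def (fun p => C @ fun2 (X p) (Y p)).
    by apply: Def_app; [apply: Def_const|apply: Def_fun2].
  case=> u h; exists u => p; rewrite h Ch /=.
  by rewrite -[cval M cZero]/zero -[cval M cOne]/one fun2_0 fun2_1.
Qed.

Lemma chi_ext (P Q : Prop) : (P <-> Q) -> chi P = chi Q :> N.
Proof. by move=> e; rewrite (propositional_extensionality _ _ e). Qed.

Lemma Dec_ext G (P Q : tup G -> Prop) :
  (forall p, P p <-> Q p) -> Dec P -> Dec Q.
Proof. by move=> e [u h]; exists u => p; rewrite h; apply: chi_ext. Qed.

Lemma Dec_imp G (P Q : tup G -> Prop) :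
  Dec P -> Dec Q -> Dec (fun p => P p -> Q p).
Proof.
  move=> DP DQ.
  have [//|C Ch] := @qf_chi (Imp (Eq (App v0 (Cst cZero)) (Cst cZero))
                              (Eq (App v0 (Cst cOne)) (Cst cZero))).
  have : Def (fun p => C @ fun2 (chi (P p)) (chi (Q p))).
    by apply: Def_app; [apply: Def_const|apply: Def_fun2].
  case=> u h; exists u => p; rewrite h Ch /=; apply: chi_ext.
  by rewrite -[cval M cZero]/zero -[cval M cOne]/one fun2_0 fun2_1 !chi0.
Qed.

Lemma Dec_const G (P : Prop) : Dec (fun p : tup G => P).
Proof. exact: Def_const. Qed.

Lemma Dec_not G (P : tup G -> Prop) : Dec P -> Dec (fun p => ~ P p).
Proof. by move=> DP; apply: Dec_imp => //; apply: Dec_const. Qed.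

Lemma Dec_and G (P Q : tup G -> Prop) : Dec P -> Dec Q -> Dec (fun p => P p /\ Q p).
Proof.
  move=> DP DQ; apply: (Dec_ext (P := fun p => ~ (P p -> ~ Q p))) => [p|].
    by split; [move=> h; apply: NNPP|]; tauto.
  by apply/Dec_not/Dec_imp => //; apply: Dec_not.
Qed.

Lemma Dec_or G (P Q : tup G -> Prop) : Dec P -> Dec Q -> Dec (fun p => P p \/ Q p).
Proof.
  move=> DP DQ; apply: (Dec_ext (P := fun p => ~ P p -> Q p)) => [p|].
    by case: (classic (P p)); tauto.
  by apply/Dec_imp => //; apply: Dec_not.
Qed.

Lemma Dec_iff G (P Q : tup G -> Prop) : Dec P -> Dec Q -> Dec (fun p => P p <-> Q p).
Proof. by move=> DP DQ; apply: Dec_and; apply: Dec_imp. Qed.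

Lemma chi_cond (P : Prop) : cond P 0 1 = chi P :> N.
Proof. by []. Qed.

Lemma chi01 (P : Prop) : chi P = 0 :> N \/ chi P = 1 :> N.
Proof. by rewrite /chi; case: excluded_middle_informative; auto. Qed.

Lemma condT (P : Prop) x y : P -> cond P x y = x.
Proof. by rewrite /cond; case: excluded_middle_informative. Qed.

Lemma condF (P : Prop) x y : ~ P -> cond P x y = y.
Proof. by rewrite /cond; case: excluded_middle_informative. Qed.

(** Definition by cases as a recursion of length [chi (P p)]: no step keeps [X], one step moves to
    [Y]. *)
Lemma Def_cond G (P : tup G -> Prop) X Y :
  Dec P -> Def X -> Def Y -> Def (fun p => cond (P p) (X p) (Y p)).
Proof.
  move=> DP DX DY; rewrite /Dec in DP.
  have : Def (fun p => rec (lamM (fun _ => lamM (fun _ => Y p))) (X p) (chi (P p))).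
    by def0.
  case=> u h; exists u => p; rewrite h /chi /cond.
  case: excluded_middle_informative => _; first by rewrite rec0.
  rewrite -(add0l 1) recS lamE; first by def0.
  by rewrite lamE //; def0.
Qed.

End Decidable.

Ltac def_dec :=
  match goal with
  | |- Def (fun p => chi (@?P p)) => change (Dec P); cbv beta
  end.

Ltac dec_tac := cbv beta;
  first [ exact (Dec_const _ _) | def_hyp
        | apply: Dec_not | apply: Dec_iff | apply: Dec_and | apply: Dec_or
        | apply: Dec_imp | apply: Dec_eq | apply: Dec_lt ].

Ltac def1 := repeat first [ dec_tac | def_dec | apply: Def_cond
                          | apply: Def_fun2 | def_tac ].

(** * Induction, predecessor and discreteness of the order *)

Section Arith.

Context {M : structure}.
Notation N := (M tO).
Notation tup := (@tup M).
Implicit Types x y z n m k i j : N.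

(** Quantifier-free induction reaches every decidable predicate, because [f @ n = 0] is
    quantifier-free in the parameter [f]. *)
Lemma ind (P : N -> Prop) : Dec (fun p : tup [tO] => P (fst p)) ->
  P 0 -> (forall n, P n -> P (n + 1)) -> forall n, P n.
Proof.
  move=> DP P0 PS n; set f : M t1 := lamM (fun n => chi (P n)).
  have fE m : f @ m = 0 <-> P m by rewrite /f lamE ?chi0.
  have := ax_sat (@ax_ind _ (Eq (App (Var (ES f)) v0) (Cst cZero)) I).
  move=> h; apply/fE; apply: h n => /=; first exact/fE.
  by move=> m /fE/PS/fE.
Qed.

Definition pred x : N := rec (lamM (fun n => lamM (fun _ => n))) 0 x.

Lemma Def_pred G (X : tup G -> N) : Def X -> Def (fun p => pred (X p)).
Proof. by move=> DX; rewrite /pred; def1. Qed.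

Lemma predS x : pred (x + 1) = x.
Proof. by rewrite /pred recS !lamE //; def1. Qed.

Lemma zero_or_pred x : x = 0 \/ x = pred x + 1.
Proof.
  have D := Def_pred (Def_fst (M := M) [] tO).
  move: x; apply: ind => [||n _]; [by def1|by left|by right; rewrite predS].
Qed.


Lemma lt_addl x y z : x < y -> z + x < z + y.
Proof. by move=> h; rewrite !(addC z); apply: lt_add. Qed.

Lemma ltS x : x < x + 1.
Proof. by have := lt_addl x (@lt01 M); rewrite add0. Qed.

Lemma zero_or_pos x : x = 0 \/ 0 < x.
Proof.
  move: x; apply: ind => [||n h]; [by def1|by left|right].
  by case: h => [->|h]; [rewrite add0l; apply: lt01|apply: lt_trans h (ltS n)].
Qed.

Lemma lt0 x : ~ x < 0.
Proof.
  move=> h; case: (zero_or_pos x) => [e|h']; first by rewrite e in h; apply: lt_irr h.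
  exact: lt_irr (lt_trans h h').
Qed.

Lemma lt_addK x y z : x + z < y + z -> x < y.
Proof.
  move=> h; case: (lt_total x y) => // -[e|/lt_add h']; exfalso.
  - by rewrite e in h; apply: lt_irr h.
  - exact: lt_irr (lt_trans h (h' z)).
Qed.

Lemma add_inj x y z : x + z = y + z -> x = y.
Proof.
  move=> e; case: (lt_total x y) => [/lt_add h|[//|/lt_add h]]; exfalso;
  by have := h z; rewrite e => /lt_irr.
Qed.

Lemma lt1 x : x < 1 -> x = 0.
Proof.
  case: (zero_or_pred x) => // -> h; exfalso.
  by move: h; rewrite -{2}(add0l 1) => /lt_addK/lt0.
Qed.

(** The ordered semi-ring axioms alone do not make the order discrete; induction is essential.
    Subtracting [x] from both sides reduces the claim to the absence of a number strictly between 0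
    and 1. *)
Lemma lt_discrete x y : x < y -> y < x + 1 -> False.
Proof.
  set sub : N -> N -> N := fun a n => rec (lamM (fun _ => lamM (fun b => pred b))) a n.
  have Dp := Def_pred (Def_fst (M := M) [] tO).
  have Dp1 := Def_pred (Def_fst (M := M) [tO] tO).
  have Dp2 := Def_pred (Def_fst (M := M) [tO; tO] tO).
  have subS a n : sub a (n + 1) = pred (sub a n) by rewrite /sub recS !lamE //; def1.
  have sub0 a : sub a 0 = a by rewrite /sub rec0.
  have subSS a n : sub (a + 1) (n + 1) = sub a n.
    move: n; apply: ind => [||n IH]; first by rewrite /sub; def1.
      by rewrite subS !sub0 predS.
    by rewrite subS IH subS.
  have subxx a : sub a a = 0.
    move: a; apply: ind => [|//|n IH]; first by rewrite /sub; def1.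
    by rewrite subSS.
  move=> xy yx.
  (* Each subtraction preserves the inequalities: [sub y n] is positive, and if [sub x n] were 0
     then [lt1] would make [sub y n] vanish. *)
  have h n : sub x n < sub y n /\ sub y n < sub x n + 1.
    move: n; apply: ind => [||n [h1 h2]]; first by rewrite /sub; def1.
      by rewrite !sub0.
    rewrite !subS; case: (zero_or_pred (sub y n)) => e.
      by rewrite e in h1; case: (lt0 h1).
    case: (zero_or_pred (sub x n)) => e'.
      by rewrite e' add0l in h2; move/lt1: h2 => h2; rewrite h2 in h1; case: (lt0 h1).
    by rewrite e e' in h1 h2; split; apply: (@lt_addK _ _ 1).
  have [h1 h2] := h x; rewrite subxx add0l in h1 h2.
  by rewrite (lt1 h2) in h1; apply: lt0 h1.
Qed.

Lemma ltS_le x y : x < y + 1 <-> x < y \/ x = y.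
Proof.
  split=> [h|[h|->]]; [|exact: lt_trans h (ltS y)|exact: ltS].
  case: (lt_total x y) => [|[]]; auto => h'; case: (lt_discrete h' h).
Qed.

Definition le x y := x < y \/ x = y.

End Arith.

Notation "x <= y" := (le x y) : model_scope.

(** * Decidability from the Suslin functional *)

Section Suslin.

Context {M : structure}.
Notation N := (M tO).
Notation tup := (@tup M).
Implicit Types x y z n m k i j : N.
Implicit Types f g : M t1.

Lemma le_refl x : x <= x.
Proof. by right. Qed.

Lemma ltW x y : x < y -> x <= y.
Proof. by left. Qed.

Lemma le_trans x y z : x <= y -> y <= z -> x <= z.
Proof.
  by move=> [xy|->] // [yz|<-]; left => //; apply: lt_trans xy yz.
Qed.

Lemma lt_le_trans x y z : x < y -> y <= z -> x < z.
Proof. by move=> xy [|<-] //; apply: lt_trans. Qed.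

Lemma le_lt_trans x y z : x <= y -> y < z -> x < z.
Proof. by move=> [xy|->] //; apply: lt_trans. Qed.

Lemma leNlt x y : x <= y <-> ~ y < x.
Proof.
  split=> [xy yx|]; first by apply: lt_irr (le_lt_trans xy yx).
  by rewrite /le; case: (lt_total x y) => [|[]]; tauto.
Qed.

Lemma le_lt_dec x y : x <= y \/ y < x.
Proof. by rewrite leNlt; tauto. Qed.

Lemma le0 x : 0 <= x.
Proof. by apply/leNlt/lt0. Qed.

Lemma ltS_leE x y : x < y + 1 <-> x <= y.
Proof. exact: ltS_le. Qed.

Lemma ltSl x y : x < y <-> x + 1 <= y.
Proof.
  rewrite leNlt; split=> [xy /ltS_leE/leNlt //|h].
  by apply: NNPP => /leNlt/ltS_leE.
Qed.

Lemma le_antisym x y : x <= y -> y <= x -> x = y.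
Proof. by move=> [xy|//] /leNlt. Qed.

Lemma leS x : x <= x + 1.
Proof. exact/ltW/ltS. Qed.

Lemma le_add_l x y z : x <= y -> z + x <= z + y.
Proof. by move=> [h|->]; [left; apply: lt_addl|right]. Qed.

Lemma le_add_r x y z : x <= y -> x + z <= y + z.
Proof. by rewrite !(addC _ z); apply: le_add_l. Qed.

Lemma le_addr x y : x <= x + y.
Proof. by rewrite -{1}(add0 x); apply/le_add_l/le0. Qed.

Lemma le_addl x y : x <= y + x.
Proof. by rewrite addC; apply: le_addr. Qed.

Lemma le_mul_r x y z : x <= y -> x * z <= y * z.
Proof.
  case: (zero_or_pos z) => [->|z0]; first by rewrite !mul0; right.
  by case=> [h|->]; [left; apply: lt_mul|right].
Qed.

Lemma le_mul x y z w : x <= y -> z <= w -> x * z <= y * w.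
Proof.
  move=> xy zw; apply: le_trans (le_mul_r z xy) _.
  by rewrite !(mulC y); apply: le_mul_r.
Qed.

Lemma Dec_le G (X Y : tup G -> N) : Def X -> Def Y -> Dec (fun p => X p <= Y p).
Proof. by move=> DX DY; apply: Dec_or; def1. Qed.

Definition sq_snoc x y : N := (x + y) * (x + y) + x + 1.

Lemma snoc_gt x y : x < sq_snoc x y.
Proof. by apply/ltS_leE/le_addl. Qed.

Definition bar g k : N :=
  rec (lamM (fun n => lamM (fun c => sq_snoc c (g @ n)))) 0 k.

Lemma Def_snoc G (X Y : tup G -> N) : Def X -> Def Y -> Def (fun p => sq_snoc (X p) (Y p)).
Proof. by move=> DX DY; rewrite /sq_snoc; def1. Qed.

Lemma Def_bar G (F : tup G -> M t1) X : Def F -> Def X -> Def (fun p => bar (F p) (X p)).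
Proof. by move=> DF DX; rewrite /bar /sq_snoc; def1. Qed.

Lemma bar0 g : bar g 0 = 0.
Proof. exact: rec0. Qed.

Lemma barS g k : bar g (k + 1) = sq_snoc (bar g k) (g @ k).
Proof. by rewrite {1}/bar recS !lamE // /sq_snoc; def1. Qed.

Lemma bar_ge g k : k <= bar g k.
Proof.
  move: k; apply: ind => [||k IH]; first by rewrite /bar /sq_snoc /le; def1.
    exact: le0.
  by rewrite barS; apply/ltSl; apply: le_lt_trans IH (snoc_gt _ _).
Qed.

Lemma ev_initial W (r : env W M) (g : tm W t1) (n : tm W tO) :
  ev r (initial g n) = bar (ev r g) (ev r n).
Proof.
  rewrite -[LHS]/(rec (ev r (lam (lam (snoc v0 (App (wk (wk g)) v1))))) 0 (ev r n)).
  rewrite /bar; congr rec; apply: app_ext => x.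
  rewrite econs_lam; apply: app_ext => y.
  rewrite econs_lam lamE; first by rewrite /sq_snoc; def1.
  rewrite lamE; first by rewrite /sq_snoc; def1.
  by rewrite /= /wk !ev_ren.
Qed.

Lemma suslin : exists S : M t2, forall f,
  (exists g, forall n, f @ bar g n = 0) <-> S @ f = 0.
Proof.
  have : sat (params (M := M)) (S2 M) by apply: carrierP; left; right.
  case/sat_Ex=> S /sat_All Sh; exists S => f.
  have /sat_And [_] := Sh f; rewrite sat_Iff sat_Ex.
  have e g n : ev (econs n (econs g (econs f (econs S params)))) (initial v1 v0)
      = bar g n by rewrite ev_initial.
  rewrite /= -/zero; move=> <-; split=> -[g gh]; exists g => n.
  - by have := gh n; rewrite -(e g n).
  - by rewrite -(e g n); apply: gh.
Qed.

(** Number quantification from the Suslin functional. [b f s] is 0 iff [f] vanishes up to [s]; as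
    [n <= bar g n], a path through the codes [s] with [b f s = 0] exists iff [f] vanishes
    everywhere. *)
Lemma all_chi : exists E : M t2, forall f, E @ f = chi (forall n, f @ n = 0).
Proof.
  have [S Sh] := suslin.
  pose b f s := rec (lamM (fun k => lamM (fun v =>
    cond (v = 0 /\ f @ (k + 1) = 0) (0 : N) 1))) (f @ 0) s.
  have b0 f : b f 0 = f @ 0 by apply: rec0.
  have bS f k : b f (k + 1) = 0 <-> b f k = 0 /\ f @ (k + 1) = 0.
    rewrite {1}/b recS !lamE; [by def1|by def1|].
    by rewrite -/(b f k) -/(chi (b f k = 0 /\ f @ (k + 1) = 0)) chi0.
  exists (lamM (fun f => cond (S @ lamM (fun s => b f s) = 0) 0 1)) => f.
  rewrite lamE; first by rewrite /b; def1.
  rewrite -/(chi _); apply: chi_ext; rewrite -Sh.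
  have Db n : Dec (fun p : tup [tO] => b f (fst p) = 0) by rewrite /b; def1.
  have e g n : lamM (fun s => b f s) @ bar g n = b f (bar g n).
    by rewrite lamE // /b; def1.
  split=> [[g gh] n|fh].
  - have h : forall s, n <= s -> b f s = 0 -> f @ n = 0.
      apply: ind => [||s IH]; first by rewrite /b /le; def1.
        by move=> [/lt0 //|->]; rewrite b0.
      move=> ns /bS [bs fs]; case: ns => [/ltS_leE/IH|->]; auto.
    by apply: h (bar_ge g n) _; rewrite -e.
  - exists f => n; rewrite e; move: (bar f n).
    apply: ind => [||s IH]; [by rewrite /b; def1|by rewrite b0|exact/bS].
Qed.

Lemma Dec_all G (P : tup G -> N -> Prop) :
  Dec (fun p : tup (tO :: G) => P (snd p) (fst p)) -> Dec (fun p => forall n, P p n).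
Proof.
  move=> DP; rewrite /Dec in DP; have [E Eh] := all_chi.
  have : Def (fun p => E @ lamM (fun n => chi (P p n))) by def1.
  case=> u h; exists u => p; rewrite h Eh; apply: chi_ext.
  have e n : lamM (fun n => chi (P p n)) @ n = chi (P p n).
    exact: (lamM_spec (F := fun q => chi (P (snd q) (fst q)))).
  by split=> H n; have := H n; rewrite e chi0.
Qed.

Lemma Dec_ex G (P : tup G -> N -> Prop) :
  Dec (fun p : tup (tO :: G) => P (snd p) (fst p)) -> Dec (fun p => exists n, P p n).
Proof.
  move=> DP; apply: (Dec_ext (P := fun p => ~ forall n, ~ P p n)) => [p|].
    by split; [apply: not_all_not_ex|move=> [n Pn] h; apply: (h n)].
  by apply/Dec_not/Dec_all/Dec_not.
Qed.

End Suslin.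

Ltac dec_quant :=
  match goal with
  | |- @Dec ?M ?G (fun p => forall n : car _ tO, @?P p n) => refine (@Dec_all M G P _)
  | |- @Dec ?M ?G (fun p => exists n : car _ tO, @?P p n) => refine (@Dec_ex M G P _)
  end; cbv beta.

Section Composition.

Context {M : structure}.
Notation tup := (@tup M).

Lemma Def_comp1 G r t (F : M r -> M t) (X : tup G -> M r) :
  Def (fun p : tup [r] => F (fst p)) -> Def X -> Def (fun p => F (X p)).
Proof.
  move=> DF DX; have : Def (fun p => lamM F @ X p).
    by apply: Def_app => //; apply: Def_const.
  by case=> u h; exists u => p; rewrite h lamE.
Qed.

Lemma Def_comp2 G r s t (F : M r -> M s -> M t) (X : tup G -> M r) Y :
  Def (fun p : tup [r; s] => F (fst p) (fst (snd p))) -> Def X -> Def Y ->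
  Def (fun p => F (X p) (Y p)).
Proof.
  move=> DF DX DY.
  have DL : Def (fun p : tup [s] => lamM (fun x => F x (fst p))).
    exact: (Def_lam (F := fun q : tup [r; s] => F (fst q) (fst (snd q)))).
  have : Def (fun p => lamM (fun x => F x (Y p)) @ X p).
    by apply: Def_app => //; exact: (@Def_comp1 G s (r ⇒ t) (fun y => lamM (fun x => F x y)) Y DL DY).
  case=> u h; exists u => p; rewrite h.
  exact: (@lamM_spec M [s] r t (fun q => F (fst q) (fst (snd q))) (Y p, tt)).
Qed.

Lemma Dec_comp1 G r (P : M r -> Prop) (X : tup G -> M r) :
  Dec (fun p : tup [r] => P (fst p)) -> Def X -> Dec (fun p => P (X p)).
Proof. exact: (@Def_comp1 G r tO (fun x => chi (P x))). Qed.

Lemma Dec_comp2 G r s (P : M r -> M s -> Prop) (X : tup G -> M r) Y :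
  Dec (fun p : tup [r; s] => P (fst p) (fst (snd p))) -> Def X -> Def Y ->
  Dec (fun p => P (X p) (Y p)).
Proof. exact: (@Def_comp2 G r s tO (fun x y => chi (P x y))). Qed.

Lemma N_semi_ring : semi_ring_theory (0 : M tO) 1 add mul eq.
Proof.
  split=> *; rewrite ?add0l ?addA ?mulA //.
  - exact: addC.
  - by rewrite mulC mul1.
  - by rewrite mulC mul0.
  - exact: mulC.
  - by rewrite mulC mulD; congr add; apply: mulC.
Qed.

End Composition.

Ltac def_comp :=
  match goal with
  | H : Def (fun p => ?F (fst p)) |- Def (fun q => ?F (@?X q)) => refine (Def_comp1 (F := F) (X := X) H _)
  | H : Dec (fun p => ?F (fst p)) |- Dec (fun q => ?F (@?X q)) => refine (Dec_comp1 (P := F) (X := X) H _)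
  | H : Def (fun p => ?F (fst p) (fst (snd p))) |- Def (fun q => ?F (@?X q) (@?Y q)) =>
      refine (Def_comp2 (F := F) (X := X) (Y := Y) H _ _)
  | H : Dec (fun p => ?F (fst p) (fst (snd p))) |- Dec (fun q => ?F (@?X q) (@?Y q)) =>
      refine (Dec_comp2 (P := F) (X := X) (Y := Y) H _ _)
  end.

Ltac def2 := repeat first
  [ def_comp | dec_tac | apply: Dec_le | dec_quant | def_dec | apply: Def_cond | apply: Def_bar
  | apply: Def_snoc | apply: Def_fun2 | def_tac ].

(** * The operator mu and least numbers *)

Section Sequences.

Context {M : structure}.
Notation N := (M tO).
Notation tup := (@tup M).
Implicit Types x y z n m k i j a b s t : N.
Implicit Types f g h : M t1.
Add Ring N_ring : (@N_semi_ring M).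

Lemma Dec_eq1 G (F H : tup G -> M t1) : Def F -> Def H -> Dec (fun p => F p = H p).
Proof.
  move=> DF DH; apply: (Dec_ext (P := fun p => forall n, F p @ n = H p @ n)) => [p|].
    by split=> [|-> //]; apply: app_ext.
  by def2.
Qed.

(** With the characteristic functional [C] of [∃ n, f n = 0] as a parameter, the matrix
    [C f = 0 → f y = 0] is quantifier-free, so choice applies. *)
Lemma mu_exists :
  exists mu : M t2, forall f, (exists n, f @ n = 0) -> f @ (mu @ f) = 0.
Proof.
  have [C Ch] : exists C : M t2, forall f, C @ f = chi (exists n, f @ n = 0).
    by exists (lamM (fun f => chi (exists n, f @ n = 0))) => f; rewrite lamE //; def2.
  have [//|f|mu muP] := @qf_ac M (Imp (Eq (App (Var (ES (ES C))) v1) (Cst cZero))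
                                  (Eq (App v1 v0) (Cst cZero))).
    case: (classic (exists n, f @ n = 0)) => [[n fn]|nf]; first by exists n => /= _.
    by exists 0 => /=; rewrite Ch => /chi0.
  by exists mu => f fn; apply: muP; rewrite /= Ch; apply/chi0.
Qed.

Definition mu : M t2 := epsilon (inhabits (dflt t2))
  (fun mu : M t2 => forall f, (exists n, f @ n = 0) -> f @ (mu @ f) = 0).

(** A choice that is uniform in parameters; without a solution the value is arbitrary. *)
Definition some (P : N -> Prop) : N := mu @ lamM (fun n => chi (P n)).

Lemma someP (P : N -> Prop) : Dec (fun p : tup [tO] => P (fst p)) ->
  (exists n, P n) -> P (some P).
Proof.
  move=> DP [n Pn].
  have e m : lamM (fun n => chi (P n)) @ m = 0 <-> P m by rewrite lamE ?chi0.
  apply/e; apply: (epsilon_spec (inhabits (dflt t2)) _ mu_exists).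
  by exists n; apply/e.
Qed.

Lemma Def_some G (P : tup G -> N -> Prop) :
  Dec (fun p : tup (tO :: G) => P (snd p) (fst p)) -> Def (fun p => some (P p)).
Proof. by move=> DP; rewrite /Dec in DP; rewrite /some; def2. Qed.

Lemma some_eq (P : N -> Prop) n : Dec (fun p : tup [tO] => P (fst p)) ->
  P n -> (forall m, P m -> m = n) -> some P = n.
Proof. by move=> DP Pn; apply; apply: someP => //; exists n. Qed.

Lemma le_exists x y : x <= y -> exists z, y = x + z.
Proof.
  move: y; apply: ind => [||y IH]; first by def2.
    by case=> [/lt0 //|->]; exists 0; rewrite add0.
  case=> [/ltS_leE/IH [z ->]|->]; last by exists 0; rewrite add0.
  by exists (z + 1); rewrite addA.
Qed.

Lemma lt_exists x y : x < y -> exists z, y = z + 1 + x.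
Proof.
  by move=> /ltSl/le_exists [z ->]; exists z; ring.
Qed.

Lemma lnp (P : N -> Prop) : Dec (fun p : tup [tO] => P (fst p)) ->
  (exists n, P n) -> exists n, P n /\ forall m, m < n -> ~ P m.
Proof.
  move=> DP [n Pn]; apply: NNPP => nP.
  have h : forall k m, m < k -> ~ P m.
    apply: ind => [|m /lt0 //|k IH m /ltS_le [/IH //|-> Pk]].
      by def2.
    by apply: nP; exists k.
  exact: h (ltS n) Pn.
Qed.

End Sequences.

Global Opaque Def lamM chi cond some rec.

Ltac def_ext := fail.

Ltac def_step := cbv beta; first [ def_hyp | def_comp | def_ext |
  lazymatch goal with
  | |- Dec (fun _ => ?P) => exact (Dec_const _ P)
  | |- Def (fun _ => ?c) => exact (Def_const _ c)
  | |- Def (fun p => chi (@?P p)) => change (Dec P)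
  | |- @Dec ?M ?G (fun p => forall n : car _ tO, @?P p n) => refine (@Dec_all M G P _)
  | |- @Dec ?M ?G (fun p => exists n : car _ tO, @?P p n) => refine (@Dec_ex M G P _)
  | |- Dec (fun p => ~ _) => apply: Dec_not
  | |- Dec (fun p => _ /\ _) => apply: Dec_and
  | |- Dec (fun p => _ \/ _) => apply: Dec_or
  | |- Dec (fun p => _ <-> _) => apply: Dec_iff
  | |- Dec (fun p => @eq (car _ tO) _ _) => apply: Dec_eq
  | |- Dec (fun p => @eq (car _ (tO ⇒ tO)) _ _) => apply: Dec_eq1
  | |- Dec (fun p => _ < _) => apply: Dec_lt
  | |- Dec (fun p => _ <= _) => apply: Dec_le
  | |- Dec (fun p => _ -> _) => apply: Dec_imp
  | |- @Def ?M ?G _ (fun p => @lamM _ ?s ?t (fun x => @?B p x)) =>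
      refine (@Def_lam M G s t (fun q => B (snd q) (fst q)) _)
  | |- @Def ?M ?G _ (fun p => some (fun n => @?P p n)) => refine (@Def_some M G P _)
  | |- Def (fun p => cond _ _ _) => apply: Def_cond
  | |- Def (fun p => bar _ _) => apply: Def_bar
  | |- Def (fun p => sq_snoc _ _) => apply: Def_snoc
  | |- Def (fun p => rec _ _ _) => apply: Def_rec
  | |- Def (fun p => pred _) => apply: Def_pred
  | |- Def (fun p => _ + _) => apply: Def_add
  | |- Def (fun p => _ * _) => apply: Def_mul
  | |- Def (fun p => _ @ _) => apply: Def_app
  | |- Def _ => def_var
  end | match goal with hdef : forall G : list ty, _ |- _ => apply: hdef end ].

Ltac def := repeat def_step.

(** * Sequence codes and their decoding *)

Section Codes.

Context {M : structure}.
Notation N := (M tO).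
Notation tup := (@tup M).
Implicit Types x y z n m k i j a b s t : N.
Implicit Types f g h : M t1.
Add Ring N_ring : (@N_semi_ring M).

(** [a + x] is the integer part of the square root of the code minus one, since
    [(a + x)^2 + a < (a + x + 1)^2]; the remainder then gives [a]. *)
Lemma snoc_inj a x b y : sq_snoc a x = sq_snoc b y -> a = b /\ x = y.
Proof.
  have lt a' x' b' y' : a' + x' < b' + y' -> sq_snoc a' x' < sq_snoc b' y'.
    move=> h; rewrite /sq_snoc; apply: lt_add.
    have {}h : (a' + x' + 1) * (a' + x' + 1) <= (b' + y') * (b' + y').
      by apply: le_mul; apply/ltSl.
    apply: lt_le_trans (le_trans h (le_addr _ b')).
    have -> : (a' + x' + 1) * (a' + x' + 1)
        = (a' + x') * (a' + x') + a' + (a' + x' + x' + 1) by ring.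
    apply: lt_le_trans (ltS _) _; apply: le_add_l; exact: le_addl.
  move=> e; case: (lt_total (a + x) (b + y)) => [/lt|[e'|/lt]];
    try by rewrite e => /lt_irr.
  have e1 : a = b.
    move: e; rewrite /sq_snoc e' => /add_inj; rewrite !(addC ((b + y) * _)).
    exact: add_inj.
  by split=> //; move: e'; rewrite e1 !(addC b) => /add_inj.
Qed.

Definition ini s : N := some (fun a => exists x, s = sq_snoc a x).
Definition las s : N := some (fun x => exists a, s = sq_snoc a x).

Lemma Def_ini G (S : tup G -> N) : Def S -> Def (fun p => ini (S p)).
Proof. by move=> DS; rewrite /ini; def. Qed.

Lemma Def_las G (S : tup G -> N) : Def S -> Def (fun p => las (S p)).
Proof. by move=> DS; rewrite /las; def. Qed.

Lemma ini_snoc a x : ini (sq_snoc a x) = a.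
Proof.
  apply: some_eq; [by def|by exists x|].
  by move=> b [y /snoc_inj [->]].
Qed.

Lemma las_snoc a x : las (sq_snoc a x) = x.
Proof.
  apply: some_eq; [by def|by exists a|].
  by move=> b [y /snoc_inj [_ ->]].
Qed.

Definition down s n : N := rec (lamM (fun _ => lamM (fun v => ini v))) s n.

Lemma down0 s : down s 0 = s.
Proof. exact: rec0. Qed.

Lemma downS s n : down s (n + 1) = ini (down s n).
Proof. by rewrite /down recS !lamE // /ini; def. Qed.

Lemma downSl s n : down s (n + 1) = down (ini s) n.
Proof.
  move: n; apply: ind => [||n IH]; first by rewrite /down /ini; def.
    by rewrite downS !down0.
  by rewrite downS IH downS.
Qed.

Lemma down_bar g i m : down (bar g (i + m)) m = bar g i.
Proof.
  move: m; apply: ind => [||m IH]; first by rewrite /down /ini; def.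
    by rewrite down0 add0.
  by rewrite downSl addA barS ini_snoc.
Qed.

(** Not every number is a sequence code; on the others [ini], and with it [len], is unspecified. *)
Definition len s : N :=
  some (fun n => down s n = 0 /\ forall m, m < n -> down s m <> 0).

Lemma Def_len G (S : tup G -> N) : Def S -> Def (fun p => len (S p)).
Proof. by move=> DS; rewrite /len /down /ini; def. Qed.

Lemma len_bar g k : len (bar g k) = k.
Proof.
  have h m : m < k -> down (bar g k) m <> 0.
    move/lt_exists => [z ->]; rewrite down_bar => e.
    have := bar_ge g (z + 1); rewrite e => /leNlt; apply.
    exact: le_lt_trans (le0 z) (ltS z).
  have h0 : down (bar g k) k = 0 by rewrite -{1}(add0l k) down_bar bar0.
  apply: some_eq; first by rewrite /down /ini; def.
    by split.
  move=> n [n0 nm]; case: (lt_total n k) => [/h //|[//|/nm]].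
  by rewrite h0.
Qed.

Definition entry s i : N := some (fun x => exists m, m < len s /\
  exists a, down s m = sq_snoc a x /\ len a = i).
(** Beyond the length of [s] the values are unspecified. Such functions let continuous relations be
    tested by quantifying over numbers. *)
Definition hat s : M t1 := lamM (fun i => entry s i).

Lemma Def_entry G (S X : tup G -> N) :
  Def S -> Def X -> Def (fun p => entry (S p) (X p)).
Proof. by move=> DS DX; rewrite /entry /len /down /ini; def. Qed.

Lemma Def_hat G (S : tup G -> N) : Def S -> Def (fun p => hat (S p)).
Proof. by move=> DS; rewrite /hat /entry /len /down /ini; def. Qed.

Lemma hat_bar g k i : i < k -> hat (bar g k) @ i = g @ i.
Proof.
  move=> ik; rewrite /hat lamE; first by rewrite /entry /len /down /ini; def.
  apply: some_eq; first by rewrite /len /down /ini; def.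
  - case: (lt_exists ik) => z ->; exists z; rewrite len_bar; split.
      by rewrite -addA; apply: lt_le_trans (ltS z) _; apply/le_add_l/le_addr.
    exists (bar g i); rewrite len_bar; split=> //.
    by rewrite -barS (_ : z + 1 + i = i + 1 + z) ?down_bar //; ring.
  - move=> x [m []]; rewrite len_bar => /lt_exists [z ->] [a []].
    by rewrite down_bar barS => /snoc_inj [<- <-]; rewrite len_bar => ->.
Qed.

Definition agree g h k := forall i, i < k -> g @ i = h @ i.

Lemma bar_agree g h k : agree g h k -> bar g k = bar h k.
Proof.
  move: k; apply: ind => [||k IH gh]; first by rewrite /agree; def.
    by rewrite !bar0.
  rewrite !barS (gh _ (ltS k)) IH //.
  by move=> i ik; apply: gh; apply: lt_trans ik (ltS k).
Qed.

Lemma agree_hat g k : agree (hat (bar g k)) g k.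
Proof. by move=> i; apply: hat_bar. Qed.

Lemma agree_sym g h k : agree g h k -> agree h g k.
Proof. by move=> gh i /gh. Qed.

Lemma agree_trans f g h k : agree f g k -> agree g h k -> agree f h k.
Proof. by move=> fg gh i ik; rewrite fg // gh. Qed.

Lemma agree_le g h k m : k <= m -> agree g h m -> agree g h k.
Proof. by move=> km gh i ik; apply: gh; apply: lt_le_trans ik km. Qed.

Lemma Dec_agree G (F H : tup G -> M t1) X :
  Def F -> Def H -> Def X -> Dec (fun p => agree (F p) (H p) (X p)).
Proof. by move=> DF DH DX; rewrite /agree; def. Qed.

End Codes.

Ltac def_ext ::=
  lazymatch goal with
  | |- Def (fun p => ini _) => apply: Def_ini
  | |- Def (fun p => las _) => apply: Def_las
  | |- Def (fun p => len _) => apply: Def_len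
  | |- Def (fun p => entry _ _) => apply: Def_entry
  | |- Def (fun p => hat _) => apply: Def_hat
  | |- Dec (fun p => agree _ _ _) => apply: Dec_agree
  end.

(** * Continuous relations and the Suslin functional *)

Section Continuity.

Context {M : structure}.
Notation N := (M tO).
Notation tup := (@tup M).
Implicit Types x y z n m k i j a b s t : N.
Implicit Types f g h : M t1.
Add Ring N_ring' : (@N_semi_ring M).

(** Continuity with respect to the discrete topology on [T]. *)
Definition LC (T : Type) (F : M t1 -> T) :=
  forall g, exists m, forall h, agree g h m -> F g = F h.

Lemma LC_const T (c : T) : LC (fun _ => c).
Proof. by exists 0. Qed.

Lemma LC_app1 T1 T (H : T1 -> T) F : LC F -> LC (fun g => H (F g)).
Proof. by move=> CF g; have [m h] := CF g; exists m => k /h ->. Qed.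

Lemma LC_app2 T1 T2 T (H : T1 -> T2 -> T) F1 F2 :
  LC F1 -> LC F2 -> LC (fun g => H (F1 g) (F2 g)).
Proof.
  move=> C1 C2 g; have [m1 h1] := C1 g; have [m2 h2] := C2 g.
  exists (m1 + m2) => h gh.
  by rewrite (h1 h (agree_le (le_addr _ _) gh)) (h2 h (agree_le (le_addl _ _) gh)).
Qed.

(** Continuity of maps of the Baire space into itself. *)
Definition CT (c : M t1 -> M t1) :=
  forall g k, exists m, forall h, agree g h m -> agree (c g) (c h) k.

Lemma LC_CT T (F : M t1 -> T) c : LC F -> CT c -> LC (fun g => F (c g)).
Proof.
  move=> CF Cc g; have [m h] := CF (c g); have [k hk] := Cc g m.
  by exists k => g' /hk/h.
Qed.

Lemma CT_comp c d : CT c -> CT d -> CT (fun g => c (d g)).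
Proof.
  move=> Cc Cd g k; have [m h] := Cc (d g) k; have [m' h'] := Cd g m.
  by exists m' => g' /h'/h.
Qed.

Lemma CT_id : CT (fun g => g).
Proof. by move=> g k; exists k. Qed.

Lemma CT_cst f : CT (fun _ => f).
Proof. by move=> g k; exists 0. Qed.

Lemma LC_app_CT c F : CT c -> LC F -> LC (fun g => c g @ F g).
Proof.
  move=> Cc CF g; have [m h] := CF g; have [k hk] := Cc g (F g + 1).
  exists (m + k) => g' gg'; rewrite -(h g').
    by apply: agree_le gg'; apply: le_addr.
  apply: hk; last exact: ltS.
  by apply: agree_le gg'; apply: le_addl.
Qed.

Definition col g j : M t1 := lamM (fun i => g @ sq_snoc j i).

Lemma Def_col G (F : tup G -> M t1) X : Def F -> Def X -> Def (fun p => col (F p) (X p)).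
Proof. by move=> DF DX; rewrite /col; def. Qed.

Lemma colE g j i : col g j @ i = g @ sq_snoc j i.
Proof. by rewrite /col lamE //; def. Qed.

Lemma snoc_mono j i k : i < k -> sq_snoc j i < sq_snoc j k.
Proof.
  move=> ik; rewrite /sq_snoc; do 2!apply: lt_add.
  have h : j + i < j + k by apply: lt_addl.
  apply: le_lt_trans (_ : _ <= (j + k) * (j + i)) _; first exact/le_mul_r/ltW.
  by rewrite mulC; apply: lt_mul => //; apply: le_lt_trans (le0 _) h.
Qed.

Lemma CT_col j : CT (fun g => col g j).
Proof.
  move=> g k; exists (sq_snoc j k) => h gh i ik.
  by rewrite !colE; apply/gh/snoc_mono.
Qed.

Lemma col_exists (c : N -> N -> N) :
  Def (fun p : tup [tO; tO] => c (fst p) (fst (snd p))) ->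
  exists g, forall j i, col g j @ i = c j i.
Proof.
  move=> Dc; exists (lamM (fun k => c (ini k) (las k))) => j i.
  rewrite colE lamE; first by def.
  by rewrite ini_snoc las_snoc.
Qed.

(** The Suslin functional sees [g] only through [bar g k], so [Q] is replaced by a condition on
    codes: for each [n] below the length of [s], some [hat t] extending [s] satisfies [Q] at [n].
    Along a path of such codes continuity forces [Q] at every [n], and it supplies the extensions
    needed for the converse. Pointwise continuity is enough; the model need not contain a
    modulus. *)
Lemma Dec_suslin G (Q : tup G -> M t1 -> N -> Prop) :
  Dec (fun p : tup (tO :: t1 :: G) => Q (snd (snd p)) (fst (snd p)) (fst p)) ->
  (forall p n, LC (fun g => Q p g n)) ->
  Dec (fun p => exists g, forall n, Q p g n).
Proof.
  move=> DQ CQ; have [S Sh] := @suslin M; rewrite /Dec in DQ.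
  pose L p := lamM (fun g => lamM (fun n => chi (Q p g n))).
  have DL : Def L by rewrite /L; def.
  have LE p g n : L p @ g @ n = 0 <-> Q p g n.
    have /= e : _ -> _ := @lamM_spec M G t1 t1 (fun q : tup (t1 :: G) =>
      lamM (fun n => chi (Q (snd q) (fst q) n))) p g.
    suff -> : L p @ g @ n = chi (Q p g n) by rewrite chi0.
    rewrite /L e; first by def.
    have /= -> // := @lamM_spec M (t1 :: G) tO tO (fun q : tup (tO :: t1 :: G) =>
      chi (Q (snd (snd q)) (fst (snd q)) (fst q))) (g, p) n DQ.
  move: L DL LE => L DL LE.
  pose R p s := forall n, n < len s ->
    exists t, agree (hat s) (hat t) (len s) /\ L p @ hat t @ n = 0.
  have : Def (fun p => chi (S @ lamM (fun s => chi (R p s)) = 0)) by rewrite /R; def.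
  apply: Dec_ext => p; rewrite -Sh.
  have RE g k : lamM (fun s => chi (R p s)) @ bar g k = 0 <-> 
      forall n, n < k -> exists t, agree g (hat t) k /\ Q p (hat t) n.
    have DR : Def (fun q : tup (tO :: G) => chi (R (snd q) (fst q))).
      by rewrite /R; def.
    have /= -> := lamM_spec p (bar g k) DR.
    rewrite chi0 /R /= len_bar; split=> h n /h [t [a q]]; exists t; split;
      try exact/LE;
      [apply: agree_trans a; apply: agree_sym|apply: agree_trans a]; exact: agree_hat.
  split=> -[g gh]; exists g => n.
  - have [m Cm] := CQ p n g.
    (* A prefix longer than [n], so that clause [n] is tested, and at least [m] long, so that
       continuity applies. *)
    have [|t [a q]] := proj1 (RE g (m + (n + 1))) (gh _) n.
      by apply: lt_le_trans (ltS n) _; apply: le_addl.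
    by rewrite (Cm (hat t)) //; apply: agree_le a; apply: le_addr.
  - apply/RE => k kn; have [m Cm] := CQ p k g.
    exists (bar g (m + n)); have a := agree_sym (@agree_hat _ g (m + n)); split.
      by apply: agree_le a; apply: le_addl.
    by rewrite -(Cm (hat (bar g (m + n)))) //; apply: agree_le a; apply: le_addr.
Qed.

End Continuity.

Ltac lc :=
  repeat (cbv beta; lazymatch goal with
  | |- LC (fun _ => ?c) => exact (LC_const c)
  | |- LC (fun g => ~ @?A g) => refine (LC_app1 (fun P => ~ P) (F := A) _)
  | |- LC (fun g => @?A g /\ @?B g) => refine (LC_app2 and (F1 := A) (F2 := B) _ _)
  | |- LC (fun g => @?A g \/ @?B g) => refine (LC_app2 or (F1 := A) (F2 := B) _ _)
  | |- LC (fun g => @?A g <-> @?B g) => refine (LC_app2 iff (F1 := A) (F2 := B) _ _)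
  | |- LC (fun g => @?A g = @?B g) => refine (LC_app2 eq (F1 := A) (F2 := B) _ _)
  | |- LC (fun g => sq_snoc (@?A g) (@?B g)) =>
      refine (LC_app2 sq_snoc (F1 := A) (F2 := B) _ _)
  | |- LC (fun g => @?A g -> @?B g) =>
      refine (LC_app2 (fun P Q : Prop => P -> Q) (F1 := A) (F2 := B) _ _)
  | |- LC (fun g => @?c g @ @?A g) => refine (LC_app_CT (c := c) (F := A) _ _)
  | |- CT (fun g => g) => exact CT_id
  | |- CT (fun _ => ?f) => exact (CT_cst f)
  | |- CT (fun g => col (@?c g) ?j) => refine (CT_comp (CT_col j) (d := c) _)
  | |- _ => match goal with hlc : forall c F, _ |- _ => apply: hlc end
  end).

(** * Ranks and uniformization *)

Section Ranks.

Context {M : structure}.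
Notation N := (M tO).
Notation tup := (@tup M).
Implicit Types x y z n m k i j a b s t u v : N.
Implicit Types f g h X Y Z : M t1.

Lemma join_cols f g : exists h, col h 0 = f /\ col h 1 = g.
Proof.
  have [|h hh] := @col_exists M (fun j i => cond (j = 0) (f @ i) (g @ i)); first by def.
  exists h; split; apply: app_ext => n; rewrite hh; first by rewrite condT.
  by rewrite condF // => e; apply: (@not01 M); rewrite e.
Qed.

Definition shift x g : M t1 := lamM (fun n => cond (n = 0) x (g @ pred n)).

Lemma succ_ne0 x : x + 1 <> 0.
Proof. by move=> e; have := ltS x; rewrite e => /lt0. Qed.

Lemma shift0 x g : shift x g @ 0 = x.
Proof. by rewrite /shift lamE; [def|rewrite condT]. Qed.

Lemma shiftS x g n : shift x g @ (n + 1) = g @ n.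
Proof. by rewrite /shift lamE; [def|rewrite condF ?predS //; apply: succ_ne0]. Qed.

(** [D i X s t] reads: [t] is a child of [s] in the tree given by [i] and [X]. *)
Variable D : N -> M t1 -> N -> N -> Prop.

Hypothesis Dec_D : forall G (I : tup G -> N) (X : tup G -> M t1) S T, Def I -> Def X -> Def S -> Def T ->
  Dec (fun p => D (I p) (X p) (S p) (T p)).
Hypothesis D_local : forall i X Y s t, agree X Y t -> D i X s t -> D i Y s t.
Hypothesis D_lt : forall i X s t, D i X s t -> s < t.
Hypothesis D_parent : forall i X s t, D i X s t -> s = 0 \/ exists r, D i X r s.

(** Clause [n] of: [r] is a simulation with replies [w]. The number [n] codes [((s, t), u)]; if [r]
    relates [s] to [t] and [u] is a child of [s], then [w n] is a child of [t] to which [u] is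
    related. With replies given by a function, being a simulation is one number quantifier over a
    continuous condition. *)
Definition simc i X Y r w n := r @ ini n = 0 -> D i X (ini (ini n)) (las n) ->
  D i Y (las (ini n)) (w @ n) /\ r @ sq_snoc (las n) (w @ n) = 0.

(** The rank of the node [s] of the tree of [X] is at most that of the node [t] of the
    tree of [Y]: the largest simulation, so that no ordinals are needed. *)
Definition rle i X Y s t := exists g, forall n,
  col g 0 @ sq_snoc s t = 0 /\ simc i X Y (col g 0) (col g 1) n.

Lemma LC_D i s c F : CT c -> LC F -> LC (fun g => D i (c g) s (F g)).
Proof.
  move=> Cc CF g; have [m h] := CF g; have [k hk] := Cc g (F g); exists (m + k) => g' gg'.
  rewrite -(h g' (agree_le (le_addr _ _) gg')).
  have a := hk g' (agree_le (le_addl _ _) gg').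
  apply: propositional_extensionality; split; apply: D_local => //; exact: agree_sym.
Qed.

Lemma Dec_simc G (I : tup G -> N) (X Y : tup G -> M t1) R W K :
  Def I -> Def X -> Def Y -> Def R -> Def W -> Def K ->
  Dec (fun p => simc (I p) (X p) (Y p) (R p) (W p) (K p)).
Proof. by move=> DI DX DY DR DW DK; rewrite /simc; def. Qed.

Lemma LC_simc i n c d r w : CT c -> CT d -> CT r -> CT w ->
  LC (fun g => simc i (c g) (d g) (r g) (w g) n).
Proof. by move=> Cc Cd Cr Cw; rewrite /simc; have := LC_D i => C; lc. Qed.

Lemma Dec_rle G (I : tup G -> N) (X Y : tup G -> M t1) S T :
  Def I -> Def X -> Def Y -> Def S -> Def T ->
  Dec (fun p => rle (I p) (X p) (Y p) (S p) (T p)).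
Proof.
  move=> DI DX DY DS DT; apply: Dec_suslin => [|p n].
    have := @Def_col M => DC; have := Dec_simc => DS'; def.
  have := @LC_simc => C; lc.
Qed.

(** Coinduction: a decidable simulation lies inside the largest one. The replies are picked by
    [some]. *)
Lemma rle_coind i X Y (R : N -> N -> Prop) s t :
  Dec (fun p : tup [tO; tO] => R (fst p) (fst (snd p))) -> R s t ->
  (forall s t u, R s t -> D i X s u -> exists v, D i Y t v /\ R u v) -> rle i X Y s t.
Proof.
  move=> DR Rst h.
  have [g [e1 e2]] := join_cols (lamM (fun k => chi (R (ini k) (las k))))
    (lamM (fun n => some (fun v => D i Y (las (ini n)) v /\ R (las n) v))).
  have rE k : col g 0 @ k = 0 <-> R (ini k) (las k).
    by rewrite e1 lamE ?chi0 //; def.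
  have wE n : (exists v, D i Y (las (ini n)) v /\ R (las n) v) ->
      D i Y (las (ini n)) (col g 1 @ n) /\ R (las n) (col g 1 @ n).
    by move=> ex; rewrite e2 lamE; [def|apply: (someP _ ex); def].
  exists g => n; split; first by rewrite rE ini_snoc las_snoc.
  move=> /rE r d; rewrite rE ini_snoc las_snoc; apply: wE; exact: h r d.
Qed.

Section Fixed.

Variable i : N.
Notation Di := (D i).
Notation rl := (rle i).
Notation sm := (simc i).

Lemma sim_rle X Y r w s t : (forall n, sm X Y r w n) -> r @ sq_snoc s t = 0 ->
  rl X Y s t.
Proof. by move=> h rst; have [g [e1 e2]] := join_cols r w; exists g => n; rewrite e1 e2. Qed.

Lemma rle_elim X Y s t u : rl X Y s t -> Di X s u -> exists v, Di Y t v /\ rl X Y u v.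
Proof.
  move=> [g gh] d; have [r _] := gh 0; have [_] := gh (sq_snoc (sq_snoc s t) u).
  rewrite /simc !ini_snoc !las_snoc => /(_ r d) [d' r'].
  by eexists; split; first exact: d'; exists g => n; split=> //; case: (gh n).
Qed.

Lemma rle_intro X Y s t : (forall u, Di X s u -> exists v, Di Y t v /\ rl X Y u v) ->
  rl X Y s t.
Proof.
  move=> h; apply: (rle_coind (R := fun a b => (a = s /\ b = t) \/ rl X Y a b)).
  - by have := Dec_rle => DR; def.
  - by left.
  - move=> a b u [[-> ->] /h|r d]; first by move=> [v [d r]]; exists v; auto.
    by have [v [d' r']] := rle_elim r d; exists v; auto.
Qed.

(** As [rle] is itself a decidable simulation, one pair [r], [w] serves all nodes at once;
    [Dec_reach] can therefore ask for a single pair. *)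
Lemma rle_sim X Y : exists r w, (forall n, sm X Y r w n) /\
  forall s t, rl X Y s t -> r @ sq_snoc s t = 0.
Proof.
  have DR := Dec_rle.
  exists (lamM (fun k => chi (rl X Y (ini k) (las k)))).
  exists (lamM (fun n => some (fun v => Di Y (las (ini n)) v /\ rl X Y (las n) v))).
  split=> [n|s t r]; last first.
    by rewrite lamE; [def|rewrite ini_snoc las_snoc chi0].
  rewrite /simc !lamE; [def|def|def|rewrite !chi0 ini_snoc las_snoc => r d].
  by apply: (someP _ (rle_elim r d)); def.
Qed.

Lemma rle_refl X s : rl X X s s.
Proof.
  apply: (rle_coind (R := fun a b => a = b)) => //; first by def.
  by move=> a b u -> d; exists u.
Qed.

Lemma rle_trans Y X Z s t u : rl X Y s t -> rl Y Z t u -> rl X Z s u.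
Proof.
  move=> st tu; have DR := Dec_rle.
  apply: (rle_coind (R := fun a b => exists c, rl X Y a c /\ rl Y Z c b)).
  - by def.
  - by exists t.
  - move=> a b a' [c [ac cb]] d; have [c' [d' ac']] := rle_elim ac d.
    have [b' [d'' cb']] := rle_elim cb d'.
    by exists b'; split=> //; exists c'.
Qed.

Definition path X g := forall k, Di X (g @ k) (g @ (k + 1)).
Definition WF X := ~ exists g, path X g.

(** A node violating [P] has a child violating [P]; iterating the choice by [some] with the type 0
    recursor builds a path. *)
Lemma wf_ind X (P : N -> Prop) : WF X -> Dec (fun p : tup [tO] => P (fst p)) ->
  (forall s, (forall u, Di X s u -> P u) -> P s) -> forall s, P s.
Proof.
  move=> wf DP h s; apply: NNPP => nP; apply: wf.
  pose next v := some (fun u => Di X v u /\ ~ P u).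
  have nextP v : ~ P v -> Di X v (next v) /\ ~ P (next v).
    move=> nPv; apply: (someP (P := fun u => Di X v u /\ ~ P u)); first by def.
    apply: NNPP => ne; apply: nPv; apply: h => u d.
    by apply: NNPP => nPu; apply: ne; exists u.
  have Dn : Def (fun p : tup [tO] => next (fst p)) by rewrite /next; def.
  pose F := lamM (fun _ : N => lamM (fun v => next v)).
  have FE k v : F @ k @ v = next v by rewrite /F !lamE //; def.
  have nPk k : ~ P (rec F s k).
    move: k; apply: ind => [||k IH]; [by def|by rewrite rec0|].
    by rewrite recS FE; apply: (proj2 (nextP _ IH)).
  exists (lamM (fun k => rec F s k)) => k; rewrite !lamE; [by def|by def|].
  by rewrite recS FE; apply: (proj1 (nextP _ (nPk k))).
Qed.

Ltac wf_induct wf :=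
  match goal with |- forall s, @?P s => apply: (wf_ind (P := P) wf); cbv beta end.

Lemma child_rle X s u : WF X -> Di X s u -> rl X X u s.
Proof.
  move=> wf; have DR := Dec_rle; move: u s.
  wf_induct wf => [|u IH s d]; first by def.
  by apply: rle_intro => v d'; exists u; split=> //; apply: IH.
Qed.

(** In terms of ordinals: if the rank of [t] exceeds that of [s], some child of [t] has at least the
    rank of [s]. Take a child [v] of [t] that is below no child of [s]; by induction every child of
    [s] is below some child of [v]. *)
Lemma rlt_child X Y s t : WF X -> ~ rl Y X t s -> exists v, Di Y t v /\ rl X Y s v.
Proof.
  move=> wf; have DR := Dec_rle; move: s t.
  wf_induct wf => [|s IH t ts]; first by def.
  have [v [d h]] : exists v, Di Y t v /\ forall u, Di X s u -> ~ rl Y X v u.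
    apply: NNPP => ne; apply: ts; apply: rle_intro => v d; apply: NNPP => ne'.
    by apply: ne; exists v; split=> // u d' r; apply: ne'; exists u.
  exists v; split=> //; apply: rle_intro => u d'.
  exact: IH d' _ (h u d').
Qed.

Lemma rle_total X Y s t : WF X -> WF Y -> rl X Y s t \/ rl Y X t s.
Proof.
  move=> wX wY; case: (classic (rl Y X t s)) => [|/(rlt_child wX) [v [d sv]]]; auto.
  by left; apply: rle_trans sv (child_rle wY d).
Qed.

(** Induction on a node [s] that bounds some element of [P]: if this element is not minimal, another
    one is bounded by a child of [s]. *)
Lemma rank_min Z (P : N -> Prop) : WF Z -> Dec (fun p : tup [tO] => P (fst p)) ->
  (exists a, P a) -> exists a, P a /\ forall b, P b -> rl Z Z a b.
Proof.
  move=> wf DP [a Pa]; have DR := Dec_rle.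
  suff h : forall s, (exists a, P a /\ rl Z Z a s) ->
      exists a, P a /\ forall b, P b -> rl Z Z a b.
    by apply: (h a); exists a; split=> //; apply: rle_refl.
  wf_induct wf => [|s IH [c [Pc cs]]]; first by def.
  apply: NNPP => ne.
  have [b [Pb bc]] : exists b, P b /\ ~ rl Z Z c b.
    apply: NNPP => ne'; apply: ne; exists c; split=> // b Pb.
    by apply: NNPP => n; apply: ne'; exists b.
  have [v [d bv]] := rlt_child wf bc; have [u [d' vu]] := rle_elim cs d.
  by apply: ne; apply: IH d' _; exists b; split=> //; apply: rle_trans bv vu.
Qed.

Definition req X Y s t := rl X Y s t /\ rl Y X t s.

Lemma req_refl X s : req X X s s.
Proof. by split; apply: rle_refl. Qed.

Lemma req_sym X Y s t : req X Y s t -> req Y X t s.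
Proof. by case. Qed.

Lemma req_trans Y X Z s t u : req X Y s t -> req Y Z t u -> req X Z s u.
Proof.
  by move=> [st ts] [tu ut]; split; [apply: rle_trans st tu|apply: rle_trans ut ts].
Qed.

(** The ranks in the tree of [Z] form an initial segment of the ordinals; hence its nodes can name
    all ranks up to that of the root. *)
Lemma req_exists X Z s t : WF X -> WF Z -> rl X Z s t -> exists b, req X Z s b.
Proof.
  move=> wX wZ; have DR := Dec_rle; move: t.
  wf_induct wZ => [|t IH st]; first by rewrite /req; def.
  case: (classic (rl Z X t s)) => [ts|/(rlt_child wX) [v [d sv]]]; first by exists t.
  exact: IH d sv.
Qed.

(** Induction on the size of the node: its parent, if any, is a smaller number and so bounded by the
    root, whence the node is bounded by a child of the root. A node that is neither the root nor a
    child has no children. *)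
Lemma rle_root X s : WF X -> rl X X s 0.
Proof.
  move=> wf; have DR := Dec_rle.
  suff h : forall k s, s < k -> rl X X s 0 by apply: (h (s + 1)); apply: ltS.
  apply: ind => [|t /lt0 //|k IH t /ltS_leE tk]; first by def.
  apply: rle_intro => u d; case: (D_parent d) => [e|[r d']].
    by exists u; split; [rewrite -e|apply: rle_refl].
  have rk : r < k by apply: lt_le_trans (D_lt d') tk.
  have [v [dv tv]] := rle_elim (IH r rk) d'.
  exists v; split=> //; apply: rle_trans tv; exact: child_rle.
Qed.

(** The starting points of paths form a decidable set, whose least element is the root: any other
    has a parent, which is smaller and could be prepended. *)
Lemma path_root X : (exists g, path X g) -> exists g, g @ 0 = 0 /\ path X g.
Proof.
  move=> [g0 p0]; pose P s := exists g, forall k, g @ 0 = s /\ Di X (g @ k) (g @ (k + 1)).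
  have DP : Dec (fun p : tup [tO] => P (fst p)).
    apply: Dec_suslin => [|p n]; first by def.
    have L k : LC (fun g => g @ k) by lc.
    apply: LC_app2; last by apply: (LC_app2 (Di X)); apply: L.
    by apply: (LC_app1 (fun x => x = fst p)); apply: L.
  have [|s [[g gs] smin]] := lnp DP.
    by exists (g0 @ 0), g0 => k; split=> //; apply: p0.
  have pg : path X g by move=> k; case: (gs k).
  have [g0s _] := gs 0; have d := pg 0; rewrite g0s in d.
  case: (D_parent d) => [e|[r d']]; first by exists g; split=> //; rewrite g0s.
  case: (smin r (D_lt d')); exists (shift r g) => k; rewrite shift0 shiftS; split=> //.
  case: (zero_or_pred k) => ->; first by rewrite shift0 g0s.
  by rewrite shiftS; apply: pg.
Qed.

(** A path of [X] is carried along the simulation, one reply at a time, to a path of [Z]. So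
    well-foundedness of [X] follows from a [Σ¹₁] condition. *)
Lemma WF_rle X Z t : WF Z -> rl X Z 0 t -> WF X.
Proof.
  move=> wf r0 /path_root [g [g0 pg]]; have DR := Dec_rle.
  pose P v k w := Di Z v w /\ rl X Z (g @ (k + 1)) w.
  pose F := lamM (fun k => lamM (fun v => some (P v k))).
  have FE k v : F @ k @ v = some (P v k) by rewrite /F !lamE //; rewrite /P; def.
  have ex k v : rl X Z (g @ k) v -> P v k (F @ k @ v).
    by move=> r; rewrite FE; apply: (someP (P := P v k)) (rle_elim r (pg k)); rewrite /P; def.
  have r k : rl X Z (g @ k) (rec F t k).
    move: k; apply: ind => [||k IH]; first by def.
      by rewrite rec0 g0.
    by rewrite recS; apply: (proj2 (ex k _ IH)).
  apply: wf; exists (lamM (fun k => rec F t k)) => k; rewrite !lamE; try by def.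
  by rewrite recS; apply: (proj1 (ex k _ (r k))).
Qed.

End Fixed.


(** * The lexicographically least witness *)

Definition bin X := forall n, X @ n = 0 \/ X @ n = 1.

Lemma Dec_bin G (X : tup G -> M t1) : Def X -> Dec (fun p => bin (X p)).
Proof. by move=> DX; rewrite /bin; def. Qed.

Lemma Dec_req G (I : tup G -> N) (X Y : tup G -> M t1) S T :
  Def I -> Def X -> Def Y -> Def S -> Def T ->
  Dec (fun p => req (I p) (X p) (Y p) (S p) (T p)).
Proof. by move=> *; apply: Dec_and; apply: Dec_rle. Qed.

(** [h] codes a sequence of pairs consisting of a node of the tree of [Z], standing for
    its rank, and a bit. *)
Definition fits i Z h k X := bin X /\
  forall j, j < k -> req i X Z j (ini (h @ j)) /\ X @ j = las (h @ j).

(** Names are nodes of the tree of [Z]; a candidate whose rank at [k] exceeds them all is left out,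
    which is harmless when a least one is sought. *)
Definition reach i Z h k b y := exists X, fits i Z h k X /\ req i X Z k b /\ X @ k = y.

Definition best i Z h k b y := reach i Z h k b y /\
  forall c z, reach i Z h k c z -> rle i Z Z b c /\ (rle i Z Z c b -> y <= z).

(** The sequence of [Z] itself: node [j] names its own rank. *)
Definition own Z : M t1 := lamM (fun j => sq_snoc j (Z @ j)).

(** Following Kondo, [Z] is lexicographically least with respect to the sequence
    (rank of 0, Z(0), rank of 1, Z(1), ...). *)
Definition kondo i Z := bin Z /\ WF i Z /\ forall k, best i Z (own Z) k k (Z @ k).

(** The candidate [X] and simulations in both directions between its tree and that of [Z] are stored
    in the columns of one function. The clauses on them are continuous, so [Dec_suslin] applies. *)
Lemma Dec_reach G (I : tup G -> N) (Z H : tup G -> M t1) K B E :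
  Def I -> Def Z -> Def H -> Def K -> Def B -> Def E ->
  Dec (fun p => reach (I p) (Z p) (H p) (K p) (B p) (E p)).
Proof.
  move=> DI DZ DH DK DB DE.
  pose Q i Z h k b y X R W R' W' n := (X @ n = 0 \/ X @ n = 1) /\
    (n < k -> (R @ sq_snoc n (ini (h @ n)) = 0 /\ R' @ sq_snoc (ini (h @ n)) n = 0) /\
              X @ n = las (h @ n)) /\
    (simc i X Z R W n /\ simc i Z X R' W' n) /\
    (R @ sq_snoc k b = 0 /\ R' @ sq_snoc b k = 0) /\ X @ k = y.
  pose Q' i Z h k b y g n := Q i Z h k b y (col g 0) (col (col (col g 1) 0) 0)
    (col (col (col g 1) 0) 1) (col (col (col g 1) 1) 0) (col (col (col g 1) 1) 1) n.
  apply: (Dec_ext (P := fun p => exists g, forall n,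
    Q' (I p) (Z p) (H p) (K p) (B p) (E p) g n)) => [p|]; last first.
    apply: Dec_suslin => [|p n].
      have := @Def_col M => DC; have := Dec_simc => DS; rewrite /Q' /Q; def.
    by have := @LC_simc => C; rewrite /Q' /Q; lc.
  split=> [[g gh]|[X [[bX fX] [[r1 r2] e]]]].
  - exists (col g 0); rewrite /Q' /Q in gh.
    have S1 : forall n, simc (I p) (col g 0) (Z p) (col (col (col g 1) 0) 0)
        (col (col (col g 1) 0) 1) n by move=> n; have := gh n; tauto.
    have S2 : forall n, simc (I p) (Z p) (col g 0) (col (col (col g 1) 1) 0)
        (col (col (col g 1) 1) 1) n by move=> n; have := gh n; tauto.
    split; first split.
    + by move=> n; have := gh n; tauto.
    + move=> j jk; have [_ [/(_ jk) [[e1 e2] e3] _]] := gh j.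
      by split=> //; split; [apply: sim_rle S1 e1|apply: sim_rle S2 e2].
    + have [_ [_ [_ [[e1 e2] e3]]]] := gh 0.
      by split=> //; split; [apply: sim_rle S1 e1|apply: sim_rle S2 e2].
  - have [R [W [S1 h1]]] := rle_sim (I p) X (Z p).
    have [R' [W' [S2 h2]]] := rle_sim (I p) (Z p) X.
    have [a [a1 a2]] := join_cols R W; have [b [b1 b2]] := join_cols R' W'.
    have [c [c1 c2]] := join_cols a b; have [g [g1 g2]] := join_cols X c.
    exists g => n; rewrite /Q' g1 g2 c1 c2 a1 a2 b1 b2; split; first exact: bX.
    split; last by split; [split|split; [split; [apply: h1|apply: h2]|]].
    by move=> nk; have [[r3 r4] ->] := fX n nk; split=> //; split; [apply: h1|apply: h2].
Qed.

Lemma Dec_best G (I : tup G -> N) (Z H : tup G -> M t1) K B E :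
  Def I -> Def Z -> Def H -> Def K -> Def B -> Def E ->
  Dec (fun p => best (I p) (Z p) (H p) (K p) (B p) (E p)).
Proof.
  move=> *; have DR := Dec_reach; have DR' := Dec_rle; rewrite /best; def.
Qed.

Lemma Def_own G (Z : tup G -> M t1) : Def Z -> Def (fun p => own (Z p)).
Proof. by move=> DZ; rewrite /own; def. Qed.

Lemma ownE Z j : own Z @ j = sq_snoc j (Z @ j).
Proof. by rewrite /own lamE //; def. Qed.

Lemma Dec_WF G (I : tup G -> N) (X : tup G -> M t1) :
  Def I -> Def X -> Dec (fun p => WF (I p) (X p)).
Proof.
  move=> DI DX; apply: Dec_not; apply: Dec_suslin => [|p n]; first by def.
  have L k : LC (fun g => g @ k) by lc.
  by apply: (LC_app2 (D _ _)); apply: L.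
Qed.

Lemma Dec_kondo G (I : tup G -> N) (X : tup G -> M t1) :
  Def I -> Def X -> Dec (fun p => kondo (I p) (X p)).
Proof.
  move=> DI DX; have := Dec_bin => D1; have := Dec_WF => D2; have := Dec_best => D3.
  by have := Def_own => D4; rewrite /kondo; def.
Qed.

Section Kondo.

Variable i : N.
Notation rl := (rle i).
Notation rq := (req i).

Lemma fits_own Z k X : fits i Z (own Z) k X <->
  bin X /\ forall j, j < k -> rq X Z j j /\ X @ j = Z @ j.
Proof.
  by split=> -[b h]; split=> // j jk; have := h j jk; rewrite ownE ini_snoc las_snoc.
Qed.

(** If the rank of [k] for [X] is at most that for [Z], it has a name in [Z] and [best] compares;
    otherwise [rle_total] settles the matter. *)
Lemma kondo_least Z X k : kondo i Z -> bin X -> WF i X ->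
  (forall j, j < k -> rq X Z j j /\ X @ j = Z @ j) ->
  rl Z X k k /\ (rl X Z k k -> Z @ k <= X @ k).
Proof.
  move=> [bZ [wZ h]] bX wX XZ.
  have key : rl X Z k k -> rl Z X k k /\ Z @ k <= X @ k.
    move=> XZk; have [b [Xb bX']] := req_exists wX wZ XZk.
    have [|r1 r2] := proj2 (h k) b (X @ k).
      by exists X; split; [apply/fits_own|].
    by split; [apply: rle_trans r1 bX'|apply: r2; apply: rle_trans bX' XZk].
  split; last by move=> /key [].
  by case: (rle_total k k wX wZ) => // /key [].
Qed.

(** At the first [k] where ranks or values differ, each of the two is minimal against the other. *)
Lemma kondo_unique X Y : kondo i X -> kondo i Y -> X = Y.
Proof.
  move=> KX KY; apply: app_ext; apply: NNPP => ne.
  have DR := Dec_req.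
  have [||k [nk h]] := @lnp M (fun k => ~ (rq X Y k k /\ X @ k = Y @ k)).
  - by def.
  - by apply: NNPP => ne'; apply: ne => n; apply: NNPP => e; apply: ne'; exists n; case.
  - apply: nk; have {}h j : j < k -> rq X Y j j /\ X @ j = Y @ j by move=> /h /NNPP.
    case: (KX) => bX [wX _]; case: (KY) => bY [wY _].
    have [YX yx] := kondo_least KY bX wX h.
    have [|XY xy] := kondo_least KX bY wY (k := k).
      by move=> j /h [r e]; split; [apply: req_sym|].
    by split=> //; apply: le_antisym; [apply: xy|apply: yx].
Qed.

Lemma reach_wd Z h h' k b y : agree h h' k -> reach i Z h k b y -> reach i Z h' k b y.
Proof.
  move=> hh [X [[bX f] r]]; exists X; split=> //; split=> // j jk.
  by rewrite -hh //; apply: f.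
Qed.

Lemma best_wd Z h h' k b y : agree h h' k -> best i Z h k b y -> best i Z h' k b y.
Proof.
  move=> hh [r l]; split; first exact: reach_wd hh r.
  by move=> c z /(reach_wd (agree_sym hh)); apply: l.
Qed.

Lemma reach_req Z h k b c y : rq Z Z b c -> reach i Z h k b y -> reach i Z h k c y.
Proof.
  by move=> bc [X [f [r e]]]; exists X; split=> //; split=> //; apply: req_trans r bc.
Qed.

Lemma best_exists Z h k : WF i Z -> (exists b y, reach i Z h k b y) ->
  exists b y, best i Z h k b y.
Proof.
  move=> wZ ex; have DR := Dec_reach.
  have [|b [eb bmin]] := rank_min (P := fun b => exists y, reach i Z h k b y) wZ _ ex.
    by def.
  have [||y [ry ymin]] := @lnp M (fun y => reach i Z h k b y) => //; first by def.
  exists b, y; split=> // c z rc; have bc := bmin c (ex_intro _ z rc); split=> // cb.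
  by apply/leNlt => zy; apply: ymin zy _; apply: reach_req rc.
Qed.

(** The recursor produces numbers only, so the history of [h] is carried as a code; decoded by
    [hat], it is correct below [k] and unspecified beyond. *)
Lemma course_of_values (F : M t1 -> N -> N) : Def (fun p : tup [t1; tO] => F (fst p) (fst (snd p))) ->
  exists h, forall k, h @ k = F (hat (bar h k)) k.
Proof.
  move=> DF; pose H := lamM (fun k => lamM (fun c => sq_snoc c (F (hat c) k))).
  have HE k c : H @ k @ c = sq_snoc c (F (hat c) k) by rewrite /H !lamE //; def.
  exists (lamM (fun k => F (hat (rec H 0 k)) k)); set h := lamM _ => k.
  have hE n : h @ n = F (hat (rec H 0 n)) n by rewrite /h lamE //; def.
  suff -> : bar h k = rec H 0 k by [].
  move: k; apply: ind => [||k IH]; [by def|by rewrite bar0 rec0|].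
  by rewrite barS recS HE IH hE.
Qed.

(** Minimal names and values are picked one after the other relative to the given [Z]. The delicate
    point is that the limit [X] realizes the chosen ranks: each stage has its own candidate, known
    to agree with [X] on an initial segment only. *)
Lemma kondo_exists Z : bin Z -> WF i Z -> exists X, kondo i X.
Proof.
  move=> bZ wZ; have DB := Dec_best; have DR := Dec_reach.
  have [|h hh] := @course_of_values (fun h k => some (fun v => best i Z h k (ini v) (las v))).
    by def.
  have hbest k : (exists b y, reach i Z h k b y) ->
      best i Z h k (ini (h @ k)) (las (h @ k)).
    move=> ex; rewrite hh; apply: best_wd (@agree_hat _ h k) _.
    apply: (someP (P := fun v => best i Z (hat (bar h k)) k (ini v) (las v))).
      by def.
    have [b [y bst]] := best_exists wZ ex; exists (sq_snoc b y).
    by rewrite ini_snoc las_snoc; apply: best_wd bst; apply/agree_sym/agree_hat.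
  (* The rank of the root is named by a node of [Z]; this alone makes the candidate well founded. *)
  have fits_next k X : fits i Z h (k + 1) X -> WF i X.
    move=> [_ /(_ 0)]; case; first by apply: le_lt_trans (le0 k) (ltS k).
    by case=> r _ _; apply: WF_rle r.
  (* At stage 0, [Z] itself is a candidate. The candidate of stage [k] remains one at stage [k + 1]:
     its rank there is bounded by that of its root, hence has a name in [Z]. *)
  have ex k : exists b y, reach i Z h k b y.
    move: k; apply: ind => [||k /hbest [[X [[bX f] [r e]]] _]]; first by def.
      exists 0, (Z @ 0), Z; split; last by split=> //; apply: req_refl.
      by split=> // j /lt0.
    have fX : fits i Z h (k + 1) X.
      by split=> // j /ltS_le [/f|->].
    have wX := fits_next k X fX.
    have [_ /(_ 0)] := fX; case; first by apply: le_lt_trans (le0 k) (ltS k).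
    move=> [r0 _] _; have [b rb] := req_exists wX wZ
      (rle_trans (rle_root (k + 1) wX) r0).
    by exists b, (X @ (k + 1)), X.
  have {}ex k := hbest k (ex k).
  set X := lamM (fun k => las (h @ k)).
  have XE k : X @ k = las (h @ k) by rewrite /X lamE //; def.
  have near k : exists X', fits i Z h (k + 1) X' /\ bin X' /\ agree X' X k.
    have [[X' [[bX f] [r e]]] _] := ex k; exists X'; split.
      by split=> // j /ltS_le [/f|->].
    by split=> // j /f [_ ->].
  have bX : bin X.
    move=> k; have [X' [[_ f] [b _]]] := near k.
    by have [_] := f k (ltS k); rewrite XE => <-; apply: b.
  (* The names decrease along the tree of [X], which gives a simulation in [Z]: whether [u] is a
     child of [s] depends on [X] below [u] only, so it can be tested on a candidate that agrees with
     [X] there and realizes the names at [s] and [u]. *)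
  have up s : rl X Z s (ini (h @ s)).
    have DL := Dec_rle.
    apply: (rle_coind (R := fun s t => rl Z Z (ini (h @ s)) t)) => [||{}s t u st d];
      [by def|exact: rle_refl|].
    have [X' [[_ f] [b a]]] := near u.
    have d' := D_local (agree_sym a) d.
    have [[s1 s2] _] := f s (lt_trans (D_lt d) (ltS u)).
    have [[_ u2] _] := f u (ltS u).
    have [v [dv uv]] := rle_elim (rle_trans s1 st) d'.
    by exists v; split=> //; apply: rle_trans u2 uv.
  have wX : WF i X by apply: WF_rle (up 0).
  (* Conversely, once the earlier ranks are exact, [X] is itself a candidate at stage [m], so the
     minimal name is bounded by the true rank. *)
  have eqX k : rq X Z k (ini (h @ k)).
    suff le m : forall j, j < m -> rl Z X (ini (h @ j)) j.
      by split=> //; apply: (le (k + 1)); apply: ltS.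
    have DL := Dec_rle.
    move: m; apply: ind => [|j /lt0 //|m IH j /ltS_le [/IH //|->]]; first by def.
    have [b [Xb bX']] := req_exists wX wZ (up m).
    have [|r _] := proj2 (ex m) b (X @ m); last exact: rle_trans r bX'.
    exists X; split=> //; split=> // j' jm; rewrite XE; split=> //.
    by split; [apply: up|apply: IH].
  exists X; split=> //; split=> // k; split.
    exists X; split; last by split=> //; apply: req_refl.
    by apply/fits_own; split=> // j _; split=> //; apply: req_refl.
  (* Competitors named in the tree of [X] are renamed in that of [Z], where [h] is minimal. *)
  move=> b y [X' [/fits_own [bX' f] [r e]]].
  have rb := eqX b.
  have [|le1 le2] := proj2 (ex k) (ini (h @ b)) y.
    exists X'; split; last by split=> //; apply: req_trans r rb.
    split=> // j /f [rj ->]; rewrite XE; split=> //; exact: req_trans rj (eqX j).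
  split.
  - by apply: rle_trans (rle_trans (proj1 (eqX k)) le1) (proj2 rb).
  - move=> bk; rewrite XE; apply: le2.
    by apply: rle_trans (rle_trans (proj2 rb) bk) (proj1 (eqX k)).
Qed.

End Kondo.

End Ranks.

(** * The tree of a statement [∃ Y ∀ n, Q] *)

Section Trees.

Context {M : structure}.
Notation N := (M tO).
Notation tup := (@tup M).
Implicit Types x y z n m k i j a b s t u v : N.
Implicit Types f g h X Y Z : M t1.

Variable Q : N -> N -> M t1 -> M t1 -> Prop.

Hypothesis Dec_Q : forall G (I J : tup G -> N) (X Y : tup G -> M t1),
  Def I -> Def J -> Def X -> Def Y -> Dec (fun p => Q (I p) (J p) (X p) (Y p)).
Hypothesis Q_local : forall i n X Y, exists m, forall X' Y',
  agree X X' m -> agree Y Y' m -> Q i n X Y <-> Q i n X' Y'.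

(** Nodes that are not refuted by the information coded in [t]; only the values of [X]
    below [t] are consulted. *)
Definition intree i X t := bar (hat t) (len t) = t /\ forall n, n < len t ->
  exists u v, agree (hat u) X t /\ agree (hat v) (hat t) (len t) /\ Q i n (hat u) (hat v).

Definition child i X s t := (exists y, t = sq_snoc s y) /\ intree i X t.

Lemma Dec_child G (I : tup G -> N) (X : tup G -> M t1) S T :
  Def I -> Def X -> Def S -> Def T -> Dec (fun p => child (I p) (X p) (S p) (T p)).
Proof. by move=> *; rewrite /child /intree; def. Qed.

Lemma child_local i X Y s t : agree X Y t -> child i X s t -> child i Y s t.
Proof.
  move=> XY [e [c h]]; split=> //; split=> // n /h [u [v [a r]]].
  by exists u, v; split=> //; apply: agree_trans a XY.
Qed.

Lemma child_lt i X s t : child i X s t -> s < t.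
Proof. by move=> [[y ->] _]; apply: snoc_gt. Qed.

(** Initial segments of a node of the tree are nodes, as the demands on a shorter sequence are fewer
    and weaker. The condition [bar (hat t) (len t) = t] makes [t] a genuine code, so that it has
    initial segments. *)
Lemma child_parent i X s t : child i X s t -> s = 0 \/ exists r, child i X r s.
Proof.
  move=> [[y e] [c h]]; case: (zero_or_pred (len t)) => l.
    by move: c; rewrite l bar0 e => c; have := snoc_gt s y; rewrite -c => /lt0.
  move: c; set g := hat t in h *; set k := pred (len t) in l.
  rewrite l barS e => /snoc_inj [sk _].
  case: (zero_or_pred k) => k0; first by left; rewrite -sk k0 bar0.
  set j := pred k in k0; right; exists (bar g j); split.
    by exists (g @ j); rewrite -sk k0 barS.
  have lk : len s = k by rewrite -sk len_bar.
  have gs : agree (hat s) g k by rewrite -sk; apply: agree_hat.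
  split; first by rewrite lk -[RHS]sk; apply: bar_agree.
  have st : s <= t by rewrite e; apply/ltW/snoc_gt.
  move=> n; rewrite lk => nk; have [|u [v [a [b q]]]] := h n.
    by rewrite l; apply: lt_trans nk (ltS k).
  exists u, v; split; first exact: agree_le st a.
  split=> //; apply: agree_trans (agree_sym gs); apply: agree_le b.
  by rewrite l; apply: leS.
Qed.

(** Paths from the root are the sequences [bar Y k]. A node only asks for [u], [v] consistent with
    the known parts of [X] and [Y]; as these grow, locality of [Q] turns the demand into
    [Q i n X Y]. *)
Lemma WF_child i X : WF child i X <-> ~ exists Y, forall n, Q i n X Y.
Proof.
  split=> wf.
  - move=> [Y hY]; apply: wf; exists (lamM (fun k => bar Y k)) => k.
    rewrite !lamE; [by def|by def|rewrite barS; split; first by exists (Y @ k)].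
    rewrite -barS; split.
      by rewrite len_bar; apply: bar_agree; apply: agree_hat.
    move=> n _; have [m hm] := Q_local i n X Y.
    set t := bar Y (k + 1); exists (bar X (m + t)), (bar Y (m + (k + 1))).
    have a1 := @agree_hat _ X (m + t); have a2 := @agree_hat _ Y (m + (k + 1)).
    split; first by apply: agree_le a1; apply: le_addl.
    split.
      rewrite /t len_bar; apply: agree_trans (agree_sym (@agree_hat _ _ _)).
      by apply: agree_le a2; apply: le_addl.
    apply/(hm _ _) => //.
    + by apply: agree_le (agree_sym a1); apply: le_addr.
    + by apply: agree_le (agree_sym a2); apply: le_addr.
  - move=> ex; have [g [g0 pg]] := path_root Dec_child child_lt child_parent ex.
    apply: wf; pose Y := lamM (fun k => las (g @ (k + 1))).
    have YE k : Y @ k = las (g @ (k + 1)) by rewrite /Y lamE //; def.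
    have gE k : g @ k = bar Y k.
      move: k; apply: ind => [||k IH]; [by def|by rewrite g0 bar0|].
      rewrite barS -IH YE; have [[y e] _] := pg k.
      by rewrite e las_snoc.
    exists Y => n; have [m hm] := Q_local i n X Y.
    (* The level [m + n] is high enough both to test clause [n] and to fix the first [m] values. *)
    have [_ [_ h]] := pg (m + n); rewrite gE !len_bar in h.
    have [|u [v [a [b q]]]] := h n.
      by apply: le_lt_trans (ltS _); apply: le_addl.
    apply/(hm (hat u) (hat v)) => //.
    + apply: agree_le (agree_sym a); apply: le_trans (bar_ge _ _).
      by rewrite -addA; apply: le_addr.
    + apply: (agree_trans (g := hat (bar Y (m + n + 1)))).
        apply: agree_le (agree_sym (@agree_hat _ _ _)).
        by rewrite -addA; apply: le_addr.
      apply: agree_le (agree_sym b).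
      by rewrite -addA; apply: le_addr.
Qed.

End Trees.

(** * Suprema of countable sets *)

Section Suprema.

Context {M : structure}.
Notation N := (M tO).
Notation tup := (@tup M).
Implicit Types x y z n m k i j a b s t u v : N.
Implicit Types f g h X Y Z : M t1.

Definition lex g h := g = h \/ exists n, (forall m, m < n -> g @ m = h @ m) /\ g @ n < h @ n.

Lemma sat_Bin W (r : env W M) (x : tm W tO) : sat r (Bin x) <-> ev r x = 0 \/ ev r x = 1.
Proof. exact: sat_Or. Qed.

Lemma sat_Cantor W (r : env W M) (f : tm W t1) : sat r (Cantor f) <-> bin (ev r f).
Proof.
  by rewrite /Cantor sat_All; split=> h x; have := h x; rewrite sat_Bin /= /wk ev_ren.
Qed.

Lemma sat_AllC W (r : env W M) (a : fm (ext W t1)) :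
  sat r (AllC a) <-> forall f, bin f -> sat (econs f r) a.
Proof.
  rewrite /AllC sat_All; split=> h f.
  - by move=> bf; apply: sat_Imp (h f) _; apply/sat_Cantor.
  - by move=> /sat_Cantor; apply: h.
Qed.

Lemma sat_lex W (r : env W M) (g h : tm W t1) : sat r (lex_le g h) <-> lex (ev r g) (ev r h).
Proof.
  rewrite /lex_le sat_Or sat_EqT sat_Ex /lex.
  suff e n : sat (econs n r) (And (All tO (Imp (Lt v0 v1)
     (Eq (App (wk (wk g)) v0) (App (wk (wk h)) v0))))
     (Lt (App (wk g) v0) (App (wk h) v0))) <->
     (forall m, m < n -> ev r g @ m = ev r h @ m) /\ ev r g @ n < ev r h @ n.
    by split=> -[|[n /e ?]]; auto; right; exists n => //; apply/e.
  by rewrite sat_And /= /wk !ev_ren; split=> -[a b]; split=> // m /(a m);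
    rewrite !ev_ren.
Qed.

Lemma sat_upper W (r : env W M) A F (h : tm W t1) : sat r (upper_bound A F h) <->
  forall f, bin f -> ev r A @ f = 1 -> lex (ev r F @ f) (ev r h).
Proof.
  rewrite /upper_bound sat_AllC.
  suff e f : sat (econs f r) (Imp (elt v0 (wk A)) (lex_le (App (wk F) v0) (wk h))) <->
      (ev r A @ f = 1 -> lex (ev r F @ f) (ev r h)).
    by split=> H f bf; apply/e; apply: H.
  have l := sat_lex (econs f r) (App (wk F) v0) (wk h).
  rewrite /= /wk !ev_ren in l; rewrite -l /= /wk ev_ren; exact: iff_refl.
Qed.

Lemma bw (A : M t2) (F : M (t1 ⇒ t1)) :
  (forall f, bin f -> A @ f = 0 \/ A @ f = 1) ->
  (exists Y : M t2, forall f g, bin f -> bin g -> A @ f = 1 -> A @ g = 1 ->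
     Y @ f = Y @ g -> f = g) ->
  (forall f, bin f -> bin (F @ f)) ->
  exists h, bin h /\ (forall f, bin f -> A @ f = 1 -> lex (F @ f) h) /\
    forall u : M t1, bin u -> (forall f, bin f -> A @ f = 1 -> lex (F @ f) u) -> lex h u.
Proof.
  move=> hA [Y hY] hF.
  have : sat (params (M := M)) (BW0C M) by apply: carrierP; right.
  move=> H.
  have H1 : sat (econs A (params (M := M))) (And (is_subset v0) (countable v0)).
    apply/sat_And; split.
      by apply/sat_AllC => f bf; apply/sat_Bin; apply: hA.
    apply/sat_Ex; exists Y; apply/sat_AllC => f bf; apply/sat_AllC => g bg.
    have e := sat_EqT (econs g (econs f (econs Y (econs A (params (M := M)))))) v1 v0.
    by move=> Af Ag Yfg; apply: (proj2 e); apply: hY.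
  have H2 : sat (econs F (econs A (params (M := M)))) (AllC (Cantor (App v1 v0))).
    by apply/sat_AllC => f bf; apply/sat_Cantor; apply: hF.
  have : sat (econs F (econs A (params (M := M)))) (ExC (is_sup v2 v1 v0)) := H A H1 F H2.
  case/sat_Ex => h.
  rewrite sat_And sat_Cantor /is_sup sat_And sat_upper sat_AllC => -[bh [up least]].
  exists h; split=> //; split=> [f bf Af|u bu hu]; first exact: up.
  have := sat_Imp (least u bu) _; rewrite sat_lex; apply.
  by apply/sat_upper => f bf Af; apply: hu.
Qed.
End Suprema.

Ltac def_ext ::=
  lazymatch goal with
  | |- Def (fun p => ini _) => apply: Def_ini
  | |- Def (fun p => las _) => apply: Def_las
  | |- Def (fun p => len _) => apply: Def_len
  | |- Def (fun p => entry _ _) => apply: Def_entry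
  | |- Def (fun p => hat _) => apply: Def_hat
  | |- Def (fun p => col _ _) => apply: Def_col
  | |- Dec (fun p => agree _ _ _) => apply: Dec_agree
  end.

(** * The domain of a relation with unique witnesses as a supremum *)

Section Domain.

Context {M : structure}.
Notation N := (M tO).
Notation tup := (@tup M).
Implicit Types x y z n m k i j a b s t u v c d : N.
Implicit Types f g h X Y Z W : M t1.

Variable K : N -> M t1 -> Prop.

Hypothesis Dec_K : forall G (I : tup G -> N) (X : tup G -> M t1),
  Def I -> Def X -> Dec (fun p => K (I p) (X p)).
Hypothesis K_bin : forall i X, K i X -> bin X.
Hypothesis K_unique : forall i X Y, K i X -> K i Y -> X = Y.

(** Column [0] of [f] is (the characteristic function of) a finite set of indices, and
    column [j + 1] is the element of [K j] if [j] is in this set. *)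
Definition witness f := (exists c, forall j, c <= j -> col f 0 @ j = 0) /\
  (forall j, (col f 0 @ j = 1 -> K j (col f (j + 1))) /\
             (col f 0 @ j = 0 -> forall m, col f (j + 1) @ m = 0)) /\
  (forall k, (forall a x, k <> sq_snoc a x) -> f @ k = 0).

Lemma Dec_witness G (F : tup G -> M t1) : Def F -> Dec (fun p => witness (F p)).
Proof. by move=> DF; rewrite /witness; def. Qed.

Lemma bin_col f j : bin f -> bin (col f j).
Proof. by move=> bf n; rewrite colE; apply: bf. Qed.

Definition bound f := some (fun c => forall j, c <= j -> col f 0 @ j = 0).

Lemma boundP f j : witness f -> bound f <= j -> col f 0 @ j = 0.
Proof.
  move=> [ex _]; move: j.
  by apply: (someP (P := fun c => forall j, c <= j -> col f 0 @ j = 0) _ ex); def.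
Qed.

(** The injection sends [f] to a code of its finite set. The set determines the columns of its
    members by [K_unique]; the other columns are zero, and so are the positions outside all
    columns. *)
Lemma witness_inj f g : bin f -> bin g -> witness f -> witness g ->
  bar (col f 0) (bound f) = bar (col g 0) (bound g) -> f = g.
Proof.
  move=> bf bg wf wg e.
  have eb : bound f = bound g by rewrite -(len_bar (col f 0) (bound f)) e len_bar.
  have eW j : col f 0 @ j = col g 0 @ j.
    case: (le_lt_dec (bound f) j) => bj.
      by rewrite !boundP // -eb.
    by rewrite -(hat_bar (col f 0) bj) e hat_bar // -eb.
  case: wf => _ [f1 f0]; case: wg => _ [g1 g0].
  have eZ j : col f (j + 1) = col g (j + 1).
    have [f2 f3] := f1 j; have [g2 g3] := g1 j; rewrite -eW in g2 g3.
    case: (bin_col (0 : N) bf j) => w; last by apply: K_unique (f2 w) (g2 w).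
    by apply: app_ext => m; rewrite f3 // g3.
  apply: app_ext => k.
  case: (classic (exists a x, k = sq_snoc a x)) => [[a [x ->]]|ne].
    rewrite -!colE; case: (zero_or_pred a) => ->; first exact: eW.
    by rewrite eZ.
  by rewrite f0 ?g0 // => a x ek; apply: ne; exists a, x.
Qed.

Lemma pack W (Z : M (tO ⇒ t1)) : exists f, col f 0 = W /\
  (forall j, col f (j + 1) = Z @ j) /\
  forall k, (forall a x, k <> sq_snoc a x) -> f @ k = 0.
Proof.
  pose F k := cond (exists a x, k = sq_snoc a x)
    (cond (ini k = 0) (W @ las k) (Z @ pred (ini k) @ las k)) 0.
  have FE k : lamM F @ k = F k by rewrite lamE //; rewrite /F; def.
  exists (lamM F); split; [|split] => [|j|k ne].
  - apply: app_ext => m; rewrite colE FE /F condT; first by exists 0, m.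
    by rewrite ini_snoc las_snoc condT.
  - apply: app_ext => m; rewrite colE FE /F condT; first by exists (j + 1), m.
    by rewrite ini_snoc las_snoc condF ?predS //; apply: succ_ne0.
  - by rewrite FE /F condF // => -[a [x e]]; apply: (ne a x).
Qed.

Lemma witness_bin f : bin (col f 0) -> witness f -> bin f.
Proof.
  move=> b0 [_ [h1 h0]] k.
  case: (classic (exists a x, k = sq_snoc a x)) => [[a [x ->]]|ne]; last first.
    by left; apply: h0 => a x e; apply: ne; exists a, x.
  rewrite -colE; case: (zero_or_pred a) => ->; first exact: b0.
  have [w1 w0] := h1 (pred a).
  case: (b0 (pred a)) => [/w0 ->|/w1/K_bin]; [by left|exact].
Qed.

Lemma lex_first f g : (forall n, (forall m, m < n -> f @ m = g @ m) ->
  f @ n <> g @ n -> f @ n < g @ n) -> lex f g.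
Proof.
  move=> h; case: (classic (f = g)) => [|ne]; first by left.
  right; have [||n [nn nm]] := @lnp M (fun n => f @ n <> g @ n).
  - by def.
  - by apply: NNPP => ne'; apply: ne; apply: app_ext => n; apply: NNPP => nn; apply: ne'; exists n.
  - have e m : m < n -> f @ m = g @ m by move=> /nm /NNPP.
    by exists n; split=> //; apply: h.
Qed.

Lemma bin_lt f g n : bin f -> bin g -> f @ n < g @ n -> f @ n = 0 /\ g @ n = 1.
Proof.
  move=> bf bg; case: (bg n) => -> l; first by case: (lt0 l).
  by rewrite (lt1 l).
Qed.

(** With [F] reading off column 0, the supremum [h] agrees on each initial segment with some finite
    set of indices ([approx]). So [h n = 1] puts [n] into such a set, which comes with a witness;
    conversely, a new index can be added to an approximation. *)
Theorem bw_domain : exists h, bin h /\ forall n, h @ n = 1 <-> exists X, K n X.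
Proof.
  have DW := Dec_witness.
  pose A : M t2 := lamM (fun f => cond (witness f) 1 0).
  have AE f : A @ f = 1 <-> witness f.
    rewrite /A lamE; first by def.
    case: (classic (witness f)) => w; first by rewrite condT.
    by rewrite condF //; split=> // /not01.
  have A01 f : bin f -> A @ f = 0 \/ A @ f = 1.
    move=> _; rewrite /A lamE; first by def.
    by case: (classic (witness f)) => w; [right; rewrite condT|left; rewrite condF].
  have ctb : exists Y : M t2, forall f g, bin f -> bin g -> A @ f = 1 -> A @ g = 1 ->
      Y @ f = Y @ g -> f = g.
    exists (lamM (fun f => bar (col f 0) (bound f))) => f g bf bg /AE wf /AE wg.
    rewrite !lamE; try by rewrite /bound; def.
    exact: witness_inj.
  have F01 f : bin f -> bin (lamM (fun f => col f 0) @ f).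
    by move=> bf; rewrite lamE; [def|apply: bin_col].
  have [h [bh [up least]]] := bw A01 ctb F01.
  have {}up f : bin f -> witness f -> lex (col f 0) h.
    by move=> bf /AE wf; have := up f bf wf; rewrite lamE //; def.
  have {}least (u' : M t1) : bin u' -> ~ lex h u' ->
      exists f, bin f /\ witness f /\ ~ lex (col f 0) u'.
    move=> bu nl; apply: NNPP => ne; apply: nl; apply: least => // f bf /AE wf.
    rewrite lamE; first by def.
    by apply: NNPP => nl; apply: ne; exists f.
  have approx k : exists f, bin f /\ witness f /\ agree (col f 0) h k.
  (* [c] is one more than the last position below [k] where [h] is 1; if there is none, [c] is 0 and
     the empty set will do. *)
  { have [||c [hc cmin]] := @lnp M (fun c => forall j, c <= j -> j < k -> h @ j = 0).
    - by def.
    - by exists k => j /leNlt.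
    - case: (zero_or_pred c) => ec.
        have [f [f0 [f1 f2]]] := pack (lamM (fun _ => 0)) (lamM (fun _ => lamM (fun _ => 0))).
        have f0E j : col f 0 @ j = 0 by rewrite f0 lamE //; def.
        have wf : witness f.
          split; first by exists 0.
          split=> // j; split=> [|_ m]; first by rewrite f0E => /not01.
          by rewrite f1 !lamE //; def.
        have bf : bin f by apply: witness_bin => // j; left.
        exists f; split=> //; split=> // j jk; rewrite f0E hc //.
        by rewrite ec; apply: le0.
      move: ec; set j := pred c => ec.
      have cj m : j < m -> m < k -> h @ m = 0 by move=> /ltSl; rewrite -ec; apply: hc.
      have hj : h @ j = 1.
        case: (bh j) => // e; case: (cmin j); first by rewrite ec; apply: ltS.
        by move=> m [|<- //]; apply: cj.
      (* [u] is the greatest sequence that agrees with [h] before [j] and is 0 at [j]. It is below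
         [h], so some witness [f] is not bounded by it; column 0 of [f] then lies above [u] and not
         above [h], which forces agreement with [h] up to [k]. *)
      pose u := lamM (fun m => cond (m < j) (h @ m) (cond (m = j) 0 1)).
      have uE m : u @ m = cond (m < j) (h @ m) (cond (m = j) 0 1).
        by rewrite /u lamE //; def.
      have u1 m : m < j -> u @ m = h @ m by move=> mj; rewrite uE condT.
      have u2 : u @ j = 0 by rewrite uE condF ?condT //; apply: lt_irr.
      have u3 m : j < m -> u @ m = 1.
        move=> jm; rewrite uE !condF // => [mj|e]; first by apply: lt_irr (lt_trans jm mj).
        by rewrite e in jm; apply: lt_irr jm.
      have bu : bin u.
        by move=> m; case: (lt_total m j) => [/u1 ->|[->|/u3 ->]]; auto.
      have nlu : ~ lex h u.
      { case=> [e|[p [hp lp]]]; first by move: hj; rewrite e u2 => /not01.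
        case: (lt_total p j) => [pj|[e|jp]].
        + by move: lp; rewrite u1 // => /lt_irr.
        + by move: lp; rewrite e u2 => /lt0.
        + by have := hp j jp; rewrite hj u2 => /not10. }
      have [f [bf [wf nl]]] := least u bu nlu.
      exists f; split=> //; split=> //.
      case: (up f bf wf) => [-> //|[p [fp lp]]].
      case: (le_lt_dec k p) => [kp|pk]; first exact: agree_le kp fp.
      case: nl; have bW := bin_col 0 bf; have [Wp hp] := bin_lt bW bh lp.
      case: (lt_total p j) => [pj|[e|jp]].
      + right; exists p; rewrite u1 //; split=> // m mp; rewrite u1 ?fp //.
        exact: lt_trans mp pj.
      + subst p; apply: lex_first => n hn ne.
        case: (lt_total n j) => [nj|[e'|jn]].
        * by case: ne; rewrite u1 // fp.
        * by case: ne; rewrite e' u2.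
        * by rewrite u3 // in ne *; case: (bW n) => // ->; apply: lt01.
      + by move: hp; rewrite (cj p) // => /not01. }
  exists h; split=> // n; split=> [hn|[X KX]].
  - have [f [bf [[_ [h1 _]] a]]] := approx (n + 1).
    by exists (col f (n + 1)); apply: (proj1 (h1 n)); rewrite a //; apply: ltS.
  - have [f [bf [[_ [h1 _]] a]]] := approx n.
    (* Take the part of [f] below [n], add the index [n] with its witness [X], and stop there: as
       column 0 of the result is bounded by [h], it forces [h n = 1]. *)
    have [g [g0 [g1 g2]]] := pack
      (lamM (fun j => cond (j < n) (col f 0 @ j) (cond (j = n) 1 0)))
      (lamM (fun j => lamM (fun m =>
         cond (j < n) (col f (j + 1) @ m) (cond (j = n) (X @ m) 0)))).
    have W j : col g 0 @ j = cond (j < n) (col f 0 @ j) (cond (j = n) 1 0).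
      by rewrite g0 lamE //; def.
    have Z j m : col g (j + 1) @ m
        = cond (j < n) (col f (j + 1) @ m) (cond (j = n) (X @ m) 0).
      by rewrite g1 !lamE //; def.
    have Wlt j : j < n -> col g 0 @ j = col f 0 @ j by move=> jn; rewrite W condT.
    have Wn : col g 0 @ n = 1 by rewrite W condF ?condT //; apply: lt_irr.
    have Wgt j : n < j -> col g 0 @ j = 0.
      move=> nj; rewrite W !condF // => [jn|e]; first by apply: lt_irr (lt_trans jn nj).
      by rewrite e in nj; apply: lt_irr nj.
    have wg : witness g.
    { split; first by exists (n + 1) => j /ltSl/Wgt.
      split=> // j; case: (lt_total j n) => [jn|[->|nj]].
      + rewrite Wlt // (_ : col g (j + 1) = col f (j + 1)); last exact: h1.
        by apply: app_ext => m; rewrite Z condT.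
      + rewrite Wn (_ : col g (n + 1) = X); last by split=> // /not10.
        by apply: app_ext => m; rewrite Z condF ?condT //; apply: lt_irr.
      + rewrite Wgt //; split=> [/not01 //|_ m]; rewrite Z !condF // => [jn|e].
          exact: lt_irr (lt_trans jn nj).
        by rewrite e in nj; apply: lt_irr nj. }
    have bg : bin g.
    { apply: witness_bin wg => j; case: (lt_total j n) => [jn|[->|nj]].
      + by rewrite Wlt //; apply: bin_col.
      + by right.
      + by left; apply: Wgt. }
    case: (up g bg wg) => [<- //|[p [hp lp]]].
    case: (lt_total p n) => [pn|[e|np]].
    + by move: lp; rewrite Wlt // a // => /lt_irr.
    + by have [] := bin_lt (bin_col 0 bg) bh lp; rewrite e Wn => /not10.
    + by rewrite -hp.
Qed.

End Domain.

(** * Arithmetical formulas *)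

Section NormalForm.

Context {M : structure}.
Notation N := (M tO).
Notation tup := (@tup M).
Implicit Types x y z n m k i j a s t u v : N.
Implicit Types f g h e X Y Z W : M t1.

Lemma Def_shift G (X : tup G -> N) F : Def X -> Def F -> Def (fun p => shift (X p) (F p)).
Proof. by move=> DX DF; rewrite /shift; def. Qed.

(** No column contains the position [0], which carries the value [v]. *)
Definition node v (C : M (tO ⇒ t1)) : M t1 :=
  lamM (fun k => cond (exists a x, k = sq_snoc a x) (C @ ini k @ las k) v).

Lemma Def_node G (V : tup G -> N) C : Def V -> Def C -> Def (fun p => node (V p) (C p)).
Proof. by move=> DV DC; rewrite /node; def. Qed.

Lemma snoc_ne0 a x : sq_snoc a x <> 0.
Proof. exact: succ_ne0. Qed.

Lemma node0 v C : node v C @ 0 = v.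
Proof.
  rewrite /node lamE; first by def.
  by rewrite condF // => -[a [x e]]; apply: (@snoc_ne0 a x).
Qed.

Lemma col_node v C j : col (node v C) j = C @ j.
Proof.
  apply: app_ext => i; rewrite colE /node lamE; first by def.
  by rewrite condT ?ini_snoc ?las_snoc //; exists j, i.
Qed.

(** Stacks [X] in front of the columns of [g]; this is how a bound set variable enters the
    environment. *)
Definition ccons X g : M t1 := node 0 (lamM (fun j => lamM (fun i =>
  cond (j = 0) (X @ i) (g @ sq_snoc (pred j) i)))).

Lemma Def_ccons G (X F : tup G -> M t1) : Def X -> Def F -> Def (fun p => ccons (X p) (F p)).
Proof. by move=> DX DF; apply: Def_node; [apply: Def_const|def]. Qed.

Lemma ccons_app X g j i : col (ccons X g) j @ i
  = cond (j = 0) (X @ i) (g @ sq_snoc (pred j) i).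
Proof. by rewrite col_node !lamE //; def. Qed.

Lemma col_ccons0 X g : col (ccons X g) 0 = X.
Proof. by apply: app_ext => i; rewrite ccons_app condT. Qed.

Lemma col_cconsS X g j : col (ccons X g) (j + 1) = col g j.
Proof.
  apply: app_ext => i; rewrite ccons_app condF ?predS ?colE //; exact: succ_ne0.
Qed.

Lemma snoc_gt_r a x : x < sq_snoc a x.
Proof.
  apply/ltS_leE; apply: le_trans (le_addr _ _).
  case: (zero_or_pos (a + x)) => [e|p].
    by rewrite e mul0 -e; apply: le_addl.
  apply: le_trans (le_addl x a) _; rewrite -{1}(mul1 (a + x)).
  by rewrite !(mulC (a + x)); apply: le_mul_r; rewrite -(add0l 1); apply/ltSl.
Qed.

Lemma snoc_mono_l a x : sq_snoc a x < sq_snoc (a + 1) x.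
Proof.
  have l : a + x <= a + 1 + x by apply/le_add_r/leS.
  apply/lt_add/lt_le_trans; first exact: (lt_addl _ (ltS a)).
  by apply/le_add_r/le_mul.
Qed.

Lemma agree_ccons X X' g g' m :
  agree X X' m -> agree g g' m -> agree (ccons X g) (ccons X' g') m.
Proof.
  move=> aX ag k km; case: (classic (exists a x, k = sq_snoc a x)) => [[a [x e]]|ne].
    subst k; rewrite -!colE.
    case: (zero_or_pred a) => ea.
      by rewrite ea !col_ccons0; apply: aX; apply: lt_trans (snoc_gt_r a x) km.
    rewrite ea !col_cconsS !colE; apply: ag; apply: lt_trans km.
    by rewrite {2}ea; apply: snoc_mono_l.
  have DP : Dec (fun p : tup [tO] => exists a x, fst p = sq_snoc a x) by def.
  by rewrite /ccons /node !lamE ?condF //; def.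
Qed.

Lemma CT_ccons c d : CT c -> CT d -> CT (fun f => ccons (c f) (d f)).
Proof.
  move=> Cc Cd f k; have [m hm] := Cc f k; have [m' hm'] := Cd f k.
  exists (m + m') => f' ff'; apply: agree_ccons.
  - by apply: hm; apply: agree_le ff'; apply: le_addr.
  - by apply: hm'; apply: agree_le ff'; apply: le_addl.
Qed.

Definition local2 (P : M t1 -> M t1 -> Prop) := forall X Y, exists m, forall X' Y',
  agree X X' m -> agree Y Y' m -> P X Y <-> P X' Y'.

Lemma local2_LC P c d : local2 P -> CT c -> CT d -> LC (fun f => P (c f) (d f)).
Proof.
  move=> PL Cc Cd f; have [m hm] := PL (c f) (d f).
  have [k hk] := Cc f m; have [k' hk'] := Cd f m; exists (k + k') => f' ff'.
  apply: propositional_extensionality; apply: hm.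
  - by apply: hk; apply: agree_le ff'; apply: le_addr.
  - by apply: hk'; apply: agree_le ff'; apply: le_addl.
Qed.

(** Two arguments are put into columns 0 and 1 of one function; the last [X] in [J] is mere
    filler. *)
Lemma LC_local2 P : LC (fun f => P (col f 0) (col f 1)) -> local2 P.
Proof.
  move=> PL X Y; pose J X Y := ccons X (ccons Y X).
  have J0 X' Y' : col (J X' Y') 0 = X' by apply: col_ccons0.
  have J1 X' Y' : col (J X' Y') 1 = Y'.
    by rewrite /J -(add0l 1) col_cconsS col_ccons0.
  have [m hm] := PL (J X Y); exists m => X' Y' aX aY.
  have := hm (J X' Y'); rewrite !J0 !J1 => -> //.
  by do 2!apply: agree_ccons => //.
Qed.

(** [R e g] is computed by a solution [h] of [forall n, Q e g h n], which carries Skolem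
    functions for [R] and has the truth value of [R e g] at [0]; [H e g] is a solution. *)
Definition normal (R : M t1 -> M t1 -> Prop) :=
  exists (Q : M t1 -> M t1 -> M t1 -> N -> Prop) (H : M t1 -> M t1 -> M t1),
  (forall G (E F U : tup G -> M t1) K, Def E -> Def F -> Def U -> Def K ->
     Dec (fun p => Q (E p) (F p) (U p) (K p))) /\
  (forall G (E F : tup G -> M t1), Def E -> Def F -> Def (fun p => H (E p) (F p))) /\
  (forall e n, local2 (fun g h => Q e g h n)) /\
  (forall e g n, Q e g (H e g) n) /\
  (forall e g h, (forall n, Q e g h n) -> h @ 0 = chi (R e g)).

Lemma normal_atom (R : M t1 -> M t1 -> Prop) :
  (forall G (E F : tup G -> M t1), Def E -> Def F -> Dec (fun p => R (E p) (F p))) ->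
  (forall e, LC (fun g => R e g)) -> normal R.
Proof.
  move=> DR LR; exists (fun e g h n => h @ 0 = chi (R e g)).
  exists (fun e g => lamM (fun n => chi (R e g))).
  split; first by move=> *; def.
  split; first by move=> *; def.
  split.
    move=> e n; apply: LC_local2.
    apply: (LC_app2 eq); first by lc.
    by apply: (LC_app1 chi); apply: (LC_CT (F := R e)) => //; apply: CT_col.
  split=> [e g n|e g h /(_ 0)] //.
  by rewrite lamE //; def.
Qed.

(** Columns 0 and 1 hold solutions for the two parts. As these carry truth values rather than mere
    evidence, the value of the implication is computed from them, also when the premise is false. *)
Lemma normal_imp R1 R2 : normal R1 -> normal R2 -> normal (fun e g => R1 e g -> R2 e g).
Proof.
  move=> [Q1 [H1 [DQ1 [DH1 [L1 [S1 C1]]]]]] [Q2 [H2 [DQ2 [DH2 [L2 [S2 C2]]]]]].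
  exists (fun e g h n => (Q1 e g (col h 0) n /\ Q2 e g (col h 1) n) /\
    h @ 0 = cond (col h 0 @ 0 = 0 -> col h 1 @ 0 = 0) 0 1).
  pose V e g : N := cond (H1 e g @ 0 = 0 -> H2 e g @ 0 = 0) 0 1.
  pose C e g := lamM (fun j => lamM (fun i => cond (j = 0) (H1 e g @ i) (H2 e g @ i))).
  have CE e g : C e g @ 0 = H1 e g /\ C e g @ 1 = H2 e g.
    split; apply: app_ext => i; rewrite /C !lamE; try by def.
      by rewrite condT.
    by rewrite condF //; apply: not10.
  have DnC G (E F : tup G -> M t1) : Def E -> Def F -> Def (fun p => C (E p) (F p)).
    by move=> DE DF; rewrite /C; def.
  have DnV G (E F : tup G -> M t1) : Def E -> Def F -> Def (fun p => V (E p) (F p)).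
    by move=> DE DF; rewrite /V; def.
  exists (fun e g => node (V e g) (C e g)).
  split; first by move=> *; def.
  split; first by move=> *; apply: Def_node; auto.
  split.
  { move=> e n; apply: LC_local2; apply: (LC_app2 and); first apply: (LC_app2 and).
    - by apply: (local2_LC (L1 e n)); lc.
    - by apply: (local2_LC (L2 e n)); lc.
    - apply: (LC_app2 eq); first by lc.
      by apply: (LC_app1 (fun P => cond P 0 1)); lc. }
  split.
    move=> e g n; rewrite !col_node node0 !(proj1 (CE e g)) !(proj2 (CE e g)).
    by split; [split|].
  move=> e g h hQ; have [_ ->] := hQ 0; rewrite chi_cond; apply: chi_ext.
  have -> : col h 0 @ 0 = chi (R1 e g) by apply: C1 => n; case: (hQ n) => -[].
  have -> : col h 1 @ 0 = chi (R2 e g) by apply: C2 => n; case: (hQ n) => -[].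
  by rewrite !chi0.
Qed.

(** Column [m + 1] holds a solution for the instance [m], obtained uniformly from [H]. If the value
    is 0, all instances must be true; if it is 1, the first entry of column 0 names a false one. *)
Lemma normal_all R : normal R -> normal (fun e g => forall m, R (shift m e) g).
Proof.
  move=> [Q [H [DQ [DH [L [S C]]]]]]; have DS := Def_shift.
  exists (fun e g h k => Q (shift (ini k) e) g (col h (ini k + 1)) (las k) /\
    ((h @ 0 = 0 /\ col h (ini k + 1) @ 0 = 0) \/
     (h @ 0 = 1 /\ col h (col h 0 @ 0 + 1) @ 0 = 1))).
  pose V e g : N := cond (forall m, H (shift m e) g @ 0 = 0) 0 1.
  pose B e g := lamM (fun j => lamM (fun i => cond (j = 0)
    (some (fun m => H (shift m e) g @ 0 = 1)) (H (shift (pred j) e) g @ i))).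
  have H01 e g : H e g @ 0 = chi (R e g) by apply: C.
  have BS e g j : B e g @ (j + 1) = H (shift j e) g.
    apply: app_ext => i; rewrite /B !lamE; [by def|by def|].
    rewrite condF ?predS //; exact: succ_ne0.
  have B0 e g i : B e g @ 0 @ i = some (fun m => H (shift m e) g @ 0 = 1).
    by rewrite /B !lamE; [by def|by def|rewrite condT].
  exists (fun e g => node (V e g) (B e g)).
  split; first by move=> *; def.
  split; first by move=> *; apply: Def_node; rewrite /V /B; def.
  split.
    move=> e k; apply: LC_local2; apply: (LC_app2 and).
      by apply: (local2_LC (L _ _)); lc.
    apply: (LC_app2 or); first by lc.
    apply: (LC_app2 and); first by lc.
    apply: (LC_app1 (fun x => x = 1)).
    (* The index of the column depends on [f], so the column is traded for an evaluation at a
       computed position. *)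
    have -> : (fun f => col (col f 1) (col (col f 1) 0 @ 0 + 1) @ 0) =
        (fun f => col f 1 @ sq_snoc (col f 1 @ sq_snoc 0 0 + 1) 0).
      by apply: functional_extensionality => f; rewrite -!colE.
    apply: LC_app_CT; first by lc.
    apply: (LC_app1 (fun x => sq_snoc (x + 1) 0)
        (F := fun f => col f 1 @ sq_snoc 0 0)); lc.
  split.
    move=> e g k; rewrite !col_node node0 !BS B0; split; first exact: S.
    rewrite /V; case: (classic (forall m, H (shift m e) g @ 0 = 0)) => h.
      by left; rewrite condT.
    right; rewrite condF //; split=> //; move: h; set P := (fun m => _ = 1) => h.
    apply: (someP (P := P)); first by rewrite /P; def.
    apply: NNPP => ne; apply: h => m; rewrite H01.
    case: (@chi01 M (R (shift m e) g)) => [//|c].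
    by case: ne; exists m; rewrite /P H01.
  move=> e g h hQ.
  have hc m : col h (m + 1) @ 0 = chi (R (shift m e) g).
    by apply: C => n; have [] := hQ (sq_snoc m n); rewrite ini_snoc las_snoc.
  case: (classic (h @ 0 = 0)) => h0.
    rewrite h0; apply/eq_sym/chi0 => m; have [_ []] := hQ (sq_snoc m 0).
      by rewrite ini_snoc hc => -[_ /chi0].
    by rewrite h0 => -[/not01].
  have [_ [[/h0 //]|[-> w]]] := hQ 0.
  rewrite hc in w; rewrite -chi_cond condF // => r.
  by apply: (@not01 M); rewrite -w; apply/eq_sym/chi0; apply: r.
Qed.

End NormalForm.

(** * Semantics of second-order formulas and comprehension *)

Section SecondOrder.

Context {M : structure}.
Notation N := (M tO).
Notation tup := (@tup M).
Implicit Types n m k i j : N.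
Implicit Types f g h e X Y Z : M t1.

Fixpoint ev2 (A : Set) (nu : A -> N) (u : tm2 A) : N :=
  match u with
  | Var2 x => nu x
  | Zero2 => 0
  | One2 => 1
  | Add2 u v => ev2 nu u + ev2 nu v
  | Mul2 u v => ev2 nu u * ev2 nu v
  end.

Definition oc (A : Set) (T : Type) (nu : A -> T) (x : T) (o : option A) : T :=
  match o with None => x | Some y => nu y end.

Fixpoint sem2 (A P : Set) (a : fm2 A P) : (A -> N) -> (P -> M t1) -> Prop :=
  match a with
  | Eq2 u v => fun nu xi => ev2 nu u = ev2 nu v
  | Lt2 u v => fun nu xi => ev2 nu u < ev2 nu v
  | Mem2 u X => fun nu xi => xi X @ ev2 nu u = 1
  | Bot2 => fun nu xi => False
  | Imp2 a b => fun nu xi => sem2 a nu xi -> sem2 b nu xi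
  | AllN a => fun nu xi => forall n, sem2 a (oc nu n) xi
  | AllS a => fun nu xi => forall X, bin X -> sem2 a nu (oc xi X)
  end.

Lemma sem2_And A P (a b : fm2 A P) nu xi :
  sem2 (And2 a b) nu xi <-> sem2 a nu xi /\ sem2 b nu xi.
Proof. by split=> /= [h|[] ? ? h]; [split; apply: NNPP|]; tauto. Qed.

Lemma sem2_Or A P (a b : fm2 A P) nu xi :
  sem2 (Or2 a b) nu xi <-> sem2 a nu xi \/ sem2 b nu xi.
Proof. by rewrite /=; split=> [h|]; [case: (classic (sem2 a nu xi))|]; tauto. Qed.

Lemma sem2_Iff A P (a b : fm2 A P) nu xi :
  sem2 (Iff2 a b) nu xi <-> (sem2 a nu xi <-> sem2 b nu xi).
Proof. by rewrite sem2_And /=; tauto. Qed.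

Lemma sem2_ExS A P (a : fm2 A (option P)) nu xi :
  sem2 (ExS a) nu xi <-> exists X, bin X /\ sem2 a nu (oc xi X).
Proof.
  rewrite /=; split=> [h|[X [bX aX]] h]; last by apply: (h X).
  by apply: NNPP => n; apply: h => X bX aX; apply: n; exists X.
Qed.

Lemma ev2_tr (A : Set) W (r : env W M) (nu : A -> tm W tO) u :
  ev r (tr_tm nu u) = ev2 (fun x => ev r (nu x)) u.
Proof. by elim: u => //= u -> v ->. Qed.

Lemma oc_ocons (A : Set) W s t (r : env W M) (x : M s) (nu : A -> tm W t) u :
  (fun y => ev (econs x r) (ocons nu u y)) =
  oc (fun y => ev r (nu y)) (ev (econs x r) u).
Proof. by apply: functional_extensionality => -[y|] //=; rewrite /wk ev_ren. Qed.

Lemma sat_tr A P (a : fm2 A P) W (r : env W M) nu xi :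
  sat r (tr a nu xi) <-> sem2 a (fun x => ev r (nu x)) (fun p => ev r (xi p)).
Proof.
  elim: a W r nu xi => {A P} [A P u v|A P u v|A P u X|A P|A P a IHa b IHb|A P a IH|A P a IH]
    W r nu xi //=.
  - by rewrite !ev2_tr.
  - by rewrite !ev2_tr.
  - by rewrite ev2_tr.
  - by rewrite IHa IHb.
  - have e n : (fun p => ev (econs n r) (wk (xi p))) = fun p => ev r (xi p).
      by apply: functional_extensionality => p; rewrite /wk ev_ren.
    by split=> h n; have := h n; rewrite IH oc_ocons e.
  - have e X : (fun x => ev (econs X r) (wk (nu x))) = fun x => ev r (nu x).
      by apply: functional_extensionality => x; rewrite /wk ev_ren.
    rewrite -[forall x, _]/(sat r (AllC _)) sat_AllC.
    by split=> h X bX; have := h X bX; rewrite IH oc_ocons e.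
Qed.

Lemma ev2_ren (A B : Set) (r : A -> B) nu u : ev2 nu (ren_tm2 r u) = ev2 (fun x => nu (r x)) u.
Proof. by elim: u => //= u -> v ->. Qed.

Lemma sem2_ren (A P : Set) (a : fm2 A P) (B R : Set) (r : A -> B) (q : P -> R) nu xi :
  sem2 (ren_fm2 r q a) nu xi <-> sem2 a (fun x => nu (r x)) (fun p => xi (q p)).
Proof.
  elim: a B R r q nu xi => {A P} [A P u v|A P u v|A P u X|A P|A P a IHa b IHb|A P a IH|A P a IH]
    B R r q nu xi //=; rewrite ?ev2_ren //.
  - by rewrite IHa IHb.
  - have e n : (fun x => oc nu n (option_map r x)) = oc (fun x => nu (r x)) n.
      by apply: functional_extensionality => -[].
    by split=> h n; have := h n; rewrite IH e.
  - have e X : (fun x => oc xi X (option_map q x)) = oc (fun x => xi (q x)) X.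
      by apply: functional_extensionality => -[].
    by split=> h X bX; have := h X bX; rewrite IH e.
Qed.

Lemma sem2_closeN (n : nat) P (a : fm2 (fin n) P) nu xi :
  (forall nu, sem2 a nu xi) -> sem2 (closeN a) nu xi.
Proof.
  elim: n P a nu xi => [|n IH] P a nu xi h /=; first exact: h.
  by apply: IH => nu' k; apply: h.
Qed.

Lemma sem2_closeS (m : nat) A (a : fm2 A (fin m)) nu xi :
  (forall xi, (forall p, bin (xi p)) -> sem2 a nu xi) -> sem2 (closeS a) nu xi.
Proof.
  elim: m A a nu xi => [|m IH] A a nu xi h /=; first by apply: h; case.
  by apply: IH => xi' bxi X bX; apply: h => -[].
Qed.

Fixpoint num (n : nat) : N := match n with O => 0 | S n => num n + 1 end.

Definition push (A : Set) (io : A -> nat) (o : option A) : nat :=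
  match o with None => O | Some x => S (io x) end.

Lemma shift_push (A : Set) (io : A -> nat) m e :
  (fun x => shift m e @ num (push io x)) = oc (fun x => e @ num (io x)) m.
Proof.
  by apply: functional_extensionality => -[x|] /=; [apply: shiftS|apply: shift0].
Qed.

Lemma ccons_push (A : Set) (ka : A -> nat) X g :
  (fun p => col (ccons X g) (num (push ka p))) = oc (fun p => col g (num (ka p))) X.
Proof.
  by apply: functional_extensionality => -[p|] /=; [apply: col_cconsS|apply: col_ccons0].
Qed.

Lemma Def_ev2 G (A : Set) (io : A -> nat) (E : tup G -> M t1) u :
  Def E -> Def (fun p => ev2 (fun x => E p @ num (io x)) u).
Proof. by move=> DE; elim: u => /= *; def. Qed.

(** Number variables live at positions of [e], set variables in columns of [g], numbered by de
    Bruijn depth. A number quantifier thus becomes [shift], and [g] stays fixed as no set quantifier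
    occurs. *)
Lemma normal_arith A P (a : fm2 A P) (io : A -> nat) (ka : P -> nat) : arithmetical a ->
  normal (fun e g => sem2 a (fun x => e @ num (io x)) (fun p => col g (num (ka p)))).
Proof.
  have DE := Def_ev2.
  elim: a io ka => {A P} [A P u v|A P u v|A P u X|A P|A P a IHa b IHb|A P a IH|A P a IH]
    io ka //=.
  - move=> _; apply: normal_atom => [*|e]; [by def|exact: LC_const].
  - move=> _; apply: normal_atom => [*|e]; [by def|exact: LC_const].
  - move=> _; apply: normal_atom => [*|e]; first by def.
    by lc.
  - move=> _; apply: normal_atom => [*|e]; [by def|exact: LC_const].
  - by move=> [/IHa na /IHb nb]; apply: normal_imp.
  - move=> /IH ha; have := normal_all (ha (push io) ka).
    congr normal; apply: functional_extensionality => e.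
    apply: functional_extensionality => g; apply: propositional_extensionality.
    by split=> h m; have := h m; rewrite shift_push.
Qed.

Fixpoint idx (n : nat) : fin n -> nat :=
  match n with
  | O => fun x => match x with end
  | S n => push (@idx n)
  end.

Lemma numbers_exist (n : nat) (nu : fin n -> N) : exists e, (fun x => e @ num (idx x)) = nu.
Proof.
  elim: n nu => [|n IH] nu.
    by exists (lamM (fun _ => 0)); apply: functional_extensionality => -[].
  have [e he] := IH (fun x => nu (Some x)).
  exists (shift (nu None) e); rewrite [idx (n := _)]/= shift_push he.
  by apply: functional_extensionality => -[].
Qed.

Lemma columns_exist (m : nat) (xi : fin m -> M t1) : exists g, (fun p => col g (num (idx p))) = xi.
Proof.
  elim: m xi => [|m IH] xi.
    by exists (lamM (fun _ => 0)); apply: functional_extensionality => -[].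
  have [g hg] := IH (fun x => xi (Some x)).
  exists (ccons (xi None) g); rewrite [idx (n := _)]/= ccons_push hg.
  by apply: functional_extensionality => -[].
Qed.

(** [kondo (child Q)] has a solution at [i] exactly when some binary [X] has a well-founded tree,
    and then only one. *)
Lemma sigma12_set (Q : N -> N -> M t1 -> M t1 -> Prop) :
  (forall G (I J : tup G -> N) (X Y : tup G -> M t1), Def I -> Def J -> Def X -> Def Y ->
     Dec (fun p => Q (I p) (J p) (X p) (Y p))) ->
  (forall i n, local2 (fun X Y => Q i n X Y)) ->
  exists h, bin h /\
    forall i, h @ i = 1 <-> exists X, bin X /\ ~ exists Y, forall n, Q i n X Y.
Proof.
  move=> DQ LQ; have DC := Dec_child DQ; have CL := @child_local M Q.
  have [||h [bh hh]] := @bw_domain M (kondo (child Q)) (Dec_kondo DC CL).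
  - by move=> i X [].
  - exact: kondo_unique DC CL.
  - exists h; split=> // i; rewrite hh; split=> -[X].
    + by move=> [bX [/(WF_child DQ LQ) wX _]]; exists X.
    + move=> [bX /(WF_child DQ LQ)].
      exact: (kondo_exists DC CL (@child_lt M Q) (@child_parent M Q)).
Qed.

(** The complement of the [Π¹₂] set is [Σ¹₂]; its inner quantifier over [Y] absorbs the Skolem
    functions of the matrix. *)
Lemma comprehension (n m : nat) (b : fm2 (option (fin n)) (option (option (fin m))))
    nu xi : arithmetical b ->
  exists X, bin X /\ forall i, X @ i = 1 <-> sem2 (AllS (ExS b)) (oc nu i) xi.
Proof.
  move=> ab.
  have [Q [H [DQ [DH [L [S C]]]]]] :=
    normal_arith (push (@idx n)) (push (push (@idx m))) ab.
  have [e he] := numbers_exist nu; have [g hg] := columns_exist xi.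
  (* Column 0 of [Z] is the set [Y], column 1 a solution for the matrix, whose first value must be
     0, that is, true. *)
  pose R i k X Z := (col Z 0 @ k = 0 \/ col Z 0 @ k = 1) /\ col Z 1 @ 0 = 0 /\
    Q (shift i e) (ccons (col Z 0) (ccons X g)) (col Z 1) k.
  have RE i X : (exists Z, forall k, R i k X Z) <->
      exists Y, bin Y /\ sem2 b (oc nu i) (oc (oc xi X) Y).
  { have semE Y : sem2 b (oc nu i) (oc (oc xi X) Y) = sem2 b
        (fun x => shift i e @ num (push (@idx n) x))
        (fun p => col (ccons Y (ccons X g)) (num (push (push (@idx m)) p))).
      by rewrite shift_push !ccons_push he hg.
    split=> [[Z hZ]|[Y [bY bXY]]].
    - exists (col Z 0); split; first by move=> k; case: (hZ k).
      rewrite semE; apply/(chi0 (M := M)); rewrite -(C _ _ (col Z 1)).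
        by move=> k; have [_ [_]] := hZ k.
      by have [_ []] := hZ 0.
    - have [Z [Z0 Z1]] := join_cols Y (H (shift i e) (ccons Y (ccons X g))).
      exists Z => k; rewrite /R Z0 Z1; split; first exact: bY.
      split; last exact: S.
      by rewrite (C _ _ _ (S _ _)); apply/chi0; rewrite -semE. }
  have DS := @Def_shift M; have DCC := @Def_ccons M.
  have [||h [bh hh]] := @sigma12_set R.
  - by move=> *; rewrite /R; def.
  - move=> i k; apply: LC_local2; rewrite /R; apply: (LC_app2 and); first by lc.
    apply: (LC_app2 and); first by lc.
    apply: (local2_LC (L _ _)); last by lc.
    by apply: CT_ccons; last apply: CT_ccons; lc.
  (* Passage to the complement; here 1 stands for membership, unlike in [chi]. *)
  - exists (lamM (fun i => cond (h @ i = 1) 0 1)).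
    have E i : lamM (fun i => cond (h @ i = 1) 0 1) @ i = cond (h @ i = 1) 0 1 :> N.
      by rewrite lamE //; def.
    split=> i; rewrite E.
      by case: (classic (h @ i = 1)) => c; [left; rewrite condT|right; rewrite condF].
    case: (classic (h @ i = 1)) => c.
    + rewrite condT //; split=> [/not01 //|all]; exfalso.
      have [X [bX nX]] := proj1 (hh i) c; apply: nX; apply/RE.
      by apply/sem2_ExS; apply: all.
    + rewrite condF //; split=> // _ X bX; apply/sem2_ExS; apply/RE.
      by apply: NNPP => nX; apply: c; apply/hh; exists X.
Qed.

Lemma sem2_Pi12CA0 (a : sentence2) nu xi : Pi12CA0 a -> sem2 a nu xi.
Proof.
  case=> {a} [|||||||||n m a [b [ab ->]]] /=.
  - by move=> n; apply: succ_ne0.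
  - by move=> n m; apply: add_inj.
  - by move=> n; apply: add0.
  - by move=> n m; apply: addA.
  - by move=> n; apply: mul0.
  - by move=> n m; rewrite mulD mul1.
  - by move=> n; apply: lt0.
  - move=> n m; apply: (proj2 (sem2_Iff (Lt2 x1 (Add2 x0 One2))
      (Or2 (Lt2 x1 x0) (Eq2 x1 x0)) (oc (oc nu n) m) xi)).
    by rewrite sem2_Or; apply: ltS_le.
  - move=> X bX h; have [X0 XS] := proj1 (sem2_And (Mem2 Zero2 None)
      (AllN (Imp2 (Mem2 x0 None) (Mem2 (Add2 x0 One2) None))) nu (oc xi X)) h.
    by apply: ind => //; def.
  - apply: sem2_closeS => xi' _; apply: sem2_closeN => nu'.
    have [X [bX hX]] := comprehension nu' xi' ab.
    apply/sem2_ExS; exists X; split=> // i.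
    apply: (proj2 (sem2_Iff (Mem2 x0 None) (ren_fm2 (fun x => x) Some (AllS (ExS b)))
      (oc nu' i) (oc xi' X))).
    by rewrite sem2_ren; apply: hX.
Qed.

End SecondOrder.

Theorem theorem3p25 : proves_system (add_axiom Pi11CA0w BW0C) Pi12CA0.
Proof.
  move=> a ax; apply: completeness.
  - exact: theory_sub.
  - by move=> V r t x y f; left; left; constructor.
  - move=> M MT; apply/(sat_tr (M := Structure MT)); exact: sem2_Pi12CA0.
Qed.
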